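(* Let $p$ be a prime. The theory $\operatorname{SDCF}^{\ell}_{p,\infty}$ has quantifier elimination. In particular, $\operatorname{SDCF}^{\ell}_{p,\infty}$ is the model-completion of $\operatorname{DF}^{\ell}_{p,\infty}$.
   Context: Let $(K,\delta)$ be a differential field of characteristic $p$ with constant field $C_K$. A tuple or set from $K$ is differentially $p$-independent if all its elements lie in $C_K$ and its $p$-monomials $a_1^{i_1}\cdots a_n^{i_n}$ (distinct $a_j$, $0\le i_j<p$) are linearly independent over $K^p$. For each $n\in\mathbb{N}_0$ let $s_n=p^n-1$ and fix an enumeration $m_0,\dots,m_{s_n}$ of the monomial functions $y_1^{i_1}\cdots y_n^{i_n}$, $0\le i_j<p$. The language $\mathcal{L}_{\delta,\ell}$ is the language of differential fields $\{0,1,+,-,\cdot,{}^{-1},\delta\}$ with $(n+1)$-ary function symbols $\ell_{n,i}$ ($n\in\mathbb{N}_0$, $0\le i\le s_n$), interpreted as follows: for $(a_1,\dots,a_n;b)\in K^{n+1}$, $\ell_{n,i}(\bar a;b)=0$ for all $i$ if some entry is not in $C_K$, or if $(a_1,\dots,a_n)$ is differentially $p$-dependent, or if $(a_1,\dots,a_n,b)$ is differentially $p$-independent; otherwise the $\ell_{n,i}(\bar a;b)$ are the unique elements with $b=\sum_{i=0}^{s_n}\ell_{n,i}(\bar a;b)^p m_i(\bar a)$. $\operatorname{DF}^{\ell}_{p,\infty}$ is the $\mathcal{L}_{\delta,\ell}$-theory of differential fields of characteristic $p$ with $[C_K:K^p]$ infinite and with the $\ell_{n,i}$ so interpreted. $\operatorname{SDCF}^{\ell}_{p,\infty}$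 adds the axioms of separably differentially closed fields: for all nonzero $f,g\in K\{x\}$ with $f\notin K$, separant $s_f=\partial f/\partial x_{\operatorname{ord} f}\ne0$ and $\operatorname{ord} g<\operatorname{ord} f$, there is $a\in K$ with $f(a)=0\neq g(a)$ (here $K\{x\}=K[x_0,x_1,\dots]$, $x_j=\delta^jx$). *)

(* Defs.v *)
From mathcomp Require Import all_boot all_algebra.
From mathcomp.multinomials Require Import mpoly.

Set Implicit Arguments.
Unset Strict Implicit.
Unset Printing Implicit Defensive.

Import GRing.Theory.
Local Open Scope ring_scope.

(** * First-order logic with equality over a functional signature *)

Record language := Language { fsym : Type; arity : fsym -> nat }.

(* Empty carriers are not excluded; they cannot occur as soon as the language
   has a constant symbol, as all languages used below do. *)
Record structure (L : language) := Structure {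
  carrier :> Type;
  interp : forall f : fsym L, ('I_(arity f) -> carrier) -> carrier }.

(* [term L n] and [formula L n]: free variables among x_0, ..., x_(n-1).
   A quantifier binds variable 0 of its body and shifts the others up. *)
Inductive term (L : language) (n : nat) : Type :=
| Var (i : 'I_n)
| App (f : fsym L) (args : 'I_(arity f) -> term L n).

Inductive formula (L : language) : nat -> Type :=
| FFalse n : formula L n
| FEq n : term L n -> term L n -> formula L n
| FImp n : formula L n -> formula L n -> formula L n
| FAnd n : formula L n -> formula L n -> formula L n
| FOr n : formula L n -> formula L n -> formula L n
| FAll n : formula L n.+1 -> formula L n
| FEx n : formula L n.+1 -> formula L n.

Arguments FFalse {L n}.

Definition FNot L n (phi : formula L n) : formula L n := FImp phi FFalse.
Definition FIff L n (phi psi : formula L n) : formula L n :=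
  FAnd (FImp phi psi) (FImp psi phi).

Definition sentence L := formula L 0.
Definition theory L := sentence L -> Prop.

Fixpoint quantifier_free L n (phi : formula L n) : Prop :=
  match phi with
  | FFalse _ | FEq _ _ _ => True
  | FImp _ a b | FAnd _ a b | FOr _ a b =>
      quantifier_free a /\ quantifier_free b
  | FAll _ _ | FEx _ _ => False
  end.

Definition scons (T : Type) n (x : T) (v : 'I_n -> T) : 'I_n.+1 -> T :=
  fun i => if unlift ord0 i is Some j then v j else x.

Fixpoint eval L (M : structure L) n (v : 'I_n -> M) (t : term L n) : M :=
  match t with
  | Var i => v i
  | App f args => interp (fun j => eval v (args j))
  end.

Fixpoint holds L (M : structure L) n (phi : formula L n) :
    ('I_n -> M) -> Prop :=
  match phi with
  | FFalse _ => fun _ => False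
  | FEq _ s t => fun v => eval v s = eval v t
  | FImp _ a b => fun v => holds a v -> holds b v
  | FAnd _ a b => fun v => holds a v /\ holds b v
  | FOr _ a b => fun v => holds a v \/ holds b v
  | FAll _ a => fun v => forall x : M, holds a (scons x v)
  | FEx _ a => fun v => exists x : M, holds a (scons x v)
  end.

Definition valid_in L (M : structure L) n (phi : formula L n) : Prop :=
  forall v : 'I_n -> M, holds phi v.

Definition is_model L (T : theory L) (M : structure L) : Prop :=
  forall sigma, T sigma -> valid_in M sigma.

Definition entails L (T : theory L) n (phi : formula L n) : Prop :=
  forall M : structure L, is_model T M -> valid_in M phi.

Definition complete L (T : theory L) : Prop :=
  (exists M : structure L, is_model T M) /\
  (forall sigma : sentence L, entails T sigma \/ entails T (FNot sigma)).

Definition has_quantifier_elimination L (T : theory L) : Prop :=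
  forall n (phi : formula L n),
    exists psi : formula L n, quantifier_free psi /\ entails T (FIff phi psi).

Definition embedding L (M N : structure L) (h : M -> N) : Prop :=
  injective h /\
  (forall (f : fsym L) (x : 'I_(arity f) -> M),
     h (interp x) = interp (fun j => h (x j))).

Definition elementary L (M N : structure L) (h : M -> N) : Prop :=
  forall n (phi : formula L n) (v : 'I_n -> M),
    holds phi v <-> holds phi (fun i => h (v i)).

Definition embeds_into_model L (M : structure L) (T : theory L) : Prop :=
  exists (N : structure L) (h : M -> N), is_model T N /\ embedding h.

Definition model_complete L (T : theory L) : Prop :=
  forall (M N : structure L) (h : M -> N),
    is_model T M -> is_model T N -> embedding h -> elementary h.

Definition model_companion L (Tstar T : theory L) : Prop :=
  [/\ forall M, is_model T M -> embeds_into_model M Tstar,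
      forall M, is_model Tstar M -> embeds_into_model M T
    & model_complete Tstar].

(** ** Diagrams *)

Definition with_constants (L : language) (C : Type) : language :=
  @Language (fsym L + C)
    (fun s => match s with inl f => arity f | inr _ => 0%N end).

Fixpoint lift_term L C n (t : term L n) : term (with_constants L C) n :=
  match t with
  | Var i => Var _ i
  | App f args =>
      @App (with_constants L C) n (inl f) (fun j => lift_term C (args j))
  end.

Fixpoint lift_formula L C n (phi : formula L n) :
    formula (with_constants L C) n :=
  match phi with
  | FFalse _ => FFalse
  | FEq _ s t => FEq (lift_term C s) (lift_term C t)
  | FImp _ a b => FImp (lift_formula C a) (lift_formula C b)
  | FAnd _ a b => FAnd (lift_formula C a) (lift_formula C b)
  | FOr _ a b => FOr (lift_formula C a) (lift_formula C b)
  | FAll _ a => FAll (lift_formula C a)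
  | FEx _ a => FEx (lift_formula C a)
  end.

Definition name_elements L (M : structure L) :
    structure (with_constants L M) :=
  @Structure (with_constants L M) M
    (fun s => match s with
              | inl f => fun x => @interp L M f x
              | inr c => fun _ => c
              end).

Definition literal L n (phi : formula L n) : Prop :=
  exists s t : term L n, phi = FEq s t \/ phi = FNot (FEq s t).

Definition diagram L (M : structure L) : theory (with_constants L M) :=
  fun sigma => literal sigma /\ valid_in (name_elements M) sigma.

Arguments diagram {L} M _.

Definition add_diagram L (T : theory L) (M : structure L) :
    theory (with_constants L M) :=
  fun sigma => (exists2 tau, T tau & sigma = lift_formula M tau)
               \/ diagram M sigma.

Arguments add_diagram {L} T M _.

Definition model_completion L (Tstar T : theory L) : Prop :=
  model_companion Tstar T /\
  (forall M : structure L, is_model T M -> complete (add_diagram Tstar M)).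

(** * Differential fields of characteristic [p] *)

Section DifferentialFields.

Variables (p : nat) (K : fieldType) (delta : K -> K).

Definition derivation : Prop :=
  (forall x y, delta (x + y) = delta x + delta y) /\
  (forall x y, delta (x * y) = delta x * y + x * delta y).

Definition diff_constant (x : K) : Prop := delta x = 0.

(* The scalars c i ^+ p are arbitrary elements of the field K^p. *)
Definition lin_indep_over_Kp (I : finType) (u : I -> K) : Prop :=
  forall c : I -> K, \sum_i c i ^+ p * u i = 0 -> forall i, c i ^+ p = 0.

(* [C_K : K^p] is infinite. *)
Definition infinite_degree : Prop :=
  forall n, exists u : 'I_n -> K,
    (forall i, diff_constant (u i)) /\ lin_indep_over_Kp u.

Definition pmonomial n (e : {ffun 'I_n -> 'I_p}) (a : 'I_n -> K) : K :=
  \prod_j a j ^+ e j.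

(* The p-monomials form a family indexed by the exponents, so a tuple with a
   repeated entry is dependent; the empty tuple is independent. *)
Definition diff_p_indep n (a : 'I_n -> K) : Prop :=
  (forall j, diff_constant (a j)) /\
  lin_indep_over_Kp (fun e : {ffun 'I_n -> 'I_p} => pmonomial e a).

Definition tuple_init n (x : 'I_n.+1 -> K) : 'I_n -> K :=
  fun j => x (widen_ord (leqnSn n) j).

(* [x] stands for (a_1, ..., a_n; b), with a = tuple_init x, b = x ord_max. *)
Definition ell_degenerate n (x : 'I_n.+1 -> K) : Prop :=
  [\/ ~ (forall j, diff_constant (x j)),
      ~ diff_p_indep (tuple_init x)
    | diff_p_indep x].

Definition ell_spec (m : forall n, 'I_(p ^ n) -> {ffun 'I_n -> 'I_p})
    (ell : forall n, 'I_(p ^ n) -> ('I_n.+1 -> K) -> K) : Prop :=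
  forall n (x : 'I_n.+1 -> K),
    (ell_degenerate x -> forall i, ell n i x = 0) /\
    (~ ell_degenerate x ->
       x ord_max =
       \sum_(i < p ^ n) ell n i x ^+ p * pmonomial (m n i) (tuple_init x)).

(* A differential polynomial is an element of K[x_0, ..., x_(N-1)] for some N,
   K{x} being the union of these rings. *)
Definition diff_eval N (f : {mpoly K[N]}) (a : K) : K :=
  f.@[fun j : 'I_N => iter j delta a].

Definition occurs N (j : 'I_N) (f : {mpoly K[N]}) : Prop :=
  exists2 e : 'X_{1..N}, e \in msupp f & (0 < e j)%N.

(* [has_order f k] implies that f is not in K. *)
Definition has_order N (f : {mpoly K[N]}) (k : 'I_N) : Prop :=
  occurs k f /\ (forall j, occurs j f -> (j <= k)%N).

(* Elements of K have order smaller than any k. *)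
Definition order_lt N (g : {mpoly K[N]}) (k : nat) : Prop :=
  forall j, occurs j g -> (j < k)%N.

Definition separably_diff_closed : Prop :=
  forall N (f g : {mpoly K[N]}) (k : 'I_N),
    has_order f k -> f^`M(k) != 0 -> g != 0 -> order_lt g k ->
    exists a : K, diff_eval f a = 0 /\ diff_eval g a != 0.

End DifferentialFields.

(** * The language of differential fields with lambda-like functions *)

(* The indices 0 <= i <= s_n = p ^ n - 1 are the elements of 'I_(p ^ n). *)
Inductive dl_symbol (p : nat) : Type :=
| SZero | SOne | SAdd | SOpp | SMul | SInv | SDelta
| SEll (n : nat) (i : 'I_(p ^ n)).

Definition dl_arity p (s : dl_symbol p) : nat :=
  match s with
  | SZero | SOne => 0
  | SOpp | SInv | SDelta => 1
  | SAdd | SMul => 2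
  | SEll n _ => n.+1
  end.

Definition L_dl (p : nat) : language := Language (@dl_arity p).

Definition dl_structure (p : nat) (K : fieldType) (delta : K -> K)
    (ell : forall n, 'I_(p ^ n) -> ('I_n.+1 -> K) -> K) : structure (L_dl p) :=
  @Structure (L_dl p) K
    (fun s : dl_symbol p =>
       match s return ('I_(dl_arity s) -> K) -> K with
       | SZero => fun _ => 0
       | SOne => fun _ => 1
       | SAdd => fun x => x ord0 + x ord_max
       | SOpp => fun x => - x ord0
       | SMul => fun x => x ord0 * x ord_max
       | SInv => fun x => (x ord0)^-1
       | SDelta => fun x => delta (x ord0)
       | SEll n i => fun x => ell n i x
       end).

(* The theory of a class of structures: the sentences true in all members. *)
Definition theory_of L (C : structure L -> Prop) : theory L :=
  fun sigma => forall M, C M -> valid_in M sigma.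

Section Theories.

(* [m n] is the enumeration m_0, ..., m_(s_n) of the monomials, each given by
   its exponents. *)
Variables (p : nat) (m : forall n, 'I_(p ^ n) -> {ffun 'I_n -> 'I_p}).

Definition DF_field (K : fieldType) (delta : K -> K) : Prop :=
  [/\ derivation delta, p \in [pchar K] & infinite_degree p delta].

Definition SDCF_field (K : fieldType) (delta : K -> K) : Prop :=
  DF_field delta /\ separably_diff_closed delta.

Definition DF : theory (L_dl p) :=
  theory_of (fun M => exists (K : fieldType) (delta : K -> K) ell,
    [/\ DF_field delta, ell_spec delta m ell & M = dl_structure delta ell]).

Definition SDCF : theory (L_dl p) :=
  theory_of (fun M => exists (K : fieldType) (delta : K -> K) ell,
    [/\ SDCF_field delta, ell_spec delta m ell & M = dl_structure delta ell]).

End Theories.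

(* Main.v *)
Require Import Defs.
From HB Require Import structures.
From mathcomp Require Import all_boot all_algebra.
From mathcomp Require Import boolp.
From mathcomp Require classical_sets filter.
From mathcomp Require Import generic_quotient.
From mathcomp.field Require Import falgebra fieldext.
From mathcomp.multinomials Require Import mpoly.
From mathcomp Require Import ring zify.

(* By compactness, quantifiers can be eliminated as soon as the following
   holds: if finite tuples of a differential field [M] and of a separably
   differentially closed field [N] have the same quantifier-free type, then [M]
   embeds over the tuples into an elementary extension of [N].  The terms give a
   partial isomorphism [R] from [M] to [N] whose domain [A] and image are closed
   under the [ell]; hence p-independent constants of [A] stay p-independent,
   and, linear independence over constants being preserved by the Wronskian
   argument, [M] and [N] are separable over the domain and the image of [R].

   To realize finitely many elements [w_k] of [M], adjoin to [M] algebraically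
   independent elements [c_0, ..., c_(r-1)], and let [D] be a derivation on
   [G = A(w, c, ...)] with [D c_i = c_(i+1)], [c_r = 0] and [D w_k = delta w_k]
   whenever [delta w_k] is among the [w_l].  A generic combination [v_0] of the
   [c_i w_k] is a cyclic vector: the [v_j = D^j v_0], [j < d], are algebraically
   independent over [A(c)] and [v_d] and the [w_k] are successively separably
   algebraic over [A(c, v_0, ..., v_(d-1))].  The axiom for separably
   differentially closed fields provides images of [c_0] and of [v_0], and those
   of the [w_k] are then determined up to roots of separable polynomials,
   compatibly with the derivations.  Constants of [M] independent over
   [M^p] and [A] are first adjoined as generic constants of an ultrapower
   of [N], which exist as [[C_N : N^p]] is infinite; this makes the
   embedding obtained from an ultraproduct preserve independence over p-th
   powers of constants, hence the [ell].

   Every differential field embeds in a separably differentially closed one: a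
   root of a separable factor of [f], over a field of rational functions in
   [x_0, ..., x_(k-1)], solves one problem [(f, g)] and preserves linear
   independence over p-th powers; an ultraproduct over finite lists of
   problems solves all of them, and a direct limit of length omega closes off. *)

Set Implicit Arguments.
Unset Strict Implicit.
Unset Printing Implicit Defensive.

Import GRing.Theory.
Local Open Scope ring_scope.

(** * Linear independence over subfields *)

(** The axiom solves one equation in one unknown, whereas a finitely generated extension has many
    generators; hence the search for a cyclic vector. If the derivation vanishes on the extension,
    no element generates more than itself, and the jets [c_i] remove this obstacle: with them as
    coefficients, the matrix of values of the derivations over the base on the [v_j] becomes
    invertible. The number [r = q(q+1)+1] reserves [q+1] jets for each of the [q] elements [w_k]. As
    [A(w)] need not be closed under [delta], the derivation is first retracted to one of [A(w)] into
    itself. This keeps [delta w_k] only when that value lies in [A(w)], so the finite lists to be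
    realized are enlarged by derivatives.

    A second obstacle is that embeddings of differential fields may destroy independence over p-th
    powers. It is reduced to linear algebra: coordinates with respect to a family independent on
    both sides turn it into the triviality of a linear system over the domain.

    A derivation is treated as a homomorphism into dual numbers, so that derivations and embeddings
    are extended by the same lemmas on partial homomorphisms with values in a ring. *)

Section Subfields.
Variable K : fieldType.
Implicit Types (F S : K -> Prop) (x y : K) (b u : seq K).

(** Subfields are predicates on one fixed field, so that long towers of adjunctions stay inside a
    single type. *)
Definition subf F : Prop :=
  [/\ F 1, forall x y, F x -> F y -> F (x - y),
      forall x y, F x -> F y -> F (x * y) & forall x, F x -> F x^-1].

Section SubfTheory.
Variable F : K -> Prop.
Hypothesis hF : subf F.

Lemma subf1 : F 1. Proof. by case: hF. Qed.
Lemma subfB x y : F x -> F y -> F (x - y). Proof. by case: hF => _ h _ _; apply: h. Qed.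
Lemma subfM x y : F x -> F y -> F (x * y). Proof. by case: hF => _ _ h _; apply: h. Qed.
Lemma subfV x : F x -> F x^-1. Proof. by case: hF => _ _ _ h; apply: h. Qed.
Lemma subf0 : F 0. Proof. by rewrite -(subrr 1); apply: subfB; apply: subf1. Qed.
Lemma subfN x : F x -> F (- x). Proof. by move=> hx; rewrite -sub0r; apply: subfB => //; apply: subf0. Qed.
Lemma subfD x y : F x -> F y -> F (x + y).
Proof. by move=> hx hy; rewrite -[y]opprK; apply: subfB => //; apply: subfN. Qed.
Lemma subf_div x y : F x -> F y -> F (x / y).
Proof. by move=> hx hy; apply: subfM => //; apply: subfV. Qed.
Lemma subf_nat n : F n%:R.
Proof. by elim: n => [|n IH]; [apply: subf0|rewrite mulrS; apply: subfD => //; apply: subf1]. Qed.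
Lemma subfMn x n : F x -> F (x *+ n).
Proof. by move=> hx; rewrite -mulr_natr; apply: subfM => //; apply: subf_nat. Qed.
Lemma subfX x n : F x -> F (x ^+ n).
Proof. by move=> hx; elim: n => [|n IH]; [apply: subf1|rewrite exprS; apply: subfM]. Qed.
Lemma subf_sum (I : Type) (r : seq I) (P : pred I) (G : I -> K) :
  (forall i, P i -> F (G i)) -> F (\sum_(i <- r | P i) G i).
Proof. by move=> h; elim/big_rec: _ => [|i x Pi hx]; [apply: subf0|apply: subfD => //; apply: h]. Qed.
Lemma subf_prod (I : Type) (r : seq I) (P : pred I) (G : I -> K) :
  (forall i, P i -> F (G i)) -> F (\prod_(i <- r | P i) G i).
Proof. by move=> h; elim/big_rec: _ => [|i x Pi hx]; [apply: subf1|apply: subfM => //; apply: h]. Qed.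

End SubfTheory.

Lemma subf_full : subf (fun _ => True).
Proof. by split. Qed.

Definition indep S (I : finType) (u : I -> K) : Prop :=
  forall c : I -> K, (forall i, S (c i)) -> \sum_i c i * u i = 0 ->
  forall i, c i = 0.

(** Coefficients are indexed by [nat] and not by the positions of [b], so that one function serves a
    list and its extensions. *)
Definition spanned S b x : Prop :=
  exists2 k : nat -> K, (forall i, S (k i)) & x = \sum_(i < size b) k i * b`_i.

Definition sindep S b : Prop :=
  forall k : nat -> K, (forall i, S (k i)) ->
    \sum_(i < size b) k i * b`_i = 0 -> forall i, (i < size b)%N -> k i = 0.

Lemma spanned_cat S b r x : subf S -> spanned S b x -> spanned S (b ++ r) x.
Proof.
move=> hS [k kS ->]; exists (fun i => if (i < size b)%N then k i else 0).
  by move=> i; case: ifP => // _; apply: subf0.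
rewrite size_cat big_split_ord /= [X in _ + X]big1 ?addr0.
  by apply: eq_bigr => i _; rewrite ltn_ord nth_cat ltn_ord.
by move=> i _; rewrite ltnNge leq_addr mul0r.
Qed.

Lemma spanned_mem S b x : subf S -> x \in b -> spanned S b x.
Proof.
move=> hS xb; exists (fun i => (i == index x b)%:R).
  by move=> i; apply: subf_nat.
have hi : (index x b < size b)%N by rewrite index_mem.
rewrite (bigD1 (Ordinal hi)) //= eqxx mul1r nth_index // big1 ?addr0 //.
by move=> i; rewrite -val_eqE /= => /negPf ->; rewrite mul0r.
Qed.

Lemma sindep_rcons S b x : subf S -> sindep S b -> ~ spanned S b x ->
  sindep S (rcons b x).
Proof.
move=> hS hb hx k kS; rewrite size_rcons big_ord_recr /= nth_rcons ltnn eqxx.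
have -> : \sum_(i < size b) k i * (rcons b x)`_i = \sum_(i < size b) k i * b`_i.
  by apply: eq_bigr => i _; rewrite nth_rcons ltn_ord.
move=> h0; have kn : k (size b) = 0.
  apply: contrapT => /eqP kn; apply: hx.
  exists (fun i => - (k (size b))^-1 * k i).
    by move=> i; apply: subfM => //; apply: subfN => //; apply: subfV.
  under eq_bigr do rewrite -mulrA; rewrite -mulr_sumr.
  move/eqP: h0; rewrite addr_eq0 => /eqP ->.
  by rewrite mulNr mulrN opprK mulrA mulVf // mul1r.
move=> i; rewrite ltnS leq_eqVlt => /orP [/eqP -> //|hi].
by apply: hb => //; move: h0; rewrite kn mul0r addr0.
Qed.

Lemma span_ext S b u : subf S -> sindep S b ->
  exists r, [/\ sindep S (b ++ r), {subset r <= u} &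
                forall x, x \in u -> spanned S (b ++ r) x].
Proof.
move=> hS; elim: u b => [|x u IH] b hb; first by exists [::]; rewrite cats0.
have [hx|hx] := pselect (spanned S b x).
  have [r [h1 h2 h3]] := IH b hb; exists r; split => //.
    by move=> y /h2; rewrite inE => ->; rewrite orbT.
  by move=> y; rewrite inE => /orP [/eqP ->|/h3 //]; apply: spanned_cat.
have [r [h1 h2 h3]] := IH _ (sindep_rcons hS hb hx).
rewrite cat_rcons in h1 h3; exists (x :: r); split => //.
  by move=> y; rewrite !inE => /orP [->//|/h2 ->]; rewrite orbT.
move=> y; rewrite inE => /orP [/eqP ->|/h3 //].
by apply: spanned_mem => //; rewrite mem_cat inE eqxx orbT.
Qed.

Lemma sindep_indep S b : subf S -> sindep S b ->
  indep S (fun i : 'I_(size b) => b`_i).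
Proof.
move=> hS hb c cS h0 i.
have e (j : 'I_(size b)) :
    (if insub (val j) is Some l then c l else 0) = c j by rewrite valK.
rewrite -(e i); apply: (hb (fun j => if insub j is Some l then c l else 0)) => //.
  by move=> j; case: insub => [l|]; [apply: cS|apply: subf0].
by rewrite -[RHS]h0; apply: eq_bigr => j _; rewrite e.
exact: ltn_ord.
Qed.

Lemma spanned_finite S b n (u : 'I_n -> K) : (forall i, spanned S b (u i)) ->
  exists2 k : 'I_n -> 'I_(size b) -> K, (forall i j, S (k i j)) &
    forall i, u i = \sum_j k i j * b`_j.
Proof.
move=> h; have /choice [k hk] : forall i, exists k : 'I_(size b) -> K,
   (forall j, S (k j)) /\ u i = \sum_j k j * b`_j.
  by move=> i; have [k kS ->] := h i; exists (fun j => k j).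
by exists k => [i j|i]; have [] := hk i.
Qed.

Lemma basis_extract S n (u : 'I_n -> K) : subf S ->
  exists s (b : 'I_s -> K) (k : 'I_n -> 'I_s -> K),
  [/\ indep S b, forall j, exists i, b j = u i, forall i j, S (k i j) &
      forall i, u i = \sum_j k i j * b j].
Proof.
move=> hS; have h0 : sindep S [::] by move=> k _ _ i.
have [r [h1 h2 h3]] := span_ext (codom u) hS h0; rewrite /= in h1 h3.
have [|k h4 h5] := @spanned_finite S r n u.
  by move=> i; apply: h3; apply: codom_f.
exists (size r), (fun i => r`_i), k; split => //; first exact: sindep_indep.
by move=> j; have /codomP : r`_j \in codom u by apply: h2; apply: mem_nth.
Qed.

(* The basis starts with [1], so that the coordinate at [ord0] is an [S]-linear
   retraction onto [S]. *)
Lemma basis_extract1 S n (u : 'I_n -> K) : subf S ->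
  exists s (b : 'I_s.+1 -> K) (k : 'I_n -> 'I_s.+1 -> K),
  [/\ indep S b, b ord0 = 1, forall i j, S (k i j) &
      forall i, u i = \sum_j k i j * b j].
Proof.
move=> hS; have h0 : sindep S [:: 1].
  by move=> k _; rewrite big_ord1 /= mulr1 => h [|i].
have [r [h1 h2 h3]] := span_ext (codom u) hS h0.
have [|k h4 h5] := @spanned_finite S (1 :: r) n u.
  by move=> i; apply: h3; apply: codom_f.
exists (size r), (fun i => (1 :: r)`_i), k; split => //.
exact: (@sindep_indep S (1 :: r)).
Qed.

Lemma indep_coords S (I : finType) (b : I -> K) (c c' : I -> K) :
  subf S -> indep S b -> (forall i, S (c i)) -> (forall i, S (c' i)) ->
  \sum_i c i * b i = \sum_i c' i * b i -> forall i, c i = c' i.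
Proof.
move=> hS hb hc hc' e i; apply/eqP; rewrite -subr_eq0; apply/eqP.
apply: (hb (fun i => c i - c' i)); first by move=> j; apply: subfB.
by under eq_bigr do rewrite mulrBl; rewrite sumrB e subrr.
Qed.

(** A linear system over [S] acquires no new solutions in [K]: expand the unknowns in an
    [S]-independent family, and each vector of coordinates is a solution in [S]. There may be
    infinitely many equations. *)
Lemma descent S n (J : Type) (al : 'I_n -> J -> K) : subf S ->
  (forall i j, S (al i j)) ->
  (forall x : 'I_n -> K, (forall i, S (x i)) ->
     (forall j, \sum_i x i * al i j = 0) -> forall i, x i = 0) ->
  forall x : 'I_n -> K, (forall j, \sum_i x i * al i j = 0) -> forall i, x i = 0.
Proof.
move=> hS hal H x hx.
have [s [b [k [hb _ hk e]]]] := basis_extract x hS.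
have hk0 i l : k i l = 0.
  apply: (H (fun i => k i l)) => // j.
  apply: (hb (fun l => \sum_i k i l * al i j)).
    by move=> l'; apply: subf_sum => // i' _; apply: subfM.
  rewrite -[RHS](hx j); under eq_bigr do rewrite mulr_suml.
  rewrite exchange_big; apply: eq_bigr => i' _; rewrite e mulr_suml.
  by apply: eq_bigr => l' _; rewrite mulrAC.
by move=> i; rewrite e big1 // => l _; rewrite hk0 mul0r.
Qed.

(** * Independence over p-th powers *)

Section PPowers.
Variable p : nat.
Hypothesis hp : p \in [pchar K].

Definition ppow F x : Prop := exists2 y, F y & x = y ^+ p.

Lemma expp_eq0 x : (x ^+ p == 0) = (x == 0).
Proof. by rewrite expf_eq0 (prime_gt0 (pcharf_prime hp)). Qed.

Lemma exppB x y : (x - y) ^+ p = x ^+ p - y ^+ p.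
Proof. exact: (rmorphB (pFrobenius_aut hp)). Qed.

Lemma expp_sum (I : Type) (r : seq I) (P : pred I) (G : I -> K) :
  (\sum_(i <- r | P i) G i) ^+ p = \sum_(i <- r | P i) G i ^+ p.
Proof. exact: (rmorph_sum (pFrobenius_aut hp)). Qed.

Lemma ppow_subf F : subf F -> subf (ppow F).
Proof.
move=> hF; split.
- by exists 1; [apply: subf1|rewrite expr1n].
- by move=> _ _ [x hx ->] [y hy ->]; exists (x - y); [apply: subfB|rewrite exppB].
- by move=> _ _ [x hx ->] [y hy ->]; exists (x * y); [apply: subfM|rewrite exprMn].
- by move=> _ [x hx ->]; exists x^-1; [apply: subfV|rewrite exprVn].
Qed.

Definition pindep F (I : finType) (u : I -> K) : Prop :=
  forall c : I -> K, (forall i, F (c i)) -> \sum_i c i ^+ p * u i = 0 ->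
  forall i, c i = 0.

Lemma pindep_full (I : finType) (u : I -> K) :
  lin_indep_over_Kp p u <-> pindep (fun _ => True) u.
Proof.
split=> [h c _ h0 i|h c h0 i]; apply/eqP; last by rewrite expp_eq0; apply/eqP; apply: h.
by rewrite -expp_eq0; apply/eqP; apply: h.
Qed.

(** Frobenius is additive, so a combination of the [u i] with p-th power coefficients has the p-th
    powers of [\sum_i x i * al i j] as coordinates in [kap]. Independence over p-th powers thus
    becomes the triviality of a linear system, which can be carried through a partial
    homomorphism. *)
Lemma pindep_coords F n (J : finType) (u : 'I_n -> K) (kap : J -> K)
    (al : 'I_n -> J -> K) : subf F ->
  (forall i j, F (al i j)) -> pindep F kap ->
  (forall i, u i = \sum_j al i j ^+ p * kap j) ->
  pindep F u <->
  (forall x : 'I_n -> K, (forall i, F (x i)) ->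
     (forall j, \sum_i x i * al i j = 0) -> forall i, x i = 0).
Proof.
move=> hF hal hkap e.
have key (x : 'I_n -> K) : \sum_i x i ^+ p * u i = \sum_j (\sum_i x i * al i j) ^+ p * kap j.
  under eq_bigr do rewrite e mulr_sumr.
  rewrite exchange_big; apply: eq_bigr => j _; rewrite expp_sum mulr_suml.
  by apply: eq_bigr => i _; rewrite exprMn mulrA.
split=> h x hx h0; apply: h => //.
  by rewrite key big1 // => j _; rewrite h0 expr0n (gtn_eqF (prime_gt0 (pcharf_prime hp))) mul0r.
move=> j; rewrite key in h0.
by apply: (hkap (fun j => \sum_i x i * al i j)) => // j'; apply: subf_sum => // i _; apply: subfM.
Qed.

End PPowers.
End Subfields.

(** * Partial homomorphisms as relations *)

Section RingRelations.
Variables (K : fieldType) (Q : comNzRingType).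
Implicit Types (R : K -> Q -> Prop) (x y : K) (q r : Q).

(** The graph is a subring of the product. The target is only a ring, because dual numbers will
    occur there. *)
Definition rrel R : Prop :=
  [/\ R 1 1, forall x y q r, R x q -> R y r -> R (x - y) (q - r) &
      forall x y q r, R x q -> R y r -> R (x * y) (q * r)].

(* A homomorphism to [Q] from a subfield of [K], given by its graph. *)
Definition phom R : Prop :=
  [/\ rrel R, forall q, R 0 q -> q = 0 &
      forall x q, R x q -> x != 0 -> exists r, R x^-1 r].

Definition rdom R x : Prop := exists q, R x q.

Section RRel.
Variable R : K -> Q -> Prop.
Hypothesis hR : rrel R.

Lemma rrel1 : R 1 1. Proof. by case: hR. Qed.
Lemma rrelB x y q r : R x q -> R y r -> R (x - y) (q - r).
Proof. by case: hR => _ h _; apply: h. Qed.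
Lemma rrelM x y q r : R x q -> R y r -> R (x * y) (q * r).
Proof. by case: hR => _ _ h; apply: h. Qed.
Lemma rrel0 : R 0 0.
Proof. by rewrite -(subrr 1) -(subrr (1 : Q)); apply: rrelB; apply: rrel1. Qed.
Lemma rrelN x q : R x q -> R (- x) (- q).
Proof. by move=> h; rewrite -sub0r -[- q]sub0r; apply: rrelB => //; apply: rrel0. Qed.
Lemma rrelD x y q r : R x q -> R y r -> R (x + y) (q + r).
Proof. by move=> h h'; rewrite -[y]opprK -[r]opprK; apply: rrelB => //; apply: rrelN. Qed.
Lemma rrelX x q n : R x q -> R (x ^+ n) (q ^+ n).
Proof. by move=> h; elim: n => [|n IH]; [apply: rrel1|rewrite !exprS; apply: rrelM]. Qed.
Lemma rrelMn x q n : R x q -> R (x *+ n) (q *+ n).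
Proof. by move=> h; elim: n => [|n IH]; [apply: rrel0|rewrite !mulrS; apply: rrelD]. Qed.
Lemma rrel_sum (I : Type) (s : seq I) (P : pred I) (G : I -> K) (H : I -> Q) :
  (forall i, P i -> R (G i) (H i)) ->
  R (\sum_(i <- s | P i) G i) (\sum_(i <- s | P i) H i).
Proof.
move=> h; elim/big_rec2: _ => [|i x q Pi hx]; first exact: rrel0.
by apply: rrelD => //; apply: h.
Qed.
Lemma rrel_prod (I : Type) (s : seq I) (P : pred I) (G : I -> K) (H : I -> Q) :
  (forall i, P i -> R (G i) (H i)) ->
  R (\prod_(i <- s | P i) G i) (\prod_(i <- s | P i) H i).
Proof.
move=> h; elim/big_rec2: _ => [|i x q Pi hx]; first exact: rrel1.
by apply: rrelM => //; apply: h.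
Qed.

Definition prel (f : {poly K}) (g : {poly Q}) : Prop := forall i, R f`_i g`_i.

Lemma prelC x q : R x q -> prel x%:P q%:P.
Proof. by move=> h i; rewrite !coefC; case: eqP => // _; apply: rrel0. Qed.
Lemma prelX : prel 'X 'X.
Proof. by move=> i; rewrite !coefX; case: eqP => _; [apply: rrel1|apply: rrel0]. Qed.
Lemma prelB f g f' g' : prel f f' -> prel g g' -> prel (f - g) (f' - g').
Proof. by move=> h h' i; rewrite !coefB; apply: rrelB. Qed.
Lemma prelD f g f' g' : prel f f' -> prel g g' -> prel (f + g) (f' + g').
Proof. by move=> h h' i; rewrite !coefD; apply: rrelD. Qed.
Lemma prelM f g f' g' : prel f f' -> prel g g' -> prel (f * g) (f' * g').
Proof. by move=> h h' i; rewrite !coefM; apply: rrel_sum => j _; apply: rrelM. Qed.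
Lemma prelZ x q f g : R x q -> prel f g -> prel (x *: f) (q *: g).
Proof. by move=> h h' i; rewrite !coefZ; apply: rrelM. Qed.
Lemma prelXn n : prel 'X^n 'X^n.
Proof. by move=> i; rewrite !coefXn; case: eqP => _; [apply: rrel1|apply: rrel0]. Qed.
Lemma prel_deriv f g : prel f g -> prel f^`() g^`().
Proof. by move=> h i; rewrite !coef_deriv; apply: rrelMn. Qed.
Lemma prel1 : prel 1 1.
Proof. by apply: prelC; apply: rrel1. Qed.

Lemma prel_horner f g x q : prel f g -> R x q -> R f.[x] g.[q].
Proof.
move=> h hx; set n := maxn (size f) (size g).
rewrite (@horner_coef_wide _ n) ?leq_maxl // (@horner_coef_wide _ n) ?leq_maxr //.
by apply: rrel_sum => i _; apply: rrelM => //; apply: rrelX.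
Qed.

Lemma prel_ex (f : {poly K}) : (forall i, rdom R f`_i) -> exists g, prel f g.
Proof.
move=> /choice [c hc]; exists (\poly_(i < size f) c i) => i; rewrite coef_poly.
by case: ltnP => // hi; rewrite nth_default //; apply: rrel0.
Qed.

Definition mrel n (f : {mpoly K[n]}) (g : {mpoly Q[n]}) : Prop :=
  forall m, R f@_m g@_m.

Section MRel.
Variable n : nat.
Implicit Types (f : {mpoly K[n]}) (g : {mpoly Q[n]}).

Lemma mrelC x q : R x q -> mrel (n := n) x%:MP q%:MP.
Proof.
move=> h m; rewrite !mcoeffC; case: eqP => _; first by rewrite !mulr1.
by rewrite !mulr0; apply: rrel0.
Qed.
Lemma mrelXm m : mrel (n := n) 'X_[m] 'X_[m].
Proof. by move=> m'; rewrite !mcoeffX; case: eqP => _; [apply: rrel1|apply: rrel0]. Qed.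
Lemma mrelB f f' g g' : mrel f g -> mrel f' g' -> mrel (f - f') (g - g').
Proof. by move=> h h' i; rewrite !mcoeffB; apply: rrelB. Qed.
Lemma mrelD f f' g g' : mrel f g -> mrel f' g' -> mrel (f + f') (g + g').
Proof. by move=> h h' i; rewrite !mcoeffD; apply: rrelD. Qed.
Lemma mrelM f f' g g' : mrel f g -> mrel f' g' -> mrel (f * f') (g * g').
Proof. by move=> h h' m; rewrite !mcoeffM; apply: rrel_sum => k _; apply: rrelM. Qed.
Lemma mrelZ x q f g : R x q -> mrel f g -> mrel (x *: f) (q *: g).
Proof. by move=> h h' m; rewrite !mcoeffZ; apply: rrelM. Qed.
Lemma mrel_deriv i f g : mrel f g -> mrel f^`M(i) g^`M(i).
Proof. by move=> h m; rewrite !mcoeff_deriv; apply: rrelMn. Qed.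
Lemma mrel1 : mrel (n := n) 1 1.
Proof. by apply: mrelC; apply: rrel1. Qed.
Lemma mrel0 : mrel (n := n) 0 0.
Proof. by move=> m; rewrite !mcoeff0; apply: rrel0. Qed.
Lemma mrel_sum (I : Type) (s : seq I) (P : pred I)
    (G : I -> {mpoly K[n]}) (H : I -> {mpoly Q[n]}) :
  (forall i, P i -> mrel (G i) (H i)) ->
  mrel (\sum_(i <- s | P i) G i) (\sum_(i <- s | P i) H i).
Proof.
move=> h; elim/big_rec2: _ => [|i x q Pi hx]; first exact: mrel0.
by apply: mrelD => //; apply: h.
Qed.

Lemma mrel_meval f g (x : 'I_n -> K) (q : 'I_n -> Q) :
  mrel f g -> (forall i, R (x i) (q i)) -> R f.@[x] g.@[q].
Proof.
move=> h hx; set k := maxn (msize f) (msize g).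
rewrite [f](@mpolywE _ _ k) ?leq_maxl // [g](@mpolywE _ _ k) ?leq_maxr //.
rewrite !raddf_sum /=; apply: rrel_sum => m _; rewrite !mevalZ !mevalX.
by apply: rrelM => //; apply: rrel_prod => i _; apply: rrelX.
Qed.

Lemma mrel_ex f : (forall m, rdom R f@_m) -> exists g, mrel f g.
Proof.
move=> /choice [c hc]; exists (\sum_(m <- msupp f) c m *: 'X_[m]) => m.
rewrite raddf_sum /=; have [hm|hm] := boolP (m \in msupp f).
  rewrite (bigD1_seq m) ?msupp_uniq //= mcoeffZ mcoeffX eqxx mulr1 big1 ?addr0 //.
  by move=> m' /negPf hm'; rewrite mcoeffZ mcoeffX hm' mulr0.
rewrite memN_msupp_eq0 // big_seq big1; first exact: rrel0.
move=> m' hm'; rewrite mcoeffZ mcoeffX; case: eqP => [e|]; last by rewrite mulr0.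
by rewrite e (negPf hm) in hm'.
Qed.

Lemma mrel_mwiden f g : mrel f g -> mrel (mwiden f) (mwiden g).
Proof.
move=> h; set k := maxn (msize f) (msize g).
rewrite (@mwidenE _ _ f k) ?leq_maxl // (@mwidenE _ _ g k) ?leq_maxr // => m.
rewrite !raddf_sum /=; apply: rrel_sum => i _; rewrite !mcoeffZ !mcoeffX.
by case: eqP => _; rewrite ?mulr1 ?mulr0 //; apply: rrel0.
Qed.

End MRel.
End RRel.

Section PHom.
Variable R : K -> Q -> Prop.
Hypothesis hR : phom R.

Lemma phom_rrel : rrel R. Proof. by case: hR. Qed.
Lemma phom0 q : R 0 q -> q = 0. Proof. by case: hR => _ h _; apply: h. Qed.
Lemma phom_fun x q r : R x q -> R x r -> q = r.
Proof.
move=> h h'; apply/eqP; rewrite -subr_eq0; apply/eqP; apply: phom0.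
by rewrite -(subrr x); apply: (rrelB phom_rrel).
Qed.
Lemma phomV x q : R x q -> x != 0 -> exists2 r, R x^-1 r & q * r = 1.
Proof.
move=> h x0; have [_ _ /(_ _ _ h x0) [r hr]] := hR; exists r => //.
apply: (phom_fun (x := 1)); last exact: (rrel1 phom_rrel).
by rewrite -(mulfV x0); apply: (rrelM phom_rrel).
Qed.
Lemma phomVr x q r : R x q -> q * r = 1 -> R x^-1 r.
Proof.
move=> h e; have x0 : x != 0.
  apply/eqP => x0; rewrite x0 in h; move: e; rewrite (phom0 h) mul0r => /eqP.
  by rewrite eq_sym oner_eq0.
have [r' hr' e'] := phomV h x0; suff -> : r = r' by [].
by rewrite -[r]mulr1 -e' mulrA [r * q]mulrC e mul1r.
Qed.
Lemma rdom_subf : subf (rdom R).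
Proof.
split.
- by exists 1; apply: (rrel1 phom_rrel).
- by move=> x y [q h] [r h']; exists (q - r); apply: (rrelB phom_rrel).
- by move=> x y [q h] [r h']; exists (q * r); apply: (rrelM phom_rrel).
- move=> x [q h]; have [->|x0] := eqVneq x 0.
    by rewrite invr0; exists 0; apply: (rrel0 phom_rrel).
  by have [r hr _] := phomV h x0; exists r.
Qed.
Lemma phom_prel_size f g : prel R f g -> (size g <= size f)%N.
Proof. by move=> h; apply/leq_sizeP => j hj; apply: phom0; rewrite -(nth_default 0 hj). Qed.
Lemma phom_mrel0 n (g : {mpoly Q[n]}) : mrel R 0 g -> g = 0.
Proof. by move=> h; apply/mpolyP => m; rewrite mcoeff0; apply: phom0; rewrite -(mcoeff0 _ m). Qed.

End PHom.

(** ** The partial homomorphism generated by prescribed values *)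

Inductive adjoin R (I : Type) (w : I -> K) (v : I -> Q) : K -> Q -> Prop :=
| adj_base x q : R x q -> adjoin R w v x q
| adj_gen i : adjoin R w v (w i) (v i)
| adj_sub x y q r : adjoin R w v x q -> adjoin R w v y r ->
    adjoin R w v (x - y) (q - r)
| adj_mul x y q r : adjoin R w v x q -> adjoin R w v y r ->
    adjoin R w v (x * y) (q * r)
| adj_inv x q r : adjoin R w v x q -> q * r = 1 -> adjoin R w v x^-1 r.

Lemma adjoin_rrel R I (w : I -> K) v : rrel R -> rrel (adjoin R w v).
Proof.
move=> hR; split; first by apply: adj_base; apply: (rrel1 hR).
- by move=> *; apply: adj_sub.
- by move=> *; apply: adj_mul.
Qed.

(* [S] plays the role of the ring generated by [R] and the new pairs. *)
Lemma adjoin_frac R I (w : I -> K) v S : rrel S ->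
  (forall q, S 0 q -> q = 0) ->
  (forall x q, S x q -> x != 0 -> exists r, q * r = 1) ->
  (forall x q, R x q -> S x q) -> (forall i, S (w i) (v i)) ->
  (forall x q, S x q -> adjoin R w v x q) ->
  phom (adjoin R w v) /\
  (forall x q, adjoin R w v x q -> exists a b s t t',
     [/\ S a s, S b t, b != 0, t * t' = 1 & x = a / b /\ q = s * t']).
Proof.
move=> hS S0 SV RS wS SA.
have rep x q : adjoin R w v x q -> exists a b s t t',
     [/\ S a s, S b t, b != 0, t * t' = 1 & x = a / b /\ q = s * t'].
  have base y r : S y r -> exists a b s t t',
     [/\ S a s, S b t, b != 0, t * t' = 1 & y = a / b /\ r = s * t'].
    move=> h; exists y, 1, r, 1, 1; split => //; first exact: (rrel1 hS).
    - exact: oner_neq0.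
    - by rewrite mulr1.
    - by rewrite divr1 mulr1.
  elim=> {x q} [x q /RS /base //|i|x y q r _ + _|x y q r _ + _|x q r _].
  - exact/base/wS.
  - move=> [a [b [s [t [t' [h1 h2 h3 h4 [h5 h6]]]]]]].
    move=> [c [d [s2 [u [u' [k1 k2 k3 k4 [k5 k6]]]]]]].
    exists (a * d - c * b), (b * d), (s * u - s2 * t), (t * u), (t' * u').
    split.
    + by apply: (rrelB hS); apply: (rrelM hS).
    + exact: (rrelM hS).
    + by rewrite mulf_neq0.
    + by rewrite mulrACA h4 k4 mulr1.
    + split; first by rewrite h5 k5 -mulNr addf_div // mulNr.
      rewrite h6 k6 mulrBl !mulrA; congr (_ - _).
        by rewrite -!mulrA [u * _]mulrC -!mulrA [u' * u]mulrC k4 mulr1.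
      by rewrite -!mulrA [t * _]mulrA h4 mul1r.
  - move=> [a [b [s [t [t' [h1 h2 h3 h4 [h5 h6]]]]]]].
    move=> [c [d [s2 [u [u' [k1 k2 k3 k4 [k5 k6]]]]]]].
    exists (a * c), (b * d), (s * s2), (t * u), (t' * u').
    split; try exact: (rrelM hS).
    + by rewrite mulf_neq0.
    + by rewrite mulrACA h4 k4 mulr1.
    + by rewrite h5 k5 h6 k6 mulf_div mulrACA.
  - move=> [a [b [s [t [t' [h1 h2 h3 h4 [h5 h6]]]]]]] e.
    have a0 : a != 0.
      apply/eqP => a0; rewrite a0 in h1; move: e; rewrite h6 (S0 _ h1) !mul0r => /eqP.
      by rewrite eq_sym oner_eq0.
    exists b, a, t, s, (t' * r); split => //.
      by rewrite mulrA -h6.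
    split; first by rewrite h5 invf_div.
    by rewrite mulrA h4 mul1r.
have Ainv x q : adjoin R w v x q -> x != 0 -> exists r, q * r = 1.
  move=> /rep [a [b [s [t [t' [h1 h2 h3 h4 [h5 h6]]]]]]] x0.
  have a0 : a != 0 by apply: contraNneq x0 => a0; rewrite h5 a0 mul0r.
  have [r hr] := SV _ _ h1 a0; exists (r * t).
  by rewrite h6 mulrACA hr mul1r mulrC h4.
split => //; split.
- split; first by apply/SA/(rrel1 hS).
  + by move=> *; apply: adj_sub.
  + by move=> *; apply: adj_mul.
- move=> q /rep [a [b [s [t [t' [h1 h2 h3 h4 [h5 h6]]]]]]].
  have a0 : a = 0.
    apply/eqP; move/eqP: h5; rewrite eq_sym mulf_eq0 invr_eq0 (negPf h3) orbF.
    by [].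
  by rewrite a0 in h1; rewrite h6 (S0 _ h1) mul0r.
- by move=> x q h x0; have [r hr] := Ainv _ _ h x0; exists r; apply: adj_inv hr.
Qed.

Lemma adjoin_min R I (w : I -> K) v T : rrel T ->
  (forall x q r, T x q -> q * r = 1 -> T x^-1 r) ->
  (forall x q, R x q -> T x q) -> (forall i, T (w i) (v i)) ->
  forall x q, adjoin R w v x q -> T x q.
Proof.
move=> hT TV RT wT x q; elim=> {x q} //.
- by move=> x y q r _ h _ h'; apply: (rrelB hT).
- by move=> x y q r _ h _ h'; apply: (rrelM hT).
- by move=> x q r _ h e; apply: TV h e.
Qed.

(** Besides respecting polynomial relations, the new values must turn nonzero denominators into
    units, which is not automatic in a ring. The pairs of values of corresponding polynomials then
    form the ring required by [adjoin_frac]. *)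
Lemma adjoin_mpoly R n (w : 'I_n -> K) v : phom R ->
  (forall f g, mrel R f g -> f.@[w] = 0 -> g.@[v] = 0) ->
  (forall f g, mrel R f g -> f.@[w] != 0 -> exists r, g.@[v] * r = 1) ->
  phom (adjoin R w v) /\
  (forall x q, adjoin R w v x q -> exists a b s t t',
     [/\ mrel R a s, mrel R b t, b.@[w] != 0, t.@[v] * t' = 1 &
         x = a.@[w] / b.@[w] /\ q = s.@[v] * t']).
Proof.
move=> hR C1 C2.
pose S x q := exists f g, [/\ mrel R f g, x = f.@[w] & q = g.@[v]].
have rR := phom_rrel hR.
have [||||||h rep] := @adjoin_frac R _ w v S.
- split.
  + by exists 1, 1; rewrite !meval1; split => //; apply: mrel1.
  + move=> _ _ _ _ [f [g [h -> ->]]] [f' [g' [h' -> ->]]].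
    by exists (f - f'), (g - g'); rewrite !mevalB; split => //; apply: mrelB.
  + move=> _ _ _ _ [f [g [h -> ->]]] [f' [g' [h' -> ->]]].
    by exists (f * f'), (g * g'); rewrite !mevalM; split => //; apply: mrelM.
- by move=> q [f [g [h e ->]]]; apply: C1 h _.
- by move=> x q [f [g [h -> ->]]]; apply: C2.
- by move=> x q h; exists x%:MP, q%:MP; rewrite !mevalC; split => //; apply: mrelC.
- by move=> i; exists 'X_i, 'X_i; rewrite !mevalXU; split => //; apply: mrelXm.
- move=> _ _ [f [g [h -> ->]]]; apply: mrel_meval; first exact: adjoin_rrel.
    by move=> m; apply: adj_base.
  exact: adj_gen.
split => // x q /rep [a [b [s [t [t' [[f [f' [h1 e1 e2]]] [g [g' [h2 e3 e4]]] h3 h4 [h5 h6]]]]]]].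
exists f, g, f', g', t'; rewrite -e1 -e2 -e3 -e4; split => //.
Qed.

Definition malgindep (F : K -> Prop) n (w : 'I_n -> K) : Prop :=
  forall f : {mpoly K[n]}, (forall m, F f@_m) -> f.@[w] = 0 -> f = 0.

Lemma adjoin_poly R (w : K) (v : Q) : phom R ->
  (forall f g, prel R f g -> f.[w] = 0 -> g.[v] = 0) ->
  (forall f g, prel R f g -> f.[w] != 0 -> exists r, g.[v] * r = 1) ->
  phom (adjoin R (fun _ : unit => w) (fun _ => v)) /\
  (forall x q, adjoin R (fun _ : unit => w) (fun _ => v) x q ->
   exists a b s t t',
     [/\ prel R a s, prel R b t, b.[w] != 0, t.[v] * t' = 1 &
         x = a.[w] / b.[w] /\ q = s.[v] * t']).
Proof.
move=> hR C1 C2.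
pose S x q := exists f g, [/\ prel R f g, x = f.[w] & q = g.[v]].
have rR := phom_rrel hR.
have [||||||h rep] := @adjoin_frac R _ (fun _ : unit => w) (fun _ => v) S.
- split.
  + by exists 1, 1; rewrite !hornerC; split => //; apply: prel1.
  + move=> _ _ _ _ [f [g [h -> ->]]] [f' [g' [h' -> ->]]].
    by exists (f - f'), (g - g'); rewrite !hornerD !hornerN; split => //; apply: prelB.
  + move=> _ _ _ _ [f [g [h -> ->]]] [f' [g' [h' -> ->]]].
    by exists (f * f'), (g * g'); rewrite !hornerM; split => //; apply: prelM.
- by move=> q [f [g [h e ->]]]; apply: C1 h _.
- by move=> x q [f [g [h -> ->]]]; apply: C2.
- by move=> x q h; exists x%:P, q%:P; rewrite !hornerC; split => //; apply: prelC.
- by move=> i; exists 'X, 'X; rewrite !hornerX; split => //; apply: prelX.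
- move=> _ _ [f [g [h -> ->]]]; apply: prel_horner; first exact: adjoin_rrel.
    by move=> m; apply: adj_base.
  exact: (adj_gen _ _ _ tt).
split => // x q /rep [a [b [s [t [t' [[f [f' [h1 e1 e2]]] [g [g' [h2 e3 e4]]] h3 h4 [h5 h6]]]]]]].
exists f, g, f', g', t'; rewrite -e1 -e2 -e3 -e4; split => //.
Qed.

(** ** Separable algebraic elements and minimal polynomials *)

Definition sepalg (F : K -> Prop) w : Prop :=
  exists h : {poly K}, [/\ forall i, F h`_i, h.[w] = 0 & h^`().[w] != 0].

(** Division is carried out on both sides at once. The leading coefficient of [g] is the only
    element to be inverted, and its image is a unit although [Q] is just a ring. *)
Lemma prel_div R f g f' g' : phom R -> prel R f f' -> prel R g g' -> g != 0 ->
  exists s s' (t : {poly K}) (t' : {poly Q}),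
    [/\ prel R s s', prel R t t', f = s * g + t, f' = s' * g' + t' &
        (size t < size g)%N].
Proof.
move=> hR hf hg g0; have rR := phom_rrel hR.
have [n] := ubnP (size f); elim: n f f' hf => // n IH f f' hf hn.
have [hlt|hle] := ltnP (size f) (size g).
  exists 0, 0, f, f'; rewrite !mul0r !add0r; split => //.
  by move=> i; rewrite !coef0; apply: rrel0.
have lg : g`_(size g).-1 != 0 by rewrite -lead_coefE lead_coef_eq0.
have [l' hl' _] := phomV hR (hg (size g).-1) lg.
set k := (size f - size g)%N.
set c := f`_(size f).-1 * (g`_(size g).-1)^-1; set c' := f'`_(size f).-1 * l'.
have hc : prel R (c *: 'X^k) (c' *: 'X^k).
  by apply: prelZ => //; [apply: (rrelM rR)|apply: prelXn].
have hd : prel R (f - c *: 'X^k * g) (f' - c' *: 'X^k * g').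
  by apply: prelB => //; apply: prelM.
have sg : (0 < size g)%N by rewrite size_poly_gt0.
have [|s [s' [r [r' [h1 h2 h3 h4 h5]]]]] := IH _ _ hd.
  apply: leq_trans (_ : (size f).-1 < n)%N; last first.
    by move: hn; rewrite ltnS; case: (size f) (leq_trans sg hle) => // m _ /= hm.
  rewrite ltnS; apply/leq_sizeP => j; rewrite leq_eqVlt => /orP [/eqP <-|hj].
    rewrite coefB -scalerAl coefZ coefXnM.
    have -> : ((size f).-1 < k)%N = false by rewrite /k; lia.
    have -> : ((size f).-1 - k)%N = (size g).-1 by rewrite /k; lia.
    by rewrite /c -mulrA mulVf // mulr1 subrr.
  have hj' : (size f <= j)%N by lia.
  rewrite coefB -scalerAl coefZ coefXnM nth_default // .
  have -> : (j < k)%N = false by rewrite /k; lia.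
  rewrite nth_default; first by rewrite mulr0 subr0.
  by rewrite leq_subRL /k ?subnK //; apply: leq_trans (leq_subr _ _) hj'.
exists (s + c *: 'X^k), (s' + c' *: 'X^k), r, r'; split => //.
- exact: prelD.
- by rewrite mulrDl addrAC -h3 subrK.
- by rewrite mulrDl addrAC -h4 subrK.
Qed.

(** A polynomial of least degree divides the given [h0]; if its derivative vanished at [w], then so
    would that of [h0]. *)
Lemma sepalg_minpoly R w : phom R -> sepalg (rdom R) w ->
  exists h h', [/\ prel R h h', h.[w] = 0, h^`().[w] != 0, h != 0 &
    forall f : {poly K}, (forall i, rdom R f`_i) -> f.[w] = 0 -> (size f < size h)%N -> f = 0].
Proof.
move=> hR [h0 [h0R h0w h0d]]; have rR := phom_rrel hR.
pose P n := `[< exists f : {poly K}, [/\ forall i, rdom R f`_i, f.[w] = 0, f != 0 & size f = n] >].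
have exP : exists n, P n.
  exists (size h0); apply/asboolP; exists h0; split => //.
  by apply: contraNneq h0d => ->; rewrite linear0 horner0.
case: (ex_minnP exP) => n /asboolP [h [hR' hw h0'0 <-]] hmin.
have [h' hh'] := prel_ex rR hR'.
have [h0' hh0'] := prel_ex rR h0R.
have min (f : {poly K}) : (forall i, rdom R f`_i) -> f.[w] = 0 -> (size f < size h)%N -> f = 0.
  move=> fR fw fs; apply/eqP; apply: contraLR fs => f0; rewrite -leqNgt.
  by apply: hmin; apply/asboolP; exists f.
exists h, h'; split => //.
have [s [s' [r [r' [h1 h2 h3 h4 h5]]]]] := prel_div hR hh0' hh' h0'0.
have r0 : r = 0.
  apply: min => //; first by move=> i; exists r'`_i.
  by move: h0w; rewrite h3 hornerD hornerM hw mulr0 add0r.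
apply: contraNneq h0d => hd.
by rewrite h3 r0 addr0 derivM hornerD !hornerM hw hd !mulr0 addr0.
Qed.

(** Reduction modulo [h] leaves only polynomials smaller than the minimal polynomial, so the point
    to settle is that those not vanishing at [w] have images that are units at [v]. *)
Lemma adjoin_root R (w : K) (v : Q) h h' : phom R -> prel R h h' ->
  h.[w] = 0 -> h'.[v] = 0 -> h != 0 ->
  (forall f : {poly K}, (forall i, rdom R f`_i) -> f.[w] = 0 -> (size f < size h)%N -> f = 0) ->
  phom (adjoin R (fun _ : unit => w) (fun _ => v)) /\
  (forall x q, adjoin R (fun _ : unit => w) (fun _ => v) x q ->
   exists a b s t t',
     [/\ prel R a s, prel R b t, b.[w] != 0, t.[v] * t' = 1 &
         x = a.[w] / b.[w] /\ q = s.[v] * t']).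
Proof.
move=> hR hh hw hv h0 min.
have rR := phom_rrel hR.
have small f g : prel R f g -> exists (t : {poly K}) (t' : {poly Q}),
    [/\ prel R t t', f.[w] = t.[w], g.[v] = t'.[v] & (size t < size h)%N].
  move=> hfg; have [s [s' [r [r' [h1 h2 -> -> h5]]]]] := prel_div hR hfg hh h0.
  by exists r, r'; split => //; rewrite hornerD hornerM ?hw ?hv mulr0 add0r.
have rd f g : prel R f g -> forall i, rdom R f`_i by move=> hfg i; exists g`_i.
apply: adjoin_poly => // f g /small [r [r' [hr -> -> rs]]] {f g}.
  move=> rw; have r0 := min _ (rd _ _ hr) rw rs; rewrite r0 in hr.
  by have := phom_prel_size hR hr; rewrite size_poly0 leqn0 size_poly_eq0 => /eqP ->; rewrite horner0.
(* Induction on the size of [r]: dividing [h] by [r] gives a remainder [t] with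
   [s'(v) r'(v) = - t'(v)], a unit by induction. *)
move: rs hr; have [n] := ubnP (size r); elim: n r r' => // n IH r r' hn rs hr rw.
have r0 : r != 0 by apply: contraNneq rw => ->; rewrite horner0.
have [s [s' [t [t' [h1 h2 h3 h4 h5]]]]] := prel_div hR hh hr r0.
(* If the remainder is zero, [s] vanishes at [w], so it is as large as [h]; hence [r] is a nonzero
   constant. *)
have [t0|t0] := eqVneq t 0.
  have sw : s.[w] = 0.
    move/eqP: hw; rewrite h3 t0 addr0 hornerM mulf_eq0 (negPf rw) orbF.
    by move/eqP.
  have s0 : s != 0 by apply: contraNneq h0 => s0; rewrite h3 s0 t0 mul0r addr0.
  have hs : (size h <= size s)%N.
    by rewrite leqNgt; apply: contraNN s0 => /(min _ (rd _ _ h1) sw) ->.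
  have sr : (size r <= 1)%N.
    move: hs; rewrite h3 t0 addr0 size_mul //.
    by move: s0; rewrite -size_poly_gt0; case: (size s) => // a _; rewrite addSn /= => h2'; rewrite -(leq_add2l a) addn1.
  have hr0 : R r`_0 r'`_0 by apply: hr.
  move: (rw); rewrite (size1_polyC sr) hornerC => r00.
  have sr' : (size r' <= 1)%N by apply: leq_trans (phom_prel_size hR hr) sr.
  by have [q _ e] := phomV hR hr0 r00; exists q; rewrite (size1_polyC sr') hornerC.
have tw : t.[w] != 0.
  by apply: contraNneq t0 => tw; apply/eqP; apply: min tw _; [apply: rd h2|apply: ltn_trans rs].
have [||q hq] := IH _ _ _ _ h2 tw; [by apply: leq_trans h5 _; rewrite -ltnS|exact: ltn_trans rs|].
exists (- s'.[v] * q); rewrite mulrA -[RHS]hq; congr (_ * _); apply/esym.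
move/eqP: hv; rewrite h4 hornerD hornerM addrC addr_eq0 => /eqP ->.
by rewrite mulrN mulrC.
Qed.

End RingRelations.

(** ** Adjoining elements to a subfield *)

Section Fadj.
Variable K : fieldType.
Implicit Types (F : K -> Prop).

Inductive fadj F (I : Type) (w : I -> K) : K -> Prop :=
| fadj_base x : F x -> fadj F w x
| fadj_gen i : fadj F w (w i)
| fadj_sub x y : fadj F w x -> fadj F w y -> fadj F w (x - y)
| fadj_mul x y : fadj F w x -> fadj F w y -> fadj F w (x * y)
| fadj_inv x : fadj F w x -> fadj F w x^-1.

Lemma fadj_subf F I (w : I -> K) : subf F -> subf (fadj F w).
Proof.
move=> hF; split; first by apply: fadj_base; apply: subf1.
- by move=> *; apply: fadj_sub.
- by move=> *; apply: fadj_mul.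
- by move=> *; apply: fadj_inv.
Qed.

Lemma fadj_min F I (w : I -> K) G : subf G -> (forall x, F x -> G x) ->
  (forall i, G (w i)) -> forall x, fadj F w x -> G x.
Proof.
move=> hG FG wG x; elim=> {x} //.
- by move=> x y _ h _ h'; apply: subfB.
- by move=> x y _ h _ h'; apply: subfM.
- by move=> x _ h; apply: subfV.
Qed.

Lemma rdom_adjoin (Q : comNzRingType) (R : K -> Q -> Prop) I (w : I -> K) v x :
  phom (adjoin R w v) -> rdom (adjoin R w v) x <-> fadj (rdom R) w x.
Proof.
move=> hA; split=> [[q]|].
  elim=> {x q}.
  - by move=> x q h; apply: fadj_base; exists q.
  - by move=> i; apply: fadj_gen.
  - by move=> *; apply: fadj_sub.
  - by move=> *; apply: fadj_mul.
  - by move=> *; apply: fadj_inv.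
apply: fadj_min; first exact: rdom_subf.
  by move=> y [q h]; exists q; apply: adj_base.
by move=> i; exists (v i); apply: adj_gen.
Qed.

(** The identity of [F] as a partial homomorphism, through which facts about one subfield become
    special cases. *)
Definition idrel F : K -> K -> Prop := fun x y => F x /\ x = y.

Lemma idrel_phom F : subf F -> phom (idrel F).
Proof.
move=> hF; split; first split.
- by split => //; apply: subf1.
- by move=> x y _ _ [h <-] [h' <-]; split => //; apply: subfB.
- by move=> x y _ _ [h <-] [h' <-]; split => //; apply: subfM.
- by move=> q [_ <-].
- by move=> x q [h e] _; exists x^-1; split => //; apply: subfV.
Qed.

Lemma mrel_idrel F n (f g : {mpoly K[n]}) :
  mrel (idrel F) f g <-> f = g /\ (forall m, F f@_m).
Proof.
split=> [h|[<- h] m]; last by split.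
by split=> [|m]; [apply/mpolyP => m|]; have [] := h m.
Qed.

Lemma fadj_frac F n (w : 'I_n -> K) x : subf F -> fadj F w x ->
  exists a b : {mpoly K[n]}, [/\ forall m, F a@_m, forall m, F b@_m,
    b.@[w] != 0 & x = a.@[w] / b.@[w]].
Proof.
move=> hF hx; have [||A rep] := @adjoin_mpoly K K (idrel F) n w w (idrel_phom hF).
- by move=> f g /mrel_idrel [<-].
- by move=> f g /mrel_idrel [<- _] f0; exists (f.@[w])^-1; rewrite mulfV.
have hx' : fadj (rdom (idrel F)) w x.
  elim: hx => {x}.
  - by move=> x h; apply: fadj_base; exists x.
  - by move=> i; apply: fadj_gen.
  - by move=> *; apply: fadj_sub.
  - by move=> *; apply: fadj_mul.
  - by move=> *; apply: fadj_inv.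
have [q /rep [a [b [s [t [t' [h1 h2 h3 h4 [h5 h6]]]]]]]] := (rdom_adjoin x A).2 hx'.
have [_ ha] := (mrel_idrel _ _ _).1 h1; have [_ hb] := (mrel_idrel _ _ _).1 h2.
by exists a, b.
Qed.

End Fadj.

(** * Derivations on subfields *)

Definition dual (K : fieldType) : Type := (K * K)%type.

Section Dual.
Variable K : fieldType.

HB.instance Definition _ := GRing.Zmodule.copy (dual K) (K * K)%type.

Definition dual_one : dual K := (1, 0).
Definition dual_mul (a b : dual K) : dual K := (a.1 * b.1, a.2 * b.1 + a.1 * b.2).

Lemma dual_mulA : associative dual_mul.
Proof. by move=> [a a'] [b b'] [c c']; rewrite /dual_mul /=; congr (_, _); ring. Qed.
Lemma dual_mulC : commutative dual_mul.
Proof. by move=> [a a'] [b b']; rewrite /dual_mul /=; congr (_, _); ring. Qed.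
Lemma dual_mul1 : left_id dual_one dual_mul.
Proof. by move=> [a a']; rewrite /dual_mul /=; congr (_, _); ring. Qed.
Lemma dual_mulD : left_distributive dual_mul +%R.
Proof.
move=> [a a'] [b b'] [c c'].
have e1 : (a + b) * c = a * c + b * c by exact: mulrDl.
have e2 : (a' + b') * c + (a + b) * c' = (a' * c + a * c') + (b' * c + b * c').
  by rewrite !mulrDl addrACA.
exact: (congr2 pair e1 e2).
Qed.
Lemma dual_oner_neq0 : dual_one != 0.
Proof. by apply/eqP => -[/eqP]; rewrite oner_eq0. Qed.

HB.instance Definition _ := GRing.Zmodule_isComNzRing.Build (dual K)
  dual_mulA dual_mulC dual_mul1 dual_mulD dual_oner_neq0.

Lemma dual_exp (w e : K) n :
  ((w, e) : dual K) ^+ n = (w ^+ n, w ^+ n.-1 *+ n * e).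
Proof.
elim: n => [|n IH]; first by rewrite !expr0 mulr0n mul0r.
rewrite exprS IH; congr (_, _) => /=; first by rewrite exprS.
case: n {IH} => [|n] /=; first by rewrite !expr0 mulr0n !mul0r mulr0 addr0 mulr1 mul1r.
by rewrite !mulrS exprS; ring.
Qed.

End Dual.

Section Derivations.
Variable K : fieldType.
Implicit Types (F G H : K -> Prop) (d : K -> K).

(** A derivation of [F] into [K], with arbitrary values outside [F]. Its values on [F] may leave
    [F]. *)
Definition pder F d : Prop :=
  [/\ subf F, forall x y, F x -> F y -> d (x - y) = d x - d y &
      forall x y, F x -> F y -> d (x * y) = d x * y + x * d y].

Section PDer.
Variables (F : K -> Prop) (d : K -> K).
Hypothesis hd : pder F d.

Lemma pder_subf : subf F. Proof. by case: hd. Qed.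
Lemma pderB x y : F x -> F y -> d (x - y) = d x - d y.
Proof. by case: hd => _ h _; apply: h. Qed.
Lemma pderM x y : F x -> F y -> d (x * y) = d x * y + x * d y.
Proof. by case: hd => _ _ h; apply: h. Qed.
Lemma pder1 : d 1 = 0.
Proof.
have := pderM (subf1 pder_subf) (subf1 pder_subf).
by rewrite !mulr1 mul1r => /eqP; rewrite -subr_eq subrr eq_sym => /eqP.
Qed.
Lemma pder0 : d 0 = 0.
Proof.
by rewrite -(subrr 1) pderB ?subrr //; apply: (subf1 pder_subf).
Qed.
Lemma pderN x : F x -> d (- x) = - d x.
Proof. by move=> h; rewrite -sub0r pderB ?pder0 ?sub0r //; apply: (subf0 pder_subf). Qed.
Lemma pderD x y : F x -> F y -> d (x + y) = d x + d y.
Proof.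
by move=> h h'; rewrite -[y]opprK pderB ?pderN ?opprK //; apply: (subfN pder_subf).
Qed.
Lemma pderV x : F x -> x != 0 -> d x^-1 = - d x / x ^+ 2.
Proof.
move=> h x0; have := pderM h (subfV pder_subf h).
rewrite mulfV // pder1 => e; apply: (mulfI x0).
have /eqP -> : x * d x^-1 == - (d x * x^-1) by rewrite -addr_eq0 addrC -e.
by rewrite expr2 invfM; field.
Qed.
Lemma pder_sum (I : Type) (r : seq I) (P : pred I) (g : I -> K) :
  (forall i, P i -> F (g i)) ->
  d (\sum_(i <- r | P i) g i) = \sum_(i <- r | P i) d (g i).
Proof.
move=> h; suff [] : F (\sum_(i <- r | P i) g i) /\
  d (\sum_(i <- r | P i) g i) = \sum_(i <- r | P i) d (g i) by [].
elim/big_rec2: _ => [|i x y Pi [hy <-]].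
  by split; [apply: (subf0 pder_subf)|apply: pder0].
by split; [apply: (subfD pder_subf) => //; apply: h|rewrite pderD //; apply: h].
Qed.

(** The map sending [x] to [x + d(x) eps] in the dual numbers is a ring homomorphism exactly when
    [d] is a derivation, so extending derivations means extending homomorphisms. *)
Definition drel : K -> dual K -> Prop := fun x q => F x /\ q = (x, d x).

Lemma drel_phom : phom drel.
Proof.
split; first split.
- by split; [apply: (subf1 pder_subf)|rewrite pder1].
- move=> x y _ _ [h ->] [h' ->]; split; first exact: (subfB pder_subf).
  by rewrite pderB.
- move=> x y _ _ [h ->] [h' ->]; split; first exact: (subfM pder_subf).
  by rewrite pderM.
- by move=> _ [_ ->]; rewrite pder0.
- move=> x q [h _] x0; exists (x^-1, d x^-1); split => //.
  exact: (subfV pder_subf).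
Qed.

(** Taylor expansion at [w + e eps]: the infinitesimal part is the polynomial with differentiated
    coefficients at [w], plus [e] times the formal derivative at [w]. *)
Lemma drel_horner f g w e : prel drel f g ->
  g.[(w, e)] = (f.[w], \sum_(i < size f) d f`_i * w ^+ i + f^`().[w] * e).
Proof.
move=> h; rewrite (horner_coef_wide _ (phom_prel_size drel_phom h)).
have -> : f^`().[w] * e = \sum_(i < size f) f`_i * (w ^+ i.-1 *+ i * e).
  have {1}-> : f = \sum_(i < size f) f`_i *: 'X^i by rewrite -poly_def coefK.
  rewrite linear_sum horner_sum mulr_suml; apply: eq_bigr => i _.
  by rewrite linearZ /= derivXn hornerZ hornerMn hornerXn mulrA.
rewrite horner_coef -big_split /=.
elim: (size f) => [|n IH]; first by rewrite !big_ord0.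
rewrite !big_ord_recr /= IH; have [_ ->] := h n; rewrite dual_exp.
by congr (_, _).
Qed.

End PDer.

(** All pairs in the generated relation have the form [(x, x + y eps)]. Since the relation is
    functional, [y] can be read off as the value of the extended derivation. *)
Lemma pder_adjoin F d (I : Type) (w e : I -> K) : pder F d ->
  phom (adjoin (drel F d) w (fun i => (w i, e i))) ->
  exists d', [/\ pder (fadj F w) d', forall x, F x -> d' x = d x &
                 forall i, d' (w i) = e i].
Proof.
move=> hd hA; set A := adjoin _ _ _ in hA.
have A1 x q : A x q -> q.1 = x.
  elim=> {x q} //.
  - by move=> x q [_ ->].
  - by move=> x y q r _ <- _ <-.
  - by move=> x y q r _ <- _ <-.
  - move=> x q r _ h e'; have := congr1 fst e'; rewrite /= h => e2.
    have x0 : x != 0 by apply: contra_eq_neq e2 => ->; rewrite mul0r eq_sym oner_neq0.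
    by apply: (mulfI x0); rewrite mulfV.
have hdom x : rdom A x <-> fadj F w x.
  rewrite (rdom_adjoin x hA); split; apply: fadj_min.
  - by apply: fadj_subf; apply: (pder_subf hd).
  - by move=> y [q [h _]]; apply: fadj_base.
  - by move=> i; apply: fadj_gen.
  - by apply: fadj_subf; apply: (rdom_subf (drel_phom hd)).
  - by move=> y h; apply: fadj_base; exists (y, d y).
  - by move=> i; apply: fadj_gen.
have /choice [d' hd'] : forall x, exists z, fadj F w x -> A x (x, z).
  move=> x; have [/hdom [[y z] h]|h] := pselect (fadj F w x); last by exists 0.
  by exists z => _; have /= e1 := A1 _ _ h; rewrite -{2}e1.
have uniq x z : A x (x, z) -> d' x = z.
  move=> h; have hx : fadj F w x by apply/hdom; exists (x, z).
  by have [] := phom_fun hA (hd' _ hx) h.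
have sF := fadj_subf w (pder_subf hd).
exists d'; split.
- split => //.
  + by move=> x y /hd' h /hd' h'; apply: uniq; apply: (adj_sub h h').
  + by move=> x y /hd' h /hd' h'; apply: uniq; apply: (adj_mul h h').
- by move=> x h; apply: uniq; apply: adj_base.
- by move=> i; apply: uniq; apply: (@adj_gen _ (dual K) (drel F d) _ w (fun i => (w i, e i)) i).
Qed.

Lemma dual_unit (q : dual K) : q.1 != 0 -> exists r, q * r = 1.
Proof.
case: q => a b /= a0; exists (a^-1, - b / a ^+ 2).
by congr (_, _) => /=; [rewrite mulfV|field].
Qed.

Lemma drel_mrel_fst F d n (f : {mpoly K[n]}) g (w e : 'I_n -> K) : pder F d ->
  mrel (drel F d) f g -> (g.@[fun i => (w i, e i) : dual K]).1 = f.@[w].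
Proof.
move=> hd h; pose T : K -> dual K -> Prop := fun x q => q.1 = x.
have hT : rrel T.
  by split=> // x y q r <- <-.
suff : T f.@[w] g.@[fun i => (w i, e i) : dual K] by [].
apply: mrel_meval => //.
by move=> m; have [_ ->] := h m.
Qed.

Lemma drel_prel_fst F d (f : {poly K}) g (w e : K) : pder F d ->
  prel (drel F d) f g -> (g.[((w, e) : dual K)]).1 = f.[w].
Proof. by move=> hd /(drel_horner hd w e) ->. Qed.

Lemma pder_ext_algindep F d n (w e : 'I_n -> K) : pder F d ->
  malgindep F w ->
  exists d', [/\ pder (fadj F w) d', forall x, F x -> d' x = d x &
                 forall i, d' (w i) = e i].
Proof.
move=> hd hw; apply: pder_adjoin => //.
have [] // := @adjoin_mpoly K (dual K) (drel F d) n w (fun i => (w i, e i) : dual K) (drel_phom hd).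
- move=> f g h f0; have f00 : f = 0 by apply: hw => // m; have [] := h m.
  by rewrite f00 in h; rewrite (phom_mrel0 (drel_phom hd) h) meval0.
- by move=> f g h f0; apply: dual_unit; rewrite (drel_mrel_fst _ _ hd h).
Qed.

Lemma rdom_drel F d : pder F d -> rdom (drel F d) = F.
Proof.
by move=> hd; apply/funext => x; apply/propext; split=> [[q []]|h] //; exists (x, d x).
Qed.

Lemma pder_ext_sepalg F d w : pder F d -> sepalg F w ->
  exists d', pder (fadj F (fun _ : unit => w)) d' /\ forall x, F x -> d' x = d x.
Proof.
move=> hd; rewrite -{1}(rdom_drel hd) => hw.
have [h [h' [hh hw0 hd0 h0 min]]] := sepalg_minpoly (drel_phom hd) hw.
(* The only value for which [w + e eps] is again a root of the minimal polynomial. *)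
pose e := - (\sum_(i < size h) d h`_i * w ^+ i) / h^`().[w].
have [] := @pder_adjoin F d unit (fun _ => w) (fun _ => e) hd; last first.
  by move=> d' [h1 h2 _]; exists d'.
have [] // := @adjoin_root K (dual K) (drel F d) w (w, e) h h' (drel_phom hd).
rewrite (drel_horner hd _ _ hh) hw0; congr (_, _).
by rewrite /e mulrC divfK // addrN.
Qed.

(** If [w] is transcendental or inseparable, every [f] over [F] vanishing at [w] has a derivative
    vanishing at [w], so [w + eps] satisfies all relations satisfied by [w]. *)
Lemma pder_ext_insep F w : subf F -> ~ sepalg F w ->
  exists d', [/\ pder (fadj F (fun _ : unit => w)) d',
                 forall x, F x -> d' x = 0 & d' w = 1].
Proof.
move=> hF hw; have hd : pder F (fun _ => 0).
  by split => // x y _ _; rewrite ?subrr // mul0r mulr0 addr0.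
have [] := @pder_adjoin F _ unit (fun _ => w) (fun _ => 1) hd; last first.
  by move=> d' [h1 h2 h3]; exists d'; split => //; apply: (h3 tt).
have [] // := @adjoin_poly K (dual K) (drel F (fun _ => 0)) w (w, 1) (drel_phom hd).
- move=> f g h f0; rewrite (drel_horner hd _ _ h) f0.
  have -> : f^`().[w] = 0.
    apply: contrapT => /eqP f1; apply: hw; exists f; split => // i.
    by have [] := h i.
  by rewrite mul0r addr0 big1 // => i _; rewrite mul0r.
- by move=> f g h f0; apply: dual_unit; rewrite (drel_prel_fst _ _ hd h).
Qed.

(** ** Towers of separable algebraic elements *)

Fixpoint fadjs F (us : seq K) : K -> Prop :=
  if us is u :: us' then fadjs (fadj F (fun _ : unit => u)) us' else F.

Fixpoint tower F (us : seq K) : Prop :=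
  if us is u :: us' then sepalg F u /\ tower (fadj F (fun _ : unit => u)) us'
  else True.

Lemma fadjs_subf F us : subf F -> subf (fadjs F us).
Proof. by elim: us F => //= u us IH F hF; apply: IH; apply: fadj_subf. Qed.

Lemma fadjs_base F us x : F x -> fadjs F us x.
Proof. by elim: us F => //= u us IH F hF; apply: IH; apply: fadj_base. Qed.

Lemma fadjs_mem F us x : x \in us -> fadjs F us x.
Proof.
elim: us F => //= u us IH F; rewrite inE => /orP [/eqP ->|/IH //].
by apply: fadjs_base; apply: (fadj_gen _ _ tt).
Qed.

Lemma fadjs_min F us G : subf G -> (forall x, F x -> G x) ->
  (forall x, x \in us -> G x) -> forall x, fadjs F us x -> G x.
Proof.
move=> hG; elim: us F => //= u us IH F FG uG x; apply: IH.
  by apply: fadj_min => // _; apply: uG; rewrite inE eqxx.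
by move=> y hy; apply: uG; rewrite inE hy orbT.
Qed.

Lemma pder_ext_tower F d us : pder F d -> tower F us ->
  exists d', pder (fadjs F us) d' /\ forall x, F x -> d' x = d x.
Proof.
elim: us F d => [|u us IH] F d hd /=; first by exists d.
move=> [/(pder_ext_sepalg hd) [d' [hd' e']] /(IH _ _ hd') [d'' [h1 h2]]].
by exists d''; split => // x hx; rewrite h2 ?e' //; apply: fadj_base.
Qed.

(** The tail is a tower over [F(u)] by induction. If [u] were not separable algebraic, a derivation
    over [F] with value 1 at [u] would extend up this tower and contradict the hypothesis. *)
Lemma tower_of_derivations F us : subf F ->
  (forall d, pder (fadjs F us) d -> (forall x, F x -> d x = 0) ->
     forall u, u \in us -> d u = 0) -> tower F us.
Proof.
elim: us F => //= u us IH F hF H.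
have ht : tower (fadj F (fun _ : unit => u)) us.
  apply: IH; first exact: fadj_subf.
  move=> d hd d0 v hv; apply: H => //; last by rewrite inE hv orbT.
  by move=> x hx; apply: d0; apply: fadj_base.
split => //; apply: contrapT => /(pder_ext_insep hF) [d [hd d0 du]].
have [d' [hd' e']] := pder_ext_tower hd ht.
have : d' u = 0.
  apply: H => //; last by rewrite inE eqxx.
  by move=> x hx; rewrite e' ?d0 //; apply: fadj_base.
by rewrite e' ?du; [move/eqP; rewrite oner_eq0|apply: (fadj_gen _ _ tt)].
Qed.

Lemma pder_eq0 F d (I : Type) (w : I -> K) : pder (fadj F w) d ->
  (forall x, F x -> d x = 0) -> (forall i, d (w i) = 0) ->
  forall x, fadj F w x -> d x = 0.
Proof.
move=> hd d0 dw x; elim=> {x} //.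
- by move=> x y hx ex hy ey; rewrite (pderB hd) // ex ey subrr.
- by move=> x y hx ex hy ey; rewrite (pderM hd) // ex ey mul0r mulr0 addr0.
- move=> x hx ex; have [->|x0] := eqVneq x 0; first by rewrite invr0 (pder0 hd).
  by rewrite (pderV hd) // ex oppr0 mul0r.
Qed.

Lemma pder_sub F G d : subf F -> (forall x, F x -> G x) -> pder G d -> pder F d.
Proof.
move=> hF FG [hG h1 h2]; split => // x y /FG hx /FG hy; [exact: h1|exact: h2].
Qed.

Lemma pder_comb F (I : finType) (c : I -> K) (d : I -> K -> K) : subf F ->
  (forall i, pder F (d i)) -> pder F (fun x => \sum_i c i * d i x).
Proof.
move=> hF hd; split => // x y hx hy.
  by rewrite -sumrB; apply: eq_bigr => i _; rewrite (pderB (hd i)) // mulrBr.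
rewrite mulr_suml mulr_sumr -big_split; apply: eq_bigr => i _ /=.
by rewrite (pderM (hd i)) // mulrDr mulrA mulrCA.
Qed.

(* Coordinates of a derivation with respect to a [G]-independent family are
   again derivations, so values in [K] can be retracted to values in [G]. *)
Lemma pder_coords E n (w : 'I_n -> K) d (G := fadj E w) : pder G d ->
  (forall x, E x -> G (d x)) ->
  exists s (b : 'I_s.+1 -> K) (D : 'I_s.+1 -> K -> K),
  [/\ indep G b, b ord0 = 1, forall l, pder G (D l),
      forall l x, G x -> G (D l x) &
      forall x, G x -> d x = \sum_l D l x * b l].
Proof.
move=> hd dE; have hG := pder_subf hd.
have [s [b [k [hb b0 hk e]]]] := basis_extract1 (fun i => d (w i)) hG.
have ex x : G x -> exists c : 'I_s.+1 -> K,
    (forall l, G (c l)) /\ d x = \sum_l c l * b l.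
  elim=> {x}.
  - move=> x hx; exists (fun l => if l == ord0 then d x else 0); split.
      by move=> l; case: ifP => _; [apply: dE|apply: subf0].
    rewrite (bigD1 ord0) //= b0 mulr1 big1 ?addr0 // => l /negPf ->.
    by rewrite mul0r.
  - by move=> i; exists (k i).
  - move=> x y hx [c [hc ex]] hy [c' [hc' ey]]; exists (fun l => c l - c' l).
    split; first by move=> l; apply: subfB.
    by rewrite (pderB hd) // ex ey -sumrB; apply: eq_bigr => l _; rewrite mulrBl.
  - move=> x y hx [c [hc ex]] hy [c' [hc' ey]]; exists (fun l => c l * y + x * c' l).
    split; first by move=> l; apply: subfD => //; apply: subfM.
    rewrite (pderM hd) // ex ey mulr_suml mulr_sumr -big_split; apply: eq_bigr => l _ /=.
    by rewrite mulrDl mulrA mulrAC.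
  - move=> x hx [c [hc ex]]; have [->|x0] := eqVneq x 0.
      exists (fun _ => 0); split; first by move=> _; apply: subf0.
      by rewrite invr0 (pder0 hd) big1 // => l _; rewrite mul0r.
    exists (fun l => - c l / x ^+ 2); split.
      by move=> l; apply: subf_div => //; [apply: subfN|apply: subfX].
    rewrite (pderV hd) // ex -sumrN mulr_suml; apply: eq_bigr => l _.
    by rewrite mulNr mulNr mulNr mulrAC.
have /choice [D hD] : forall x, exists c : 'I_s.+1 -> K,
    G x -> (forall l, G (c l)) /\ d x = \sum_l c l * b l.
  move=> x; have [hx|hx] := pselect (G x); last by exists (fun _ => 0).
  by have [c hc] := ex x hx; exists c.
exists s, b, (fun l x => D x l); split => //.
- move=> l; split => // x y hx hy; have [hcx ex'] := hD x hx; have [hcy ey'] := hD y hy.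
    apply: (@indep_coords K G _ b (D (x - y)) (fun l => D x l - D y l)) => //.
    + by have [] := hD (x - y) (subfB hG hx hy).
    + by move=> l'; apply: subfB.
    + have [_ <-] := hD (x - y) (subfB hG hx hy).
      by rewrite (pderB hd) // ex' ey' -sumrB; apply: eq_bigr => l' _; rewrite mulrBl.
  apply: (@indep_coords K G _ b (D (x * y)) (fun l => D x l * y + x * D y l)) => //.
  + by have [] := hD (x * y) (subfM hG hx hy).
  + by move=> l'; apply: subfD => //; apply: subfM.
  + have [_ <-] := hD (x * y) (subfM hG hx hy).
    rewrite (pderM hd) // ex' ey' mulr_suml mulr_sumr -big_split; apply: eq_bigr => l' _ /=.
    by rewrite mulrDl mulrA mulrAC.
- by move=> l x hx; have [] := hD x hx.
- by move=> x hx; have [] := hD x hx.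
Qed.

(** ** Algebraic independence from derivations *)

Lemma mpoly_coef_ind F n (P : {mpoly K[n]} -> Prop) :
  (forall c, F c -> P c%:MP) -> P 0 -> P 1 -> (forall i, P 'X_i) ->
  (forall f g, P f -> P g -> P (f + g)) ->
  (forall f g, P f -> P g -> P (f * g)) ->
  forall f, (forall m, F f@_m) -> P f.
Proof.
move=> PC P0 P1 PX PD PM f hf; rewrite [f]mpolyE.
apply: (big_ind P P0 PD) => m _; rewrite -mul_mpolyC; apply: (PM); first exact: PC.
rewrite mpolyXE_id; apply: (big_ind P P1 PM) => i _.
by elim: (m i) => [|k IH]; rewrite ?expr0 // exprS; apply: PM.
Qed.

Lemma subf_meval F n (f : {mpoly K[n]}) (w : 'I_n -> K) : subf F ->
  (forall m, F f@_m) -> (forall i, F (w i)) -> F f.@[w].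
Proof.
move=> hF hf hw; rewrite mevalE; apply: subf_sum => // m _; apply: subfM => //.
by apply: subf_prod => // i _; apply: subfX.
Qed.

Lemma pder_meval F H d n (w : 'I_n -> K) (f : {mpoly K[n]}) : pder H d ->
  (forall x, F x -> H x) -> (forall x, F x -> d x = 0) -> (forall i, H (w i)) ->
  (forall m, F f@_m) ->
  d f.@[w] = \sum_i f^`M(i).@[w] * d (w i).
Proof.
move=> hd FH d0 wH hf; have hH := pder_subf hd.
suff [] : H f.@[w] /\ d f.@[w] = \sum_i f^`M(i).@[w] * d (w i) by [].
move: f hf; apply: mpoly_coef_ind.
- move=> c Fc; rewrite mevalC; split; first exact: FH.
  by rewrite d0 // big1 // => i _; rewrite mderivC meval0 mul0r.
- rewrite meval0; split; first exact: subf0.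
  by rewrite (pder0 hd) big1 // => i _; rewrite mderiv0 meval0 mul0r.
- rewrite meval1; split; first exact: subf1.
  by rewrite (pder1 hd) big1 // => i _; rewrite -mpolyC1 mderivC meval0 mul0r.
- move=> i; rewrite mevalXU; split => //.
  rewrite (bigD1 i) //= mderivX mevalZ mnmE eqxx mul1r.
  have -> : (U_(i) - U_(i))%MM = 0%MM by apply/mnmP => j; rewrite mnmBE subnn mnm0E.
  rewrite mpolyX0 meval1 mul1r big1 ?addr0 // => j ji.
  by rewrite mderivX mevalZ mnmE eq_sym (negPf ji) mul0r mul0r.
- move=> f g [h1 e1] [h2 e2]; rewrite mevalD; split; first exact: subfD.
  rewrite (pderD hd) // e1 e2 -big_split; apply: eq_bigr => i _ /=.
  by rewrite mderivD mevalD mulrDl.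
- move=> f g [h1 e1] [h2 e2]; rewrite mevalM; split; first exact: subfM.
  rewrite (pderM hd) // e1 e2 mulr_suml mulr_sumr -big_split; apply: eq_bigr => i _ /=.
  by rewrite mderivM mevalD !mevalM mulrDl mulrAC mulrA.
Qed.

(* Finite families of [E] have coordinates in [E] with respect to families
   independent over the p-th powers of the whole field: [K] is separable over
   [E]. *)
Definition good_over p E : Prop :=
  forall n (e : 'I_n -> K), (forall i, E (e i)) ->
  exists s (kap : 'I_s -> K) (al : 'I_n -> 'I_s -> K),
  [/\ forall j, E (kap j), forall i j, E (al i j),
      pindep p (fun _ => True) kap &
      forall i, e i = \sum_j al i j ^+ p * kap j].

(** Differentiating a relation [f(w) = 0] and using that the values of the derivations satisfy no
    common linear relation, every partial derivative of [f] vanishes at [w], hence is zero by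
    induction on the degree. So all exponents in [f] are divisible by [p]. Separability over [E]
    writes the coefficients as sums of [al ^+ p * kap], and [f(w)] becomes a combination of the
    [kap] with coefficients [g_j(w) ^+ p]. Each [g_j] vanishes at [w], and its degree is that of [f]
    divided by [p]. *)
Lemma algindep_of_derivations p E H s (w : 'I_s -> K) : p \in [pchar K] ->
  subf E -> good_over p E -> (forall x, E x -> H x) -> (forall j, H (w j)) ->
  (forall lam : 'I_s -> K,
     (forall d, pder H d -> (forall x, E x -> d x = 0) ->
        \sum_j lam j * d (w j) = 0) -> forall j, lam j = 0) ->
  malgindep E w.
Proof.
move=> hp hE good EH wH hlam f hf f0.
have [n] : exists n, forall m, f@_m != 0 -> (mdeg m < n)%N.
  by exists (msize f) => m; rewrite -mcoeff_msupp => /msize_mdeg_lt.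
have p_pr := pcharf_prime hp.
elim: n f hf f0 => [|n IH] f hf f0 hn.
  by apply/mpolyP => m; rewrite mcoeff0; apply: contraTeq isT => /hn.
have der0 i : f^`M(i) = 0.
  apply: IH.
  - by move=> m; rewrite mcoeff_deriv; apply: subfMn.
  - apply: (hlam (fun i => f^`M(i).@[w])) => d hd d0.
    by rewrite -(pder_meval hd EH) // f0 (pder0 hd).
  - move=> m; rewrite mcoeff_deriv => h.
    have : f@_(m + U_(i)) != 0 by apply: contraNneq h => ->; rewrite mul0rn.
    by move/hn; rewrite mdegD mdeg1 addn1 ltnS.
have dvd m i : f@_m != 0 -> (p %| m i)%N.
  move=> fm; have [->|mi] := posnP (m i); first exact: dvdn0.
  have : f^`M(i)@_(m - U_(i)) = 0 by rewrite der0 mcoeff0.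
  rewrite mcoeff_deriv submK; last by rewrite lep1mP -lt0n.
  rewrite mnmBE mnm1E eqxx subn1 prednK // -mulr_natr => /eqP.
  by rewrite mulf_eq0 (negPf fm) /= (dvdn_pcharf hp).
(* Degree zero is treated apart, since dividing exponents by [p] does not lower it. *)
case: n IH hn => [|n] IH hn.
  have e : f = (f@_0)%:MP.
    apply/mpolyP => m; rewrite mcoeffC; have [<-|m0] := eqVneq 0%MM m.
      by rewrite mulr1.
    rewrite mulr0; apply: contraNeq m0 => /hn.
    by rewrite ltnS leqn0 mdeg_eq0 eq_sym.
  by move: f0; rewrite e mevalC => ->; rewrite mpolyC0.
pose mm (i : 'I_(size (msupp f))) : 'X_{1..s} := nth 0%MM (msupp f) i.
have mmin i : f@_(mm i) != 0 by rewrite -mcoeff_msupp; apply: mem_nth.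
have [t [kap [al [kapE alE hkap e]]]] := good _ (fun i => f@_(mm i)) (fun i => hf _).
pose q (m : 'X_{1..s}) : 'X_{1..s} := [multinom (m i %/ p)%N | i < s].
have qE m i : q m i = (m i %/ p)%N by rewrite mnmE.
have q_inj i i' : q (mm i) = q (mm i') -> i = i'.
  move=> eq; have : mm i = mm i'.
    apply/mnmP => j; rewrite -(divnK (dvd _ j (mmin i))) -(divnK (dvd _ j (mmin i'))).
    by rewrite -!qE eq.
  move=> h; apply/val_inj/eqP.
  by rewrite -(nth_uniq 0%MM (ltn_ord i) (ltn_ord i') (msupp_uniq f)); apply/eqP.
have qX i : 'X_[K, mm i].@[w] = 'X_[K, q (mm i)].@[w] ^+ p.
  rewrite !mevalX -prodrXl; apply: eq_bigr => j _.
  by rewrite -exprM qE divnK //; apply: dvd.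
pose g j : {mpoly K[s]} := \sum_i al i j *: 'X_[q (mm i)].
have gc i j : (g j)@_(q (mm i)) = al i j.
  rewrite raddf_sum (bigD1 i) //= mcoeffZ mcoeffX eqxx mulr1 big1 ?addr0 // => i' ii.
  rewrite mcoeffZ mcoeffX; case: eqP => [/q_inj h|_]; last by rewrite mulr0.
  by rewrite h eqxx in ii.
have gsupp j m : (g j)@_m != 0 -> exists i, m = q (mm i).
  apply: contra_neqP => h; rewrite raddf_sum big1 // => i _ /=.
  rewrite mcoeffZ mcoeffX; case: eqP => [e'|_]; last by rewrite mulr0.
  by case: h; exists i.
have g0 j : g j = 0.
  apply: IH.
  - move=> m; rewrite raddf_sum; apply: subf_sum => // i _ /=; rewrite mcoeffZ mcoeffX.
    by apply: subfM => //; apply: subf_nat.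
  - apply: (hkap (fun j => (g j).@[w])) => //.
    rewrite -[RHS]f0 [f in RHS]mpolyE raddf_sum /=.
    rewrite (big_nth 0%MM) big_mkord.
    under [RHS]eq_bigr => i _ do rewrite -/(mm i) mevalZ qX e mulr_suml.
    rewrite exchange_big /=; apply: eq_bigr => j' _.
    rewrite raddf_sum /= (expp_sum hp) mulr_suml; apply: eq_bigr => i _.
    by rewrite mevalZ exprMn mulrAC.
  - move=> m /gsupp [i ->].
    have mq : (mdeg (q (mm i)) * p = mdeg (mm i))%N.
      rewrite !mdegE big_distrl /=; apply: eq_bigr => k _.
      by rewrite qE divnK //; apply: dvd.
    have := hn _ (mmin i); rewrite -mq ltnS => h.
    have [->//|h0] := posnP (mdeg (q (mm i))).
    by apply: leq_trans h; rewrite -{1}[mdeg _]muln1 ltn_pmul2l // prime_gt1.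
apply/mpolyP => m; rewrite mcoeff0; apply/eqP; apply: contraT => fm.
have mS : m \in msupp f by rewrite mcoeff_msupp.
have [i mi] : exists i, m = mm i.
  have h : (index m (msupp f) < size (msupp f))%N by rewrite index_mem.
  by exists (Ordinal h); rewrite /mm /= nth_index.
move: fm; rewrite mi e big1 ?eqxx // => j _.
by rewrite -gc g0 mcoeff0 expr0n (gtn_eqF (prime_gt0 p_pr)) mul0r.
Qed.

End Derivations.

(** * The cyclic vector argument *)

Section Coefficients.
Variable K : fieldType.
Variable F : K -> Prop.
Hypothesis hF : subf F.
Variable n : nat.
Implicit Types (f g : {mpoly K[n]}).

Definition coefin f : Prop := forall m, F f@_m.

Lemma coefinE f : coefin f <-> mrel (idrel F) f f.
Proof. by rewrite mrel_idrel; split=> [|[]]. Qed.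

Let rF := phom_rrel (idrel_phom hF).

Lemma coefin1 : coefin 1. Proof. by apply/coefinE; apply: mrel1. Qed.
Lemma coefin0 : coefin 0. Proof. by apply/coefinE; apply: mrel0. Qed.
Lemma coefinD f g : coefin f -> coefin g -> coefin (f + g).
Proof. by rewrite !coefinE => h h'; apply: mrelD. Qed.
Lemma coefinB f g : coefin f -> coefin g -> coefin (f - g).
Proof. by rewrite !coefinE => h h'; apply: mrelB. Qed.
Lemma coefinM f g : coefin f -> coefin g -> coefin (f * g).
Proof. by rewrite !coefinE => h h'; apply: mrelM. Qed.
Lemma coefinX m : coefin 'X_[m].
Proof. by apply/coefinE; apply: mrelXm. Qed.
Lemma coefinZ x f : F x -> coefin f -> coefin (x *: f).
Proof. by rewrite !coefinE => h h'; apply: mrelZ. Qed.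
Lemma coefin_sum (I : Type) (r : seq I) (P : pred I) (g : I -> {mpoly K[n]}) :
  (forall i, P i -> coefin (g i)) -> coefin (\sum_(i <- r | P i) g i).
Proof.
move=> h; apply: (big_ind coefin coefin0) => // f f'; exact: coefinD.
Qed.
Lemma coefin_prod (I : Type) (r : seq I) (P : pred I) (g : I -> {mpoly K[n]}) :
  (forall i, P i -> coefin (g i)) -> coefin (\prod_(i <- r | P i) g i).
Proof.
move=> h; apply: (big_ind coefin coefin1) => // f f'; exact: coefinM.
Qed.
Lemma coefin_exp f k : coefin f -> coefin (f ^+ k).
Proof.
by move=> h; elim: k => [|k IH]; rewrite ?exprS; [apply: coefin1|apply: coefinM].
Qed.
Lemma coefin_det k (A : 'M[{mpoly K[n]}]_k) :
  (forall i j, coefin (A i j)) -> coefin (\det A).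
Proof.
move=> h; apply: coefin_sum => s _; apply: coefinM; last exact: coefin_prod.
apply: coefin_exp; rewrite -[-1]sub0r; apply: coefinB; [exact: coefin0|exact: coefin1].
Qed.

End Coefficients.

Section CyclicVector.
Variable K : fieldType.
Implicit Types (F G E : K -> Prop) (d D : K -> K).

Lemma pder_stable F (I : Type) (w : I -> K) d : pder (fadj F w) d ->
  (forall x, F x -> fadj F w (d x)) -> (forall i, fadj F w (d (w i))) ->
  forall x, fadj F w x -> fadj F w (d x).
Proof.
move=> hd dF dw x; have hA := pder_subf hd; elim=> {x} //.
- by move=> x y hx ex hy ey; rewrite (pderB hd) //; apply: subfB.
- move=> x y hx ex hy ey; rewrite (pderM hd) //.
  by apply: subfD => //; apply: subfM.
- move=> x hx ex; have [->|x0] := eqVneq x 0; first by rewrite invr0 (pder0 hd); apply: subf0.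
  by rewrite (pderV hd) //; apply: subf_div => //; [apply: subfN|apply: subfX].
Qed.

Lemma pder_iter F D x j : F x -> (forall y, F y -> F (D y)) -> F (iter j D x).
Proof. by move=> hx hD; elim: j => //= j IH; apply: hD. Qed.

Lemma pder_leibniz F D x y j : pder F D -> (forall z, F z -> F (D z)) ->
  F x -> F y -> iter j D (x * y) =
    \sum_(l < j.+1) (iter l D x * iter (j - l) D y) *+ 'C(j, l).
Proof.
move=> hD sD hx hy; have hF := pder_subf hD.
have hi l z : F z -> F (iter l D z) by move=> hz; apply: pder_iter.
elim: j => [|j IH]; first by rewrite big_ord1 /= mulr1n.
rewrite iterS IH (pder_sum hD); last first.
  by move=> l _; apply: subfMn => //; apply: (subfM hF); apply: hi.
have dMn z n : F z -> D (z *+ n) = D z *+ n.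
  move=> hz; elim: n => [|n IHn]; first by rewrite (pder0 hD).
  by rewrite !mulrS (pderD hD) ?IHn //; apply: subfMn.
have step (l : 'I_j.+1) : D ((iter l D x * iter (j - l) D y) *+ 'C(j, l)) =
   (iter l.+1 D x * iter (j - l) D y) *+ 'C(j, l) +
   (iter l D x * iter (j.+1 - l) D y) *+ 'C(j, l).
  rewrite dMn; last by apply: (subfM hF); apply: hi.
  have lj : (l <= j)%N by rewrite -ltnS.
  by rewrite (subSn lj) /= (pderM hD) ?mulrnDl //; apply: hi.
under eq_bigr do rewrite step.
rewrite big_split /= [RHS]big_ord_recl /= bin0 mulr1n.
rewrite [X in _ + X = _]big_ord_recl /= bin0 mulr1n addrCA; congr (_ + _).
have -> : \sum_(i < j) (iter (bump 0 i) D x * iter (j.+1 - bump 0 i) D y) *+ 'C(j, bump 0 i) =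
  \sum_(i < j.+1) (iter i.+1 D x * iter (j - i) D y) *+ 'C(j, i.+1).
  by rewrite big_ord_recr /= bin_small // mulr0n addr0.
rewrite -big_split; apply: eq_bigr => i _ /=.
by rewrite /bump /= add1n subSS binS mulrnDr addrC.
Qed.

Lemma row_free_rcons m q (r : 'rV[K]_q) (A : 'M[K]_(m, q)) :
  row_free A -> ~~ (r <= A)%MS -> row_free (col_mx r A).
Proof.
move=> hA nA; rewrite /row_free -(addsmxE r A).
have r1 : \rank r = 1%N.
  by apply/eqP; rewrite rank_rV eqb1; apply: contraNneq nA => ->; apply: sub0mx.
rewrite mxrank_disjoint_sum ?r1 ?(eqP hA) //; apply/eqP.
rewrite -mxrank_eq0; apply/eqP.
have := mxrankS (capmxSl r A); rewrite r1.
case e : (\rank _) => [//|[|//]] _; case/negP: nA.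
have /eqmxP e2 : ((r :&: A) == r)%MS.
  by rewrite -(geq_leqif (mxrank_leqif_eq (capmxSl _ _))) e r1.
by rewrite -e2; apply: capmxSr.
Qed.

(** Take as many derivations of [G0] into itself, zero on [E], as possible with independent rows of
    values on [w]. A derivation with values in [K] has coordinates that are again derivations of
    [G0] into itself, so by maximality its row lies in the span of the chosen ones. *)
Lemma restrict_derivations E q (w : 'I_q -> K) : subf E ->
  let G0 := fadj E w in
  exists m (d : 'I_m -> K -> K), [/\ (m <= q)%N,
    forall i, pder G0 (d i), forall i x, E x -> d i x = 0,
    forall i x, G0 x -> G0 (d i x) & row_free (\matrix_(i, k) d i (w k)) /\
    forall Dl, pder G0 Dl -> (forall x, E x -> Dl x = 0) ->
      exists lam : 'I_m -> K, forall k, Dl (w k) = \sum_i lam i * d i (w k)].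
Proof.
move=> hE G0; have hG : subf G0 by apply: fadj_subf.
pose P m := `[< exists d : 'I_m -> K -> K, [/\ forall i, pder G0 (d i),
    forall i x, E x -> d i x = 0, forall i x, G0 x -> G0 (d i x) &
    row_free (\matrix_(i, k) d i (w k))] >].
have exP : exists m, P m.
  exists 0%N; apply/asboolP; exists (fun _ _ => 0); split => //; try by case.
  by rewrite /row_free flatmx0 mxrank0.
have ubP m : P m -> (m <= q)%N.
  by move=> /asboolP [d [_ _ _ /eqP <-]]; apply: rank_leq_col.
case: (ex_maxnP exP ubP) => m Pm mmax; exists m.
have /asboolP [d [h1 h2 h3 h4]] := Pm.
exists d; split => //; first exact: ubP.
split => // Dl hDl DlE.
have [|s [b [De [hb b0 hDe DeG eDl]]]] := pder_coords hDl.
  by move=> x hx; rewrite DlE //; apply: subf0.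
set A := \matrix_(i, k) d i (w k) in h4.
have inA l : (\row_k De l (w k) <= A)%MS.
  have DeE x : E x -> De l x = 0.
    move=> hx; apply: (hb (fun l => De l x)).
      by move=> l'; apply: DeG; apply: fadj_base.
    by rewrite -eDl ?DlE //; apply: fadj_base.
  apply: contraT => nA; suff : P m.+1 by move/mmax; rewrite ltnn.
  apply/asboolP.
  exists (fun i => if unlift ord0 i is Some j then d j else De l); split.
  - by move=> i; case: unliftP.
  - by move=> i x hx; case: unliftP => [j _|_]; [apply: h2|apply: DeE].
  - by move=> i x hx; case: unliftP => [j _|_]; [apply: h3|apply: DeG].
  - have -> : \matrix_(i < m.+1, k < q) (if unlift ord0 i is Some j then d j else De l) (w k)
        = col_mx (\row_k De l (w k)) A :> 'M_(1 + m, q).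
      apply/matrixP => i k; rewrite -[i](splitK (m := 1)).
      case: (split (m := 1) i) => j /=.
        rewrite (col_mxEu (m1 := 1)) !mxE; have -> : lshift m j = ord0.
          by apply: val_inj; case: j => -[].
        by rewrite unlift_none.
      rewrite (col_mxEd (m1 := 1)) !mxE; have -> : rshift 1 j = lift ord0 j.
        by apply: val_inj.
      by rewrite liftK.
    exact: row_free_rcons.
have : (\row_k Dl (w k) <= A)%MS.
  have -> : \row_k Dl (w k) = \sum_l b l *: \row_k De l (w k).
    apply/rowP => k; rewrite mxE summxE eDl; last exact: fadj_gen.
    by apply: eq_bigr => l _; rewrite !mxE mulrC.
  by apply: summx_sub => l _; apply: scalemx_sub.
move=> /submxP [L eL]; exists (fun i => L ord0 i) => k.
have /rowP/(_ k) := eL; rewrite !mxE => ->.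
by apply: eq_bigr => i _; rewrite !mxE.
Qed.

(** The system is triangular in [y]: the last term of equation [j] is [y j *m T 0], and [P] solves
    for it. It serves to exhibit a point where a determinant of polynomials does not vanish. *)
Lemma solve_rows m q (T : nat -> 'M[K]_(q, m)) (P : 'M_(m, q)) (t : nat -> 'rV_m) n :
  P *m T 0%N = 1%:M ->
  exists y : nat -> 'rV_q, forall j, (j < n)%N ->
    \sum_(l < j.+1) (y l *m T (j - l)%N) *+ 'C(j, l) = t j.
Proof.
move=> hP; elim: n => [|n [y hy]]; first by exists (fun _ => 0).
pose S := \sum_(l < n) (y l *m T (n - l)%N) *+ 'C(n, l).
pose z := (t n - S) *m P.
exists (fun j => if j == n then z else y j) => j; rewrite ltnS leq_eqVlt.
case/orP => [/eqP ->|hj].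
  rewrite big_ord_recr /= eqxx subnn binn mulr1n /z -mulmxA hP mulmx1.
  have -> : \sum_(l < n) ((if l == n :> nat then (t n - S) *m P else y l)
      *m T (n - l)%N) *+ 'C(n, l) = S.
    by apply: eq_bigr => l _; rewrite (ltn_eqF (ltn_ord l)).
  by rewrite addrC subrK.
rewrite -[RHS]hy //; apply: eq_bigr => l _.
by rewrite ltn_eqF // (leq_trans _ hj).
Qed.

Lemma pder_iter_sum G D (I : Type) (r : seq I) (g : I -> K) j : pder G D ->
  (forall x, G x -> G (D x)) -> (forall i, G (g i)) ->
  iter j D (\sum_(i <- r) g i) = \sum_(i <- r) iter j D (g i).
Proof.
move=> hD sD hg; elim: j => //= j ->; rewrite (pder_sum hD) // => i _.
exact: pder_iter.
Qed.

(* Over a base containing enough algebraically independent jets [c], the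
   derivation [D] has a cyclic vector [v 0] for the differentials of [w]. *)
Theorem cyclic_vector p E q (w : 'I_q -> K) (de : K -> K)
    (c : 'I_(q * q.+1).+1 -> K) (G0 := fadj E w) (E1 := fadj E c)
    (cn := fun i => if (i < (q * q.+1).+1)%N then c (inord i) else 0) :
  p \in [pchar K] -> subf E -> pder G0 de -> (forall x, E x -> E (de x)) ->
  malgindep G0 c -> good_over p E1 ->
  exists m (v : nat -> K) (D : K -> K),
  let E2 := fadj E1 (fun l : 'I_m => v l) in
  let us := v m :: codom w in
  [/\ malgindep E1 (fun l : 'I_m => v l), tower E2 us,
      pder (fadjs E2 us) D /\ (forall x, fadjs E2 us x -> fadjs E2 us (D x)),
      (forall x, E x -> D x = de x) /\ (forall i, D (cn i) = cn i.+1) &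
      (forall l, (l < m)%N -> D (v l) = v l.+1) /\
      (forall k, G0 (de (w k)) -> D (w k) = de (w k))].
Proof.
move=> hp hE hde sE hc good.
have hG0 : subf G0 := pder_subf hde.
have EG0 x : E x -> G0 x by apply: fadj_base.
have [|s [b [De [hb b0 hDe DeG eDe]]]] := pder_coords hde.
  by move=> x hx; apply: EG0; apply: sE.
(* The component along [b ord0 = 1] maps [G0] to itself and agrees with [de] wherever the value of
   [de] lies in [G0]. *)
pose D0 := De ord0.
have D0e x : G0 x -> G0 (de x) -> D0 x = de x.
  move=> hx hdx.
  have := @indep_coords K G0 _ b (fun l => De l x) (fun l => if l == ord0 then de x else 0)
     hG0 hb; rewrite /D0 => ->; rewrite ?eqxx //.
  - by move=> l; apply: DeG.
  - by move=> l; case: ifP => _ //; apply: subf0.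
  - rewrite -eDe // [RHS](bigD1 ord0) //= b0 mulr1 big1 ?addr0 // => l /negPf ->.
    by rewrite mul0r.
have D0G x : G0 x -> G0 (D0 x) by apply: DeG.
(* Element [w k] owns the block of jets with indices [k(q+1), ..., k(q+1)+q]. As [m <= q], the
   blocks do not overlap in the expansions of [v 0, ..., v m]. Beyond [r] the jets are zero, which
   makes [D] nilpotent on them. *)
pose r := (q * q.+1).+1; pose G1 := fadj G0 c.
have cnE (i : 'I_r) : cn i = c i by rewrite /cn ltn_ord inord_val.
have cnG1 i : G1 (cn i).
  by rewrite /cn; case: ifP => _; [apply: fadj_gen|apply: subf0; apply: fadj_subf].
have [D [hD DD0 Dc]] := pder_ext_algindep (fun i => cn i.+1) (hDe ord0) hc.
have hG1 : subf G1 := pder_subf hD.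
have G01 x : G0 x -> G1 x by apply: fadj_base.
have DG1 x : G1 x -> G1 (D x).
  apply: (pder_stable hD) => [y hy|i]; last by rewrite Dc; apply: cnG1.
  by rewrite DD0 //; exact: (G01 _ (D0G _ hy)).
have Dcn i : D (cn i) = cn i.+1.
  rewrite {1}/cn; case: ltnP => hi; first by rewrite Dc inordK.
  by rewrite (pder0 hD) /cn ltnNge (leq_trans hi (leqnSn i)).
have [m [d [mq hd dE dG [rfA span]]]] := restrict_derivations w hE.
pose v0 := \sum_(k < q) cn (k * q.+1)%N * w k; pose v j := iter j D v0.
have wG0 k : G0 (w k) by apply: fadj_gen.
have wG1 k : G1 (w k) by apply: G01.
have v0G1 : G1 v0 by apply: subf_sum => // k _; exact: (subfM hG1 (cnG1 _) (wG1 _)).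
have vG1 j : G1 (v j) by exact: (pder_iter j v0G1 DG1).
have D0i a k : G0 (iter a D0 (w k)) by exact: (pder_iter a (wG0 k) D0G).
have iterD a k : iter a D (w k) = iter a D0 (w k).
  by elim: a => //= a ->; rewrite DD0 //; exact: D0i.
have itercn a i : iter a D (cn i) = cn (i + a)%N.
  by elim: a => [|a /= ->]; rewrite ?addn0 ?Dcn ?addnS.
have vE j : v j = \sum_(k < q) \sum_(l < j.+1)
    (cn (k * q.+1 + l)%N * iter (j - l) D0 (w k)) *+ 'C(j, l).
  rewrite /v (pder_iter_sum _ _ hD) //; last by move=> k; exact: (subfM hG1 (cnG1 _) (wG1 _)).
  apply: eq_bigr => k _; rewrite (pder_leibniz j hD DG1 (cnG1 _) (wG1 _)); apply: eq_bigr => l _.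
  by rewrite itercn iterD.
have /choice [d' hd'] : forall i, exists di', [/\ pder G1 di',
    forall x, G0 x -> di' x = d i x & forall j, di' (c j) = 0].
  by move=> i; apply: (pder_ext_algindep (fun _ => 0) (hd i) hc).
have d'0 i x : E1 x -> d' i x = 0.
  have [h1 h2 h3] := hd' i.
  apply: (@pder_eq0 K E (d' i) _ c) => //; last by move=> y hy; rewrite h2 ?dE //; apply: EG0.
  apply: pder_sub h1; first exact: fadj_subf.
  apply: fadj_min => // [y hy|j]; first by apply: fadj_base; apply: EG0.
  exact: fadj_gen.
have E1G1 x : E1 x -> G1 x.
  apply: fadj_min => // [y hy|j]; first by apply: G01; apply: EG0.
  exact: fadj_gen.
have cnE1 i : E1 (cn i).
  by rewrite /cn; case: ifP => _; [apply: fadj_gen|apply: subf0; apply: fadj_subf].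
have hE1 : subf E1 by apply: fadj_subf.
(* A derivation that kills the jets acts only on the factors [iter (j - l) D0 (w k)] of the Leibniz
   expansion. *)
have linv (f : K -> K) : pder G1 f -> (forall x, E1 x -> f x = 0) -> forall j,
    f (v j) = \sum_(k < q) \sum_(l < j.+1)
      (cn (k * q.+1 + l)%N * f (iter (j - l) D0 (w k))) *+ 'C(j, l).
  move=> hf f0 j.
  have iG a k : G1 (iter a D0 (w k)) by exact: (G01 _ (D0i a k)).
  have tG l a k : G1 (cn l * iter a D0 (w k)) by exact: (subfM hG1 (cnG1 _) (iG _ _)).
  rewrite vE (pder_sum hf); last first.
    by move=> k _; apply: subf_sum => // l _; apply: subfMn.
  apply: eq_bigr => k _; rewrite (pder_sum hf); last by move=> l _; apply: subfMn.
  apply: eq_bigr => l _.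
  rewrite -mulr_natl (pderM hf) //; last by apply: subf_nat.
  rewrite (f0 _ (subf_nat hE1 _)) mul0r add0r mulr_natl; congr (_ *+ _).
  by rewrite (pderM hf) // f0 // mul0r add0r.
pose T a : 'M[K]_(q, m) := \matrix_(k, i) d i (iter a D0 (w k)).
pose o (k : 'I_q) l : 'I_r := inord (k * q.+1 + l).
have olt (k : 'I_q) l : (l <= q)%N -> (k * q.+1 + l < r)%N.
  move=> lq; rewrite /r ltnS; apply: leq_trans (_ : k.+1 * q.+1 <= _)%N; last first.
    by apply: leq_mul => //; apply: ltn_ord.
  by rewrite mulSn addnC leq_add2r; apply: leq_trans lq _.
have oE (k : 'I_q) l : (l <= q)%N -> o k l = (k * q.+1 + l)%N :> nat.
  by move=> lq; rewrite /o inordK //; apply: olt.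
(* The matrix [Mat] with indeterminates in place of the jets; its coefficients lie in [G0]. *)
pose PM : 'M[{mpoly K[r]}]_m :=
  \matrix_(j, i) \sum_(k < q) \sum_(l < j.+1) (T (j - l)%N k i *+ 'C(j, l)) *: 'X_(o k l).
have lq (j : 'I_m) (l : 'I_j.+1) : (l <= q)%N.
  by rewrite -ltnS (leq_trans (ltn_ord l)) // ltnS (leq_trans (ltnW (ltn_ord j))).
pose Mat : 'M[K]_m := \matrix_(j, i) d' i (v j).
have MatE : Mat = map_mx (meval c) PM.
  apply/matrixP => j i; rewrite !mxE; have [h1 h2 h3] := hd' i.
  rewrite (linv _ h1 (d'0 i)) raddf_sum; apply: eq_bigr => k _.
  rewrite raddf_sum; apply: eq_bigr => l _ /=.
  rewrite mevalZ mevalXU -cnE oE ?lq // mxE h2; last exact: D0i.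
  by rewrite mulrnAl mulrC.
have PMG0 : forall m', G0 (\det PM)@_m'.
  apply: coefin_det => // j i; rewrite mxE.
  apply: (coefin_sum hG0) => k _; apply: (coefin_sum hG0) => l _.
  apply: (coefinZ hG0); last exact: coefinX.
  by apply: subfMn => //; rewrite mxE; exact: (dG _ _ (D0i _ _)).
(* At the point given by [solve_rows] the matrix becomes the identity. As the jets are algebraically
   independent over [G0], a nonzero determinant polynomial then gives an invertible [Mat]. *)
have detPM : \det PM != 0.
  set A := \matrix_(i, k) d i (w k) in rfA.
  have hP : (pinvmx A)^T *m T 0%N = 1%:M.
    have -> : T 0%N = A^T by apply/matrixP => k i; rewrite !mxE.
    by rewrite -trmx_mul mulmxVp // trmx1.
  have [y hy] := solve_rows (fun j => if insub j is Some j' then delta_mx 0 j' else 0) m hP.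
  pose x (i : 'I_r) := if insub (i %/ q.+1)%N is Some k then y (i %% q.+1)%N ord0 k else 0.
  have xo (k : 'I_q) l : (l <= q)%N -> x (o k l) = y l ord0 k.
    move=> hl; rewrite /x oE // divnMDl // divn_small ?ltnS // addn0.
    by rewrite insubT // => hk; rewrite modnMDl modn_small ?ltnS //; congr (y l _ _); apply: val_inj.
  have e1 : map_mx (meval x) PM = 1%:M.
    apply/matrixP => j i; rewrite !mxE raddf_sum.
    have := hy j (ltn_ord j); rewrite valK => /rowP/(_ i).
    rewrite summxE mxE eqxx eq_sym /= => <-.
    under eq_bigr do rewrite raddf_sum; rewrite exchange_big; apply: eq_bigr => l _ /=.
    have -> : (y l *m T (j - l)%N *+ 'C(j, l)) ord0 i = (y l *m T (j - l)%N) ord0 i *+ 'C(j, l).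
      by rewrite mulmxnE.
    rewrite mxE -sumrMnl; apply: eq_bigr => k _.
    by rewrite mevalZ mevalXU xo ?lq // mulrnAl mulrC.
  apply: contra_eq_neq e1 => e0; apply/eqP => /(congr1 determinant).
  by rewrite det_map_mx e0 raddf0 det1 => /eqP; rewrite eq_sym oner_eq0.
have unitMat : Mat \in unitmx.
  rewrite unitmxE unitfE MatE det_map_mx.
  by apply: contra_neq detPM => /(hc _ PMG0).
exists m, v, D => E2 us.
have usG1 x : fadjs E2 us x -> G1 x.
  apply: fadjs_min => //.
    by apply: fadj_min.
  by move=> y; rewrite inE => /orP [/eqP ->|/codomP [k ->]].
have G1us x : G1 x -> fadjs E2 us x.
  have hus : subf (fadjs E2 us) by apply: fadjs_subf; apply: fadj_subf.
  have E2us y : E1 y -> fadjs E2 us y by move=> h; apply: fadjs_base; apply: fadj_base.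
  apply: fadj_min => //; last by move=> i; apply: E2us; apply: fadj_gen.
  apply: fadj_min => //; first by move=> y hy; apply: E2us; apply: fadj_base.
  by move=> k; apply: fadjs_mem; rewrite inE codom_f orbT.
split.
- apply: (@algindep_of_derivations K p E1 G1) => // lam hlam.
  have e0 : (\row_j lam j) *m Mat = 0.
    apply/rowP => i; rewrite !mxE -[RHS](hlam (d' i)); last exact: d'0.
      by apply: eq_bigr => j _; rewrite !mxE.
    by have [] := hd' i.
  have : \row_j lam j = 0 by rewrite -(mulmxK unitMat (\row_j lam j)) e0 mul0mx.
  by move=> /rowP h j; have := h j; rewrite !mxE.
(* A derivation killing [E2] is a combination [lam] of the [d' i]; since it kills
   [v 0, ..., v (m - 1)], invertibility of [Mat] forces [lam = 0]. *)
- apply: tower_of_derivations; first exact: fadj_subf.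
  move=> Dl hDl Dl0.
  have hDl1 : pder G1 Dl by apply: pder_sub hDl.
  have Dl0' x : E1 x -> Dl x = 0 by move=> hx; apply: Dl0; apply: fadj_base.
  have [||lam hlam] := span Dl.
  + by apply: pder_sub hDl1.
  + by move=> x hx; apply: Dl0'; apply: fadj_base.
  pose Sd x := \sum_i lam i * d' i x.
  have hSd : pder G1 Sd by apply: pder_comb => // i; have [] := hd' i.
  have eq0 x : G1 x -> Dl x - Sd x = 0.
    pose f x := \sum_(i : bool) (if i then 1 else -1) * (if i then Dl else Sd) x.
    have fE y : f y = Dl y - Sd y by rewrite /f big_bool /= mul1r mulN1r.
    have hf : pder G1 f by apply: (@pder_comb K G1 _ (fun i : bool => if i then 1 else -1) (fun i : bool => if i then Dl else Sd)) => //; case.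
    rewrite -fE; move: x; apply: pder_eq0 => //.
      apply: pder_eq0 => //; first by apply: pder_sub hf.
        move=> y hy; rewrite fE Dl0' ?/Sd ?big1 ?subrr //; last by apply: fadj_base.
        by move=> i _; rewrite d'0 ?mulr0 //; apply: fadj_base.
      move=> k; rewrite fE hlam; apply/eqP; rewrite subr_eq0; apply/eqP.
      by apply: eq_bigr => i _; have [_ h _] := hd' i; rewrite h //; exact: wG0.
    move=> i; rewrite fE Dl0' ?/Sd ?big1 ?subrr //; last by apply: fadj_gen.
    by move=> j _; have [_ _ ->] := hd' j; rewrite mulr0.
  have e0 : (\row_i lam i) *m Mat^T = 0.
    apply/rowP => j; rewrite !mxE.
    have -> : \sum_i (\row_i lam i) ord0 i * Mat^T i j = Sd (v j).
      by apply: eq_bigr => i _; rewrite !mxE.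
    have := eq0 _ (vG1 j); rewrite Dl0; last by apply: (@fadj_gen _ _ _ (fun l : 'I_m => v l) j).
    by rewrite sub0r => /eqP; rewrite oppr_eq0 => /eqP.
  have lam0 i : lam i = 0.
    have uT : Mat^T \in unitmx by rewrite unitmx_tr.
    have : \row_i lam i = 0 by rewrite -(mulmxK uT (\row_i lam i)) e0 mul0mx.
    by move=> /rowP/(_ i); rewrite !mxE.
  have Dl00 x : G1 x -> Dl x = 0.
    move=> /eq0; rewrite /Sd big1 ?subr0 // => i _; rewrite lam0 mul0r //.
  move=> u; rewrite inE => /orP [/eqP ->|/codomP [k ->]]; exact: Dl00.
- split; first by apply: pder_sub hD => //; apply: fadjs_subf; apply: fadj_subf.
  by move=> x /usG1 /DG1 /G1us.
- split => // x hx; rewrite (DD0 _ (EG0 _ hx)).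
  exact: (D0e _ (EG0 _ hx) (EG0 _ (sE _ hx))).
- split=> [l _|k hk]; first by rewrite /v iterS.
  by rewrite (DD0 _ (wG0 k)); exact: (D0e _ (wG0 k) hk).
Qed.

End CyclicVector.

(** * Relative p-bases *)

Section PowerSpan.
Variables (K : fieldType) (p : nat).
Hypothesis hp : p \in [pchar K].
Implicit Types (F E : K -> Prop).

Let p_gt0 : (0 < p)%N := prime_gt0 (pcharf_prime hp).

Lemma pindep_reindex (I I' : finType) (h : I' -> I) (u : I -> K) : bijective h ->
  pindep p (fun _ => True) u -> pindep p (fun _ => True) (fun i => u (h i)).
Proof.
move=> [g gK hK] hu c _ c0 i; rewrite -[i]gK.
apply: (hu (fun i => c (g i))) => //; rewrite -[RHS]c0.
rewrite (reindex h) /=; last by exists g => x _; [apply: gK|apply: hK].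
by apply: eq_bigr => j _; rewrite gK.
Qed.

(** For a subfield [E] this is the compositum of [E] and the field of p-th powers of [K]. *)
Definition pspan E x : Prop :=
  exists n (y e : 'I_n -> K), (forall i, E (e i)) /\ x = \sum_i y i ^+ p * e i.

Lemma pspan_finType E (I : finType) (y e : I -> K) : (forall i, E (e i)) ->
  pspan E (\sum_i y i ^+ p * e i).
Proof.
move=> hE; exists #|I|, (fun i => y (enum_val i)), (fun i => e (enum_val i)).
split=> //; exact: big_enum_val.
Qed.

Lemma pspan_base E x : E x -> pspan E x.
Proof.
move=> hx; exists 1%N, (fun _ => 1), (fun _ => x); split => //.
by rewrite big_ord1 expr1n mul1r.
Qed.

Lemma pspan_ppow E x : subf E -> pspan E (x ^+ p).
Proof.
move=> hE; exists 1%N, (fun _ => x), (fun _ => 1); split; first by move=> _; apply: subf1.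
by rewrite big_ord1 mulr1.
Qed.

Lemma pspan_sub E E' x : (forall y, E y -> E' y) -> pspan E x -> pspan E' x.
Proof. by move=> h [n [y [e [he ->]]]]; apply: pspan_finType => i; apply: h. Qed.

Lemma pspan_subf E : subf E -> subf (pspan E).
Proof.
move=> hE.
have hM x y : pspan E x -> pspan E y -> pspan E (x * y).
  move=> [n [a [e [he ->]]]] [m [b [f [hf ->]]]].
  have -> : (\sum_i a i ^+ p * e i) * (\sum_i b i ^+ p * f i) =
     \sum_(ij : 'I_n * 'I_m) (a ij.1 * b ij.2) ^+ p * (e ij.1 * f ij.2).
    rewrite big_distrlr pair_bigA; apply: eq_bigr => ij _ /=.
    by rewrite exprMn mulrACA.
  by apply: pspan_finType => ij; apply: subfM.
have hX x n : pspan E x -> pspan E (x ^+ n).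
  move=> hx; elim: n => [|n IH]; first by apply: pspan_base; apply: subf1.
  by rewrite exprS; apply: hM.
split=> //.
- by apply: pspan_base; apply: subf1.
- move=> x y [n [a [e [he ->]]]] [m [b [f [hf ->]]]].
  have -> : \sum_i a i ^+ p * e i - \sum_i b i ^+ p * f i =
     \sum_(k : 'I_n + 'I_m) (match k with inl i => a i | inr j => - b j end) ^+ p
       * (match k with inl i => e i | inr j => f j end).
    rewrite big_sumType /= -sumrN; congr (_ + _); apply: eq_bigr => i _.
    by rewrite -[- b i]sub0r (exppB hp) expr0n (gtn_eqF p_gt0) sub0r mulNr.
  by apply: pspan_finType => -[].
- move=> x hx; have [->|x0] := eqVneq x 0.
    by rewrite invr0; apply: pspan_base; apply: subf0.
  have -> : x^-1 = x^-1 ^+ p * x ^+ p.-1.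
    by rewrite exprVn; apply: (mulfI x0); rewrite mulfV // mulrCA -exprS prednK // mulVf // expf_neq0.
  by apply: hM; [apply: pspan_ppow|apply: hX].
Qed.

(* The minimal polynomial of [b] over [F] divides [(X - b)^p]. *)
Lemma sepalg_ppow F b : subf F -> F (b ^+ p) -> sepalg F b -> F b.
Proof.
move=> hF hb; have hR := idrel_phom hF; have rR := phom_rrel hR.
have dom x : rdom (idrel F) x <-> F x by split=> [[y []]|h] //; exists x.
have -> : sepalg F b <-> sepalg (rdom (idrel F)) b.
  by split=> -[h [h1 h2 h3]]; exists h; split => // i; apply/dom.
move=> /(sepalg_minpoly hR) [h [h' [hh hw hd h0 min]]].
have hX : prel (idrel F) ('X^p - (b ^+ p)%:P) ('X^p - (b ^+ p)%:P).
  by apply: prelB => //; [apply: prelXn|apply: prelC].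
have [s [s' [t [t' [h1 h2 h3 _ h5]]]]] := prel_div hR hX hh h0.
have t0 : t = 0.
  apply: min => //; first by move=> i; exists t'`_i.
  have : ('X^p - (b ^+ p)%:P).[b] = 0 by rewrite hornerD hornerN hornerXn hornerC subrr.
  by rewrite h3 hornerD hornerM hw mulr0 add0r.
have e : 'X^p - (b ^+ p)%:P = ('X - b%:P) ^+ p :> {poly K}.
  have hpP : p \in [pchar {poly K}] by apply: (rmorph_pchar (polyC : {rmorphism K -> {poly K}})).
  have -> : ('X - b%:P) ^+ p = 'X ^+ p - b%:P ^+ p :> {poly K}.
    exact: (rmorphB (pFrobenius_aut hpP)).
  by rewrite rmorphXn.
have : h %| ('X - b%:P) ^+ p by rewrite -e h3 t0 addr0 dvdp_mulIr.
case/dvdp_exp_XsubCP => k _ /eqpP [[c1 c2] /= /andP [c10 c20] ek].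
have {ek} ek : h = (c2 / c1) *: ('X - b%:P) ^+ k.
  by rewrite mulrC -scalerA -ek scalerA mulVf // scale1r.
set c := c2 / c1 in ek; have c0 : c != 0 by rewrite mulf_neq0 ?invr_neq0.
case: k ek => [|[|k]] ek.
- by move: hw; rewrite ek expr0 hornerZ hornerC mulr1 => /eqP; rewrite (negPf c0).
- have e0 : h`_0 = - (c * b) by rewrite ek expr1 coefZ coefB coefX coefC /= sub0r mulrN.
  have e1 : h`_1 = c by rewrite ek expr1 coefZ coefB coefX coefC /= subr0 mulr1.
  have -> : b = - h`_0 / h`_1 by rewrite e0 e1 opprK [c * b]mulrC mulfK.
  have [h00 _] := hh 0%N; have [h01 _] := hh 1%N.
  by apply: subf_div => //; apply: subfN.
- move: hd; rewrite ek derivZ deriv_exp hornerZ hornerMn hornerM horner_exp.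
  by rewrite hornerXsubC subrr expr0n /= mulr0 mul0rn mulr0 eqxx.
Qed.

(** This expresses that [b] has degree [p] over [F]. If [q] vanishes at [b], so does its derivative,
    as otherwise [b] would be separable over [F] and lie in it. By induction the derivative is zero,
    and in degree below [p] this makes [q] constant. *)
Lemma poly_small_vanish F b (q : {poly K}) : subf F -> F (b ^+ p) -> ~ F b ->
  (forall i, F q`_i) -> (size q <= p)%N -> q.[b] = 0 -> q = 0.
Proof.
move=> hF hbp hb; have [n] := ubnP (size q); elim: n q => // n IH q qn hq sq q0.
have [//|qn0] := eqVneq q 0.
have sd : (size q^`() < size q)%N by apply: lt_size_deriv.
have qd0 : q^`().[b] = 0.
  apply: contrapT => /eqP qd; apply: hb; apply: sepalg_ppow => //.
  by exists q.
have qd : q^`() = 0.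
  apply: IH => //; first exact: leq_trans sd _.
    by move=> i; rewrite coef_deriv; apply: subfMn.
  by apply: leq_trans sq; apply: ltnW.
have sq1 : (size q <= 1)%N.
  apply/leq_sizeP => j; case: j => // j _.
  have [hj|hj] := leqP (size q) j.+1; first by rewrite nth_default.
  have : q^`()`_j = 0 by rewrite qd coef0.
  rewrite coef_deriv -mulr_natr => /eqP; rewrite mulf_eq0 -(dvdn_pcharf hp) => /orP [/eqP //|].
  by move=> /dvdn_leq => /(_ isT); rewrite leqNgt (leq_trans hj sq).
by move: q0; rewrite (size1_polyC sq1) hornerC => ->; rewrite polyC0.
Qed.

Definition powprod n (x : 'I_n -> K) (e : {ffun 'I_n -> 'I_p}) : K :=
  \prod_i x i ^+ e i.

(** Grouping a relation by powers of [b] gives a polynomial of degree below [p] over [pspan E]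
    vanishing at [b], hence zero; each coefficient is then a relation among the [kap]. *)
Lemma pindep_powprod1 E t (kap : 'I_t -> K) b : subf E -> (forall j, E (kap j)) ->
  pindep p (fun _ => True) kap -> ~ pspan E b ->
  pindep p (fun _ => True) (fun je : 'I_t * {ffun 'I_1 -> 'I_p} =>
     kap je.1 * powprod (fun _ : 'I_1 => b) je.2).
Proof.
move=> hE kE hk hb c _ c0.
pose ff (i : 'I_p) : {ffun 'I_1 -> 'I_p} := [ffun=> i].
have ffK (e : {ffun 'I_1 -> 'I_p}) : ff (e ord0) = e.
  by apply/ffunP => i; rewrite ffunE; congr (e _); apply: val_inj; case: i => -[].
pose cf (i : nat) := if insub i is Some i' then \sum_j c (j, ff i') ^+ p * kap j else 0.
have cfE (i : 'I_p) : cf i = \sum_j c (j, ff i) ^+ p * kap j by rewrite /cf valK.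
pose q := \poly_(i < p) cf i.
have q0 : q = 0.
  apply: (@poly_small_vanish (pspan E) b).
  - exact: pspan_subf.
  - exact: pspan_ppow.
  - by [].
  - move=> i; rewrite coef_poly; case: ifP => hi; last by apply: pspan_base; apply: subf0.
    by rewrite (cfE (Ordinal hi)); apply: pspan_finType.
  - exact: size_poly.
  rewrite horner_poly -[RHS]c0.
  under eq_bigr do rewrite cfE mulr_suml.
  rewrite exchange_big pair_bigA /=.
  rewrite (reindex (fun je : 'I_t * {ffun 'I_1 -> 'I_p} => (je.1, je.2 ord0))) /=.
    apply: eq_bigr => -[j e] _ /=; rewrite ffK -mulrA; congr (_ * (_ * _)).
    by rewrite /powprod big_ord1.
  exists (fun ji : 'I_t * 'I_p => (ji.1, ff ji.2)) => -[j e] _ /=; first by rewrite ffK.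
  by rewrite ffunE.
move=> [j e]; rewrite -(ffK e).
apply: (hk (fun j => c (j, ff (e ord0)))) => //.
by rewrite -cfE; have := coef_poly p cf (e ord0); rewrite -/q q0 coef0 ltn_ord.
Qed.

(** Outside [pspan E], which contains its p-th power, [b] is not separable algebraic over it. So
    some derivation kills [pspan E] and takes the value 1 at [b], and the differential criterion
    applies. *)
Lemma algindep_pspan E b : subf E -> good_over p E -> ~ pspan E b ->
  malgindep E (fun _ : 'I_1 => b).
Proof.
move=> hE good hb.
have nsep : ~ sepalg (pspan E) b.
  by move=> h; apply: hb; apply: sepalg_ppow h; [apply: pspan_subf|apply: pspan_ppow].
have [d [hd d0 d1]] := pder_ext_insep (pspan_subf hE) nsep.
apply: (algindep_of_derivations hp hE good (H := fadj (pspan E) (fun _ : unit => b))).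
- by move=> x hx; apply: fadj_base; apply: pspan_base.
- by move=> j; apply: (fadj_gen _ _ tt).
- move=> lam hlam j.
  have d0' x : E x -> d x = 0 by move=> hx; apply: d0; apply: pspan_base.
  by have := hlam d hd d0'; rewrite big_ord1 d1 mulr1 => <-; rewrite ord1.
Qed.

End PowerSpan.

(** * Separability over the domain and the image of a partial isomorphism *)

Section Good.
Variables (K N : fieldType) (p : nat).
Hypotheses (hpK : p \in [pchar K]) (hpN : p \in [pchar N]).
Implicit Types (R : K -> N -> Prop).

(* [K] and [N] are separable over the domain and the image of [R]. *)
Definition good2 R : Prop :=
  forall n (e : 'I_n -> K), (forall i, rdom R (e i)) ->
  exists s (kap : 'I_s -> K) (kap' : 'I_s -> N) (al : 'I_n -> 'I_s -> K),
  [/\ forall j, R (kap j) (kap' j), forall i j, rdom R (al i j),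
      pindep p (fun _ => True) kap, pindep p (fun _ => True) kap' &
      forall i, e i = \sum_j al i j ^+ p * kap j].

Lemma good2_over R : good2 R -> good_over p (rdom R).
Proof.
move=> h n e /h [s [kap [kap' [al [h1 h2 h3 h4 h5]]]]]; exists s, kap, al.
by split => // j; exists (kap' j).
Qed.

Lemma good2_finType R (I : finType) (e : I -> K) : good2 R ->
  (forall i, rdom R (e i)) ->
  exists s (kap : 'I_s -> K) (kap' : 'I_s -> N) (al : I -> 'I_s -> K),
  [/\ forall j, R (kap j) (kap' j), forall i j, rdom R (al i j),
      pindep p (fun _ => True) kap, pindep p (fun _ => True) kap' &
      forall i, e i = \sum_j al i j ^+ p * kap j].
Proof.
move=> good he.
have [|s [kap [kap' [al [h1 h2 h3 h4 h5]]]]] := good _ (fun i => e (@enum_val I xpredT i)).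
  by move=> i; apply: he.
exists s, kap, kap', (fun i j => al (enum_rank i) j); split => // i.
by rewrite -{1}(enum_rankK i) h5.
Qed.

Lemma mpoly_supersupp (n : nat) (f : {mpoly K[n]}) (S : seq 'X_{1..n}) :
  uniq S -> {subset msupp f <= S} ->
  f = \sum_(l < size S) f@_(nth 0%MM S l) *: 'X_[nth 0%MM S l].
Proof.
move=> uS fS; rewrite [LHS]mpolyE -(big_mkord xpredT (fun l => f@_(nth 0%MM S l) *: 'X_[nth 0%MM S l])).
rewrite -(big_nth 0%MM xpredT (fun m => f@_m *: 'X_[m])).
rewrite [RHS](bigID (fun m => m \in msupp f)) /= [X in _ = _ + X]big1 ?addr0.
  rewrite -[RHS]big_filter; apply: perm_big; apply: uniq_perm => //.
  - exact: filter_uniq.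
  - by move=> m; rewrite mem_filter; case: (boolP (m \in msupp f)) => //= /fS ->.
by move=> m /memN_msupp_eq0 ->; rewrite scale0r.
Qed.

(** The new family consists of the products of the [kap] with monomials of exponents below [p] in
    the generators. Each exponent is divided by [p] with remainder, and the quotient goes into the
    p-th power coefficient. *)
Lemma good2_adjoin R n (x : 'I_n -> K) (x' : 'I_n -> N) :
  phom R -> phom (adjoin R x x') -> good2 R ->
  (forall t (kap : 'I_t -> K) (kap' : 'I_t -> N), (forall j, R (kap j) (kap' j)) ->
     pindep p (fun _ => True) kap -> pindep p (fun _ => True) kap' ->
     pindep p (fun _ => True) (fun je : 'I_t * _ => kap je.1 * powprod (p := p) x je.2) /\
     pindep p (fun _ => True) (fun je : 'I_t * _ => kap' je.1 * powprod (p := p) x' je.2)) ->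
  good2 (adjoin R x x').
Proof.
move=> hR hA good H m e he.
have p_gt0 := prime_gt0 (pcharf_prime hpK).
have hE : subf (rdom R) := rdom_subf hR.
have he' i : fadj (rdom R) x (e i) by apply/(rdom_adjoin _ hA).
have /choice [a ha] : forall i, exists ab : {mpoly K[n]} * {mpoly K[n]},
   [/\ coefin (rdom R) ab.1, coefin (rdom R) ab.2, ab.2.@[x] != 0 & e i = ab.1.@[x] / ab.2.@[x]].
  by move=> i; have [a [b h]] := fadj_frac hE (he' i); exists (a, b).
(* Writing [a / b] as [a b^(p-1) / b^p] turns the denominators into p-th powers. *)
pose f i := (a i).1 * (a i).2 ^+ p.-1.
have fR i : coefin (rdom R) (f i).
  by have [h1 h2 _ _] := ha i; apply: coefinM => //; apply: coefin_exp.
have ef i : e i = (f i).@[x] / (a i).2.@[x] ^+ p.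
  have [_ _ h3 ->] := ha i; rewrite mevalM rmorphXn /= -{2}(prednK p_gt0) exprSr invfM.
  by rewrite mulrA mulfK // expf_neq0.
pose S := undup (flatten [seq msupp (f i) | i <- enum 'I_m]).
have fS i : f i = \sum_(l < size S) (f i)@_(nth 0%MM S l) *: 'X_[nth 0%MM S l].
  apply: mpoly_supersupp; first exact: undup_uniq.
  move=> mm hm; rewrite mem_undup; apply/flatten_mapP; exists i => //.
  exact: mem_enum.
have [|s [kap [kap' [al [h1 h2 h3 h4 h5]]]]] :=
   @good2_finType R _ (fun il : 'I_m * 'I_(size S) => (f il.1)@_(nth 0%MM S il.2)) good.
  by move=> il; apply: fR.
have [hk hk'] := H _ _ _ h1 h3 h4.
pose J : finType := ('I_s * {ffun 'I_n -> 'I_p})%type.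
pose ev (k : 'I_#|J|) : J := enum_val k.
pose eps (mm : 'X_{1..n}) : {ffun 'I_n -> 'I_p} := [ffun k => Ordinal (ltn_pmod (mm k) p_gt0)].
pose quo (l : 'I_(size S)) : K := \prod_k x k ^+ ((nth 0%MM S l) k %/ p).
have monE (l : 'I_(size S)) : 'X_[K, nth 0%MM S l].@[x] =
    quo l ^+ p * powprod (p := p) x (eps (nth 0%MM S l)).
  rewrite mevalX /quo /powprod -prodrXl -big_split; apply: eq_bigr => k _ /=.
  by rewrite ffunE /= -exprM -exprD -divn_eq.
pose be i (je : J) : K :=
  (\sum_(l : 'I_(size S) | eps (nth 0%MM S l) == je.2) al (i, l) je.1 * quo l) / (a i).2.@[x].
have hAf := fadj_subf x hE.
exists #|J|, (fun k => kap (ev k).1 * powprod (p := p) x (ev k).2),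
  (fun k => kap' (ev k).1 * powprod (p := p) x' (ev k).2), (fun i k => be i (ev k)); split.
- move=> k; have rA := phom_rrel hA; apply: (rrelM rA); first exact: adj_base.
  by apply: (rrel_prod rA) => i _; apply: (rrelX rA); apply: adj_gen.
- move=> i k; apply/(rdom_adjoin _ hA); apply: subf_div => //.
    apply: subf_sum => // l _; apply: subfM => //; first by apply: fadj_base.
    by apply: subf_prod => // k' _; apply: subfX => //; apply: fadj_gen.
  apply: subf_meval => // [mm|k']; last exact: fadj_gen.
  by apply: fadj_base; have [] := ha i.
- exact: (pindep_reindex (enum_val_bij J) hk).
- exact: (pindep_reindex (enum_val_bij J) hk').
move=> i; rewrite /ev -(big_enum_val (A := {: J}) (fun je => be i je ^+ p * (kap je.1 * powprod (p := p) x je.2))) /=.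
rewrite ef fS raddf_sum /= mulr_suml.
transitivity (\sum_j \sum_e (be i (j, e) ^+ p * (kap j * powprod (p := p) x e))); last first.
  by rewrite pair_bigA; apply: eq_big => [je|[j e'] _].
transitivity (\sum_(l < size S) \sum_j (al (i, l) j * quo l / (a i).2.@[x]) ^+ p *
    (kap j * powprod (p := p) x (eps (nth 0%MM S l)))).
  apply: eq_bigr => l _; rewrite mevalZ monE (h5 (i, l)) !mulr_suml; apply: eq_bigr => j _.
  by rewrite !exprMn exprVn; ring.
rewrite exchange_big; apply: eq_bigr => j _.
rewrite (partition_big (fun l : 'I_(size S) => eps (nth 0%MM S l)) xpredT) //=.
apply: eq_bigr => e' _; rewrite /be mulr_suml (expp_sum hpK) mulr_suml.
by apply: eq_bigr => l /eqP ->.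
Qed.

End Good.

(** * Rational function fields *)

Lemma frac_rep (R : idomainType) (x : {fraction R}) :
  exists a b : R, b != 0 /\ x = FracField.tofrac a / FracField.tofrac b.
Proof.
elim/quotW: x => r; exists (\n_r), (\d_r); split; first exact: denom_ratioP.
apply/(canRL (mulfK _)); first by rewrite tofrac_eq0 denom_ratioP.
unlock FracField.tofrac; rewrite -[LHS]FracField.pi_mul; apply/eqmodP.
rewrite /= FracField.equivfE /FracField.mulf /= !numden_Ratio ?mulf_neq0 ?oner_eq0 ?denom_ratioP //.
by rewrite !mulr1 mulrC.
Qed.

Lemma frac_common (R : idomainType) (I : finType) (c : I -> {fraction R}) :
  exists (d : R) (f : I -> R), d != 0 /\
    forall i, c i = FracField.tofrac (f i) / FracField.tofrac d.
Proof.
have /choice [ab hab] : forall i, exists ab : R * R, ab.2 != 0 /\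
    c i = FracField.tofrac ab.1 / FracField.tofrac ab.2.
  by move=> i; have [a [b h]] := frac_rep (c i); exists (a, b).
exists (\prod_i (ab i).2), (fun i => (ab i).1 * \prod_(j | j != i) (ab j).2); split.
  by apply/prodf_neq0 => i _; have [] := hab i.
move=> i; have [h ->] := hab i.
have h2 : \prod_(j | j != i) (ab j).2 != 0 by apply/prodf_neq0 => j _; have [] := hab j.
have -> : \prod_j (ab j).2 = (ab i).2 * \prod_(j | j != i) (ab j).2 by rewrite (bigD1 i).
by rewrite !tofracM -mulf_div divff ?mulr1 // tofrac_eq0.
Qed.

Section FunctionField.
Variables (M : fieldType) (p r : nat).
Hypothesis hp : p \in [pchar M].

Definition ffield : fieldType := {fraction {mpoly M[r]}}.
Definition ffc : {rmorphism M -> ffield} :=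
  (@FracField.tofrac {mpoly M[r]} \o @mpolyC r M)%FUN.
Definition ffx (i : 'I_r) : ffield := FracField.tofrac 'X_i.

Let p_gt0 : (0 < p)%N := prime_gt0 (pcharf_prime hp).

Lemma ff_pchar : p \in [pchar ffield].
Proof. by rewrite (fmorph_pchar ffc). Qed.

Lemma ff_meval (f : {mpoly M[r]}) : (map_mpoly ffc f).@[ffx] = FracField.tofrac f.
Proof.
have : forall m, (fun _ : M => True) f@_m by [].
move: f; apply: (mpoly_coef_ind (F := fun _ => True)).
- by move=> c _; rewrite map_mpolyC mevalC.
- by rewrite raddf0 meval0 raddf0.
- by rewrite rmorph1 meval1 rmorph1.
- by move=> i; rewrite map_mpolyX mevalXU.
- move=> f g ef eg; rewrite (rmorphD (map_mpoly ffc)) mevalD.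
  exact: (etrans (congr2 +%R ef eg) (esym (rmorphD (@FracField.tofrac _) f g))).
- move=> f g ef eg; rewrite (rmorphM (map_mpoly ffc)) mevalM.
  exact: (etrans (congr2 *%R ef eg) (esym (rmorphM (@FracField.tofrac _) f g))).
Qed.

Lemma ff_algindep : malgindep (fun y => exists x, y = ffc x) ffx.
Proof.
move=> f hf f0; pose R (y : ffield) (x : M) := y = ffc x.
have hR : rrel R.
  split; first by rewrite /R rmorph1.
  - by move=> x y q s -> ->; rewrite /R rmorphB.
  - by move=> x y q s -> ->; rewrite /R rmorphM.
have [g hg] := mrel_ex hR hf.
have eg : f = map_mpoly ffc g by apply/mpolyP => m; rewrite mcoeff_map_mpoly; apply: hg.
move/eqP: f0; rewrite eg ff_meval tofrac_eq0 => /eqP ->.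
by rewrite raddf0.
Qed.

Lemma mpoly_expp (f : {mpoly M[r]}) :
  f ^+ p = \sum_(m <- msupp f) f@_m ^+ p *: 'X_[m *+ p].
Proof.
have hpP : p \in [pchar {mpoly M[r]}] by apply: (rmorph_pchar (@mpolyC r M)).
rewrite {1}[f]mpolyE.
have -> : (\sum_(m <- msupp f) f@_m *: 'X_[m]) ^+ p =
   \sum_(m <- msupp f) (f@_m *: 'X_[m]) ^+ p.
  exact: (rmorph_sum (pFrobenius_aut hpP)).
by apply: eq_bigr => m _; rewrite exprZn mpolyXn.
Qed.

(** After clearing denominators, compare coefficients: division by [p] with remainder shows that an
    exponent vector is [p m + e] for exactly one [m] and one reduced [e], so every coefficient
    equation is a relation among the [kap]. *)
Lemma ff_pindep t (kap : 'I_t -> M) : pindep p (fun _ => True) kap ->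
  pindep p (fun _ => True) (fun je : 'I_t * _ => ffc (kap je.1) * powprod (p := p) ffx je.2).
Proof.
move=> hk c _ c0; have [d [f [d0 ef]]] := frac_common c.
pose mon (e : {ffun 'I_r -> 'I_p}) : 'X_{1..r} := [multinom (e i : nat) | i < r].
have monE e : powprod (p := p) ffx e = FracField.tofrac 'X_[mon e].
  rewrite /powprod mpolyXE_id rmorph_prod; apply: eq_bigr => i _ /=.
  by rewrite mnmE rmorphXn.
have s0 : \sum_je f je ^+ p * (kap je.1 *: 'X_[mon je.2]) = 0.
  apply/eqP; rewrite -tofrac_eq0; apply/eqP.
  have dd : FracField.tofrac d ^+ p != 0 by rewrite expf_neq0 // tofrac_eq0.
  apply: (mulIf (invr_neq0 dd)); rewrite mul0r -[RHS]c0 raddf_sum mulr_suml.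
  apply: eq_bigr => je _; rewrite ef exprMn exprVn -mul_mpolyC monE.
  by rewrite /= !tofracM tofracXn; ring.
have f0 je : f je = 0.
  case: je => j e; apply/mpolyP => m; rewrite mcoeff0.
  apply: (hk (fun j => (f (j, e))@_m)) => //.
  have := congr1 (fun g => g@_(m *+ p + mon e)) s0; rewrite mcoeff0 raddf_sum /= => es; rewrite -[RHS]es.
  transitivity (\sum_j' \sum_e' (f (j', e') ^+ p * (kap j' *: 'X_[mon e']))@_(m *+ p + mon e)); last first.
    by rewrite pair_bigA; apply: eq_bigr => -[].
  apply: eq_bigr => j' _.
  have key e' : (f (j', e') ^+ p * (kap j' *: 'X_[mon e']))@_(m *+ p + mon e) =
      if e' == e then (f (j', e'))@_m ^+ p * kap j' else 0.
    rewrite -scalerAr mcoeffZ mpoly_expp mulr_suml raddf_sum /=.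
    have dec m1 : ((m1 *+ p + mon e')%MM == (m *+ p + mon e)%MM) = (m1 == m) && (e' == e).
      apply/eqP/andP => [h|[/eqP -> /eqP -> //]].
      have hi i : (m1 i * p + e' i = m i * p + e i)%N.
        by move/mnmP: h => /(_ i); rewrite !mnmDE !mulmnE !mnmE.
      split; apply/eqP; [apply/mnmP => i|apply/ffunP => i; apply: val_inj].
        have := congr1 (fun k => k %/ p)%N (hi i).
        by rewrite !divnMDl // !divn_small // !addn0.
      have := congr1 (fun k => k %% p)%N (hi i).
      by rewrite /= !modnMDl !modn_small.
    under eq_bigr => m1 _ do rewrite -scalerAl mcoeffZ -mpolyXD mcoeffX dec.
    case: (e' == e); last by rewrite big1 ?mulr0 // => m1 _; rewrite andbF mulr0.
    have [hm|hm] := boolP (m \in msupp (f (j', e'))).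
      rewrite (bigD1_seq m) ?msupp_uniq //= eqxx mulr1 big1 ?addr0 1?mulrC //.
      by move=> m1 /negPf ->; rewrite mulr0.
    rewrite big_seq big1 ?mulr0.
      by rewrite memN_msupp_eq0 // expr0n (gtn_eqF p_gt0) mul0r.
    move=> m1 hm1; case: eqP => [e1|_]; last by rewrite mulr0.
    by rewrite -e1 hm1 in hm.
  rewrite (bigD1 e) //= key eqxx big1 ?addr0 // => e' /negPf he.
  by rewrite key he.
by move=> je; rewrite ef f0 tofrac0 mul0r.
Qed.

Lemma pindep_rmorph (K : fieldType) (j : {rmorphism M -> K}) (I : finType) (u : I -> M) :
  pindep p (fun _ => True) (fun i => j (u i)) -> pindep p (fun _ => True) u.
Proof.
move=> h c _ c0 i; apply: (fmorph_inj j); rewrite rmorph0.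
apply: (h (fun i => j (c i))) => //.
rewrite -[RHS](rmorph0 j) -[X in _ = j X]c0 rmorph_sum; apply: eq_bigr => k _ /=.
by rewrite rmorphM rmorphXn.
Qed.

Lemma ff_pindep0 t (kap : 'I_t -> M) : pindep p (fun _ => True) kap ->
  pindep p (fun _ => True) (fun j => ffc (kap j)).
Proof.
move=> /ff_pindep hk c _ c0 j.
pose z : {ffun 'I_r -> 'I_p} := [ffun=> Ordinal p_gt0].
have := hk (fun je => if je.2 == z then c je.1 else 0) (fun=> I) _ (j, z).
rewrite /= eqxx; apply.
rewrite -(pair_bigA _ (fun j e => (if e == z then c j else 0) ^+ p * (ffc (kap j) * powprod (p := p) ffx e))) /=.
rewrite -[RHS]c0; apply: eq_bigr => j' _; rewrite (bigD1 z) //= eqxx big1 ?addr0.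
  rewrite {1}/powprod big1 ?mulr1 // => i _.
  by rewrite ffunE expr0.
by move=> e /negPf ->; rewrite expr0n (gtn_eqF p_gt0) mul0r.
Qed.

Lemma ff_good E : subf E -> good_over p E ->
  good_over p (fadj (fun y => exists2 x, E x & y = ffc x) ffx).
Proof.
move=> hE good; set E' := fun y => _.
have hE' : subf E'.
  split.
  - by exists 1; [apply: subf1|rewrite rmorph1].
  - by move=> _ _ [x hx ->] [y hy ->]; exists (x - y); [apply: subfB|rewrite rmorphB].
  - by move=> _ _ [x hx ->] [y hy ->]; exists (x * y); [apply: subfM|rewrite rmorphM].
  - by move=> _ [x hx ->]; exists x^-1; [apply: subfV|rewrite fmorphV].
have hR := idrel_phom hE'.
have dR x : rdom (idrel E') x <-> E' x by split=> [[y []]|h] //; exists x.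
have [||hA _] := @adjoin_mpoly _ _ (idrel E') r ffx ffx hR.
- by move=> f g /mrel_idrel [<-].
- by move=> f g /mrel_idrel [<- _] f0; exists (f.@[ffx])^-1; rewrite mulfV.
have g2 : good2 p (idrel E').
  move=> n e he; have /choice [e0 he0] : forall i, exists x, E x /\ e i = ffc x.
    by move=> i; have /dR [x hx ->] := he i; exists x.
  have [|s [kap [al [h1 h2 h3 h4]]]] := good n e0; first by move=> i; have [] := he0 i.
  exists s, (fun j => ffc (kap j)), (fun j => ffc (kap j)), (fun i j => ffc (al i j)); split.
  - by move=> j; split => //; exists (kap j); rewrite // ; exact: h1.
  - by move=> i j; apply/dR; exists (al i j); rewrite //; exact: h2.
  - exact: ff_pindep0.
  - exact: ff_pindep0.
  - move=> i; have [_ ->] := he0 i; rewrite h4 rmorph_sum; apply: eq_bigr => j _ /=.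
    exact: (etrans (rmorphM ffc _ _) (congr2 *%R (rmorphXn ffc _ _) erefl)).
have := good2_over (good2_adjoin ff_pchar hR hA g2 _).
have -> : rdom (adjoin (idrel E') ffx ffx) = fadj E' ffx.
  apply/funext => x; apply/propext; rewrite (rdom_adjoin x hA).
  have -> // : rdom (idrel E') = E' by apply/funext => y; apply/propext.
apply => t kap kap' hkap hk _.
have /choice [k0 hk0] : forall j, exists x, kap j = ffc x.
  by move=> j; have [[x _ ->] _] := hkap j; exists x.
have ek : kap = fun j => ffc (k0 j) by apply/funext.
have ek' : kap' = fun j => ffc (k0 j).
  by apply/funext => j; have [_ <-] := hkap j.
rewrite ek ek'; rewrite ek in hk.
by split; apply: ff_pindep; apply: pindep_rmorph hk.
Qed.

End FunctionField.

(** * Filtered products of fields *)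

Definition pfilter (I : Type) (U : (I -> Prop) -> Prop) : Prop :=
  [/\ U (fun _ => True), forall P Q, (forall i, P i -> Q i) -> U P -> U Q,
      forall P Q, U P -> U Q -> U (fun i => P i /\ Q i) & ~ U (fun _ => False)].

Definition ultra (I : Type) (U : (I -> Prop) -> Prop) : Prop :=
  pfilter U /\ forall P, U P \/ U (fun i => ~ P i).

(** * Ultrafilters on finite lists *)

Section Ultrafilters.
Import classical_sets filter.

(** The source of every compactness argument below: with finite lists of requirements as indices,
    each single requirement is met almost everywhere. *)
Lemma ultra_list (X : Type) : exists U : (list X -> Prop) -> Prop,
  ultra U /\ forall x, U (fun l => List.In x l).
Proof.
pose F : set_system (list X) := fun P => exists l0, forall l, List.incl l0 l -> P l.
have FP : ProperFilter F.
  split; first by move=> [l0 h]; apply: (h l0); apply: List.incl_refl.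
  split.
  - by exists nil.
  - move=> P Q [l hl] [l' hl']; exists (app l l') => l'' h; split.
      by apply: hl => x hx; apply: h; apply: List.in_or_app; left.
    by apply: hl' => x hx; apply: h; apply: List.in_or_app; right.
  - by move=> P Q PQ [l hl]; exists l => l' /hl /PQ.
have [G [GU FG]] := ultraFilterLemma FP.
have [[Gn0 GF] _] := GU.
exists G; split; last first.
  by move=> x; apply: FG; exists (cons x nil) => l; apply; left.
split; first split.
- exact: filterT.
- by move=> P Q PQ; apply: filterS.
- by move=> P Q GP GQ; apply: filterI.
- exact: Gn0.
- by move=> P; apply: in_ultra_setVsetC.
Qed.

End Ultrafilters.

Section Quotient.
Variables (T : Type) (e : T -> T -> Prop).
Hypotheses (e_refl : forall s, e s s) (e_sym : forall s t, e s t -> e t s)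
  (e_trans : forall s t u, e s t -> e t u -> e s u).

Definition quot : Type := {P : T -> Prop | exists s, P = e s}.
Definition qcls (s : T) : quot := exist _ (e s) (ex_intro _ s erefl).

Lemma qcls_eq s t : qcls s = qcls t <-> e s t.
Proof.
split=> [[h]|h].
  by have : e s t by rewrite h.
apply: eq_exist => /=; apply/funext => u; apply/propext; split=> h'.
  exact: e_trans (e_sym h) h'.
exact: e_trans h h'.
Qed.

Lemma qcls_surj (x : quot) : exists s, x = qcls s.
Proof. by case: x => P [s eP]; exists s; apply: eq_exist. Qed.

Definition qrepr (x : quot) : T := sval (cid (qcls_surj x)).
Lemma qreprK x : qcls (qrepr x) = x.
Proof. by rewrite /qrepr; case: cid. Qed.
Lemma qcls_repr s : e (qrepr (qcls s)) s.
Proof. by apply/qcls_eq; rewrite qreprK. Qed.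

End Quotient.

(** * Coherent families modulo a filter *)

Section FilteredProduct.
Variables (I : Type) (U : (I -> Prop) -> Prop) (K : I -> fieldType)
  (coh : (forall i, K i) -> Prop).

(** One construction covers ultraproducts, where all families are coherent, and direct limits, where
    the filter is that of cofinite sets. The dichotomy [fp_dich] makes the quotient a field. *)
Record fp_spec : Prop := FPSpec {
  fp_filter : pfilter U;
  fp1 : coh (fun _ => 1);
  fpB : forall s t, coh s -> coh t -> coh (fun i => s i - t i);
  fpM : forall s t, coh s -> coh t -> coh (fun i => s i * t i);
  fpV : forall s, coh s -> coh (fun i => (s i)^-1);
  fp_dich : forall s, coh s -> U (fun i => s i = 0) \/ U (fun i => s i != 0) }.

Hypothesis hfp : fp_spec.

Lemma UT : U (fun _ => True). Proof. by case: (fp_filter hfp). Qed.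
Lemma US P Q : (forall i, P i -> Q i) -> U P -> U Q.
Proof. by case: (fp_filter hfp) => _ h _ _; apply: h. Qed.
Lemma UI P Q : U P -> U Q -> U (fun i => P i /\ Q i).
Proof. by case: (fp_filter hfp) => _ _ h _; apply: h. Qed.
Lemma UN : ~ U (fun _ => False). Proof. by case: (fp_filter hfp). Qed.
Lemma Uall P : (forall i, P i) -> U P.
Proof. by move=> h; apply: US UT => i _. Qed.
Lemma US2 P Q R : (forall i, P i -> Q i -> R i) -> U P -> U Q -> U R.
Proof. by move=> h hP hQ; apply: US (UI hP hQ) => i []; apply: h. Qed.

Definition fpT : Type := {s : forall i, K i | coh s}.
Definition fpe (s t : fpT) : Prop := U (fun i => sval s i = sval t i).

Lemma fpe_refl s : fpe s s. Proof. exact: Uall. Qed.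
Lemma fpe_sym s t : fpe s t -> fpe t s. Proof. by apply: US => i ->. Qed.
Lemma fpe_trans s t u : fpe s t -> fpe t u -> fpe s u.
Proof. by apply: US2 => i -> ->. Qed.

Definition fp_one : fpT := exist _ _ (fp1 hfp).
Definition fp_sub (s t : fpT) : fpT := exist _ _ (fpB hfp (svalP s) (svalP t)).
Definition fp_mul (s t : fpT) : fpT := exist _ _ (fpM hfp (svalP s) (svalP t)).
Definition fp_inv (s : fpT) : fpT := exist _ _ (fpV hfp (svalP s)).
Definition fp_zero : fpT := fp_sub fp_one fp_one.
Definition fp_opp s := fp_sub fp_zero s.
Definition fp_add s t := fp_sub s (fp_opp t).

Definition fpq : Type := quot fpe.
Notation cls := (@qcls fpT fpe).
Notation rep := (@qrepr fpT fpe).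

Lemma fcls_eq s t : cls s = cls t <-> fpe s t.
Proof. exact: (qcls_eq fpe_refl fpe_sym fpe_trans). Qed.
Lemma frepK s : fpe (rep (cls s)) s.
Proof. exact: (qcls_repr fpe_refl fpe_sym fpe_trans). Qed.

Definition q_add (x y : fpq) : fpq := cls (fp_add (rep x) (rep y)).
Definition q_mul (x y : fpq) : fpq := cls (fp_mul (rep x) (rep y)).
Definition q_opp (x : fpq) : fpq := cls (fp_opp (rep x)).
Definition q_inv (x : fpq) : fpq := cls (fp_inv (rep x)).

Lemma q_addE s t : q_add (cls s) (cls t) = cls (fp_add s t).
Proof.
by apply/fcls_eq; apply: US2 (frepK s) (frepK t) => i /= -> ->.
Qed.
Lemma q_mulE s t : q_mul (cls s) (cls t) = cls (fp_mul s t).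
Proof.
by apply/fcls_eq; apply: US2 (frepK s) (frepK t) => i /= -> ->.
Qed.
Lemma q_oppE s : q_opp (cls s) = cls (fp_opp s).
Proof. by apply/fcls_eq; apply: US (frepK s) => i /= ->. Qed.
Lemma q_invE s : q_inv (cls s) = cls (fp_inv s).
Proof. by apply/fcls_eq; apply: US (frepK s) => i /= ->. Qed.

HB.instance Definition _ := gen_eqMixin fpq.
HB.instance Definition _ := gen_choiceMixin fpq.

Lemma q_addA : associative q_add.
Proof.
move=> x y z; have [s ->] := qcls_surj x; have [t ->] := qcls_surj y.
have [u ->] := qcls_surj z; rewrite !q_addE; apply/fcls_eq; apply: Uall => i /=.
by ring.
Qed.
Lemma q_addC : commutative q_add.
Proof.
move=> x y; have [s ->] := qcls_surj x; have [t ->] := qcls_surj y.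
by rewrite !q_addE; apply/fcls_eq; apply: Uall => i /=; ring.
Qed.
Lemma q_add0 : left_id (cls fp_zero) q_add.
Proof.
move=> x; have [s ->] := qcls_surj x.
by rewrite !q_addE; apply/fcls_eq; apply: Uall => i /=; ring.
Qed.
Lemma q_addN : left_inverse (cls fp_zero) q_opp q_add.
Proof.
move=> x; have [s ->] := qcls_surj x.
by rewrite q_oppE !q_addE; apply/fcls_eq; apply: Uall => i /=; ring.
Qed.

HB.instance Definition _ := GRing.isZmodule.Build fpq q_addA q_addC q_add0 q_addN.

Lemma q_mulA : associative q_mul.
Proof.
move=> x y z; have [s ->] := qcls_surj x; have [t ->] := qcls_surj y.
have [u ->] := qcls_surj z; rewrite !q_mulE; apply/fcls_eq; apply: Uall => i /=.
by ring.
Qed.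
Lemma q_mulC : commutative q_mul.
Proof.
move=> x y; have [s ->] := qcls_surj x; have [t ->] := qcls_surj y.
by rewrite !q_mulE; apply/fcls_eq; apply: Uall => i /=; ring.
Qed.
Lemma q_mul1 : left_id (cls fp_one) q_mul.
Proof.
move=> x; have [s ->] := qcls_surj x.
by rewrite !q_mulE; apply/fcls_eq; apply: Uall => i /=; ring.
Qed.
Lemma q_mulD : left_distributive q_mul q_add.
Proof.
move=> x y z; have [s ->] := qcls_surj x; have [t ->] := qcls_surj y.
have [u ->] := qcls_surj z; rewrite !(q_addE, q_mulE); apply/fcls_eq; apply: Uall => i /=.
by ring.
Qed.
Lemma q_one_neq0 : (cls fp_one : fpq) != cls fp_zero.
Proof.
apply/eqP => /fcls_eq h; apply: UN; apply: US h => i /= /eqP.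
by rewrite subrr oner_eq0.
Qed.

HB.instance Definition _ := GRing.Zmodule_isComNzRing.Build fpq
  q_mulA q_mulC q_mul1 q_mulD q_one_neq0.

Lemma q_mulV (x : fpq) : x != 0 -> q_mul (q_inv x) x = 1.
Proof.
have [s ->] := qcls_surj x => h; rewrite q_invE q_mulE; apply/fcls_eq.
have [h0|] := fp_dich hfp (svalP s).
  case/eqP: h; apply/fcls_eq; apply: US h0 => i /= ->.
  by rewrite subrr.
by apply: US => i hi /=; rewrite mulVf.
Qed.
Lemma q_inv0 : q_inv 0 = 0.
Proof.
rewrite q_invE; apply/fcls_eq; apply: Uall => i /=.
by rewrite subrr invr0.
Qed.

HB.instance Definition _ := GRing.ComNzRing_isField.Build fpq q_mulV q_inv0.

Definition fpfield : fieldType := fpq.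

(** A relation and not a function, so that proofs of coherence need not be carried along. *)
Definition frep (x : fpfield) (s : forall i, K i) : Prop :=
  exists hs : coh s, x = cls (exist _ s hs).

Lemma frep_surj (x : fpfield) : exists s, frep x s.
Proof. by have [[s hs] ->] := qcls_surj x; exists s, hs. Qed.
Lemma frep_coh x s : frep x s -> coh s. Proof. by case. Qed.
Lemma frep_ex s : coh s -> exists x, frep x s.
Proof. by move=> hs; exists (cls (exist _ s hs)); exists hs. Qed.
Lemma frep_eq x y s t : frep x s -> frep y t -> x = y <-> U (fun i => s i = t i).
Proof. by move=> [hs ->] [ht ->]; exact: fcls_eq. Qed.
Lemma frep1 : frep 1 (fun _ => 1).
Proof. by exists (fp1 hfp). Qed.
Lemma frepB x y s t : frep x s -> frep y t -> frep (x - y) (fun i => s i - t i).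
Proof.
move=> [hs ->] [ht ->]; exists (fpB hfp hs ht).
have -> : forall a b : fpfield, a - b = q_add a (q_opp b) by [].
rewrite q_oppE q_addE; apply/fcls_eq; apply: Uall => i /=.
by ring.
Qed.
Lemma frepM x y s t : frep x s -> frep y t -> frep (x * y) (fun i => s i * t i).
Proof.
move=> [hs ->] [ht ->]; exists (fpM hfp hs ht).
have -> : forall a b : fpfield, a * b = q_mul a b by [].
by rewrite q_mulE; apply/fcls_eq; apply: Uall.
Qed.
Lemma frepV x s : frep x s -> frep x^-1 (fun i => (s i)^-1).
Proof.
move=> [hs ->]; exists (fpV hfp hs).
have -> : forall a : fpfield, a^-1 = q_inv a by [].
by rewrite q_invE; apply/fcls_eq; apply: Uall.
Qed.
Lemma frep_ext x s t : frep x s -> (forall i, s i = t i) -> frep x t.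
Proof. by move=> h e; have -> : t = s by apply: functional_extensionality_dep. Qed.
Lemma frep0 : frep 0 (fun _ => 0).
Proof. by rewrite -(subrr 1); apply: frep_ext (frepB frep1 frep1) _ => i; rewrite subrr. Qed.
Lemma frepN x s : frep x s -> frep (- x) (fun i => - s i).
Proof.
by move=> h; rewrite -sub0r; apply: frep_ext (frepB frep0 h) _ => i; rewrite sub0r.
Qed.
Lemma frepD x y s t : frep x s -> frep y t -> frep (x + y) (fun i => s i + t i).
Proof.
move=> h h'; rewrite -[y]opprK; apply: frep_ext (frepB h (frepN h')) _ => i.
by rewrite opprK.
Qed.
Lemma frepX x s n : frep x s -> frep (x ^+ n) (fun i => s i ^+ n).
Proof.
move=> h; elim: n => [|n IH]; first exact: frep1.
by rewrite exprS; apply: frep_ext (frepM h IH) _ => i; rewrite exprS.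
Qed.
Lemma frepMn x s n : frep x s -> frep (x *+ n) (fun i => s i *+ n).
Proof.
move=> h; elim: n => [|n IH]; first exact: frep0.
by rewrite mulrS; apply: frep_ext (frepD h IH) _ => i; rewrite mulrS.
Qed.
Lemma frep_sum (J : Type) (r : seq J) (P : pred J) (x : J -> fpfield)
    (s : J -> forall i, K i) : (forall j, frep (x j) (s j)) ->
  frep (\sum_(j <- r | P j) x j) (fun i => \sum_(j <- r | P j) s j i).
Proof.
move=> h; elim: r => [|j r IH].
  by rewrite big_nil; apply: frep_ext frep0 _ => i; rewrite big_nil.
rewrite big_cons; case: ifP => Pj.
  by apply: frep_ext (frepD (h j) IH) _ => i; rewrite big_cons Pj.
by apply: frep_ext IH _ => i; rewrite big_cons Pj.
Qed.
Lemma frep_prod (J : Type) (r : seq J) (P : pred J) (x : J -> fpfield)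
    (s : J -> forall i, K i) : (forall j, frep (x j) (s j)) ->
  frep (\prod_(j <- r | P j) x j) (fun i => \prod_(j <- r | P j) s j i).
Proof.
move=> h; elim: r => [|j r IH].
  by rewrite big_nil; apply: frep_ext frep1 _ => i; rewrite big_nil.
rewrite big_cons; case: ifP => Pj.
  by apply: frep_ext (frepM (h j) IH) _ => i; rewrite big_cons Pj.
by apply: frep_ext IH _ => i; rewrite big_cons Pj.
Qed.
Lemma frep_eq0 x s : frep x s -> x = 0 <-> U (fun i => s i = 0).
Proof. by move=> h; apply: (frep_eq h frep0). Qed.

Lemma fp_pchar p : (forall i, p \in [pchar K i]) -> (exists i : I, True) ->
  p \in [pchar fpfield].
Proof.
move=> hp [i0 _]; rewrite inE; apply/andP; split.
  by case/andP: (hp i0).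
apply/eqP/(frep_eq0 (frepMn p frep1)); apply: Uall => i.
by apply/eqP; case/andP: (hp i).
Qed.

(** The supports of all representatives lie in that of [f], so evaluation is one finite sum of the
    same shape at every index. *)
Lemma fp_lift n (f : {mpoly fpfield[n]}) : exists F : forall i, {mpoly (K i)[n]},
  (forall m, frep f@_m (fun i => (F i)@_m)) /\
  (forall i m, m \notin msupp f -> (F i)@_m = 0).
Proof.
have /choice [c hc] : forall m, exists s, frep f@_m s by move=> m; apply: frep_surj.
exists (fun i => \sum_(m <- msupp f) c m i *: 'X_[m]).
have coefE i m : (\sum_(m <- msupp f) c m i *: 'X_[m])@_m =
    if m \in msupp f then c m i else 0.
  rewrite raddf_sum /=; case: ifP => hm.
    rewrite (bigD1_seq m) ?msupp_uniq //= mcoeffZ mcoeffX eqxx mulr1 big1 ?addr0 //.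
    by move=> m' /negPf hm'; rewrite mcoeffZ mcoeffX hm' mulr0.
  rewrite big_seq big1 // => m' hm'; rewrite mcoeffZ mcoeffX; case: eqP => [e|].
    by rewrite -e hm' in hm.
  by rewrite mulr0.
split=> [m|i m /negPf hm]; last by rewrite coefE hm.
case: (boolP (m \in msupp f)) => hm.
  by apply: frep_ext (hc m) _ => i; rewrite coefE hm.
rewrite memN_msupp_eq0 //; apply: frep_ext frep0 _ => i.
by rewrite coefE (negPf hm).
Qed.

Lemma fp_meval n (f : {mpoly fpfield[n]}) (F : forall i, {mpoly (K i)[n]})
    (x : 'I_n -> fpfield) (s : 'I_n -> forall i, K i) :
  (forall m, frep f@_m (fun i => (F i)@_m)) ->
  (forall i m, m \notin msupp f -> (F i)@_m = 0) ->
  (forall l, frep (x l) (s l)) ->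
  frep f.@[x] (fun i => (F i).@[fun l => s l i]).
Proof.
move=> hF hF0 hx; rewrite mevalE.
have FE i : (F i).@[fun l => s l i] =
    \sum_(m <- msupp f) (F i)@_m * \prod_l s l i ^+ m l.
  rewrite {1}(mpoly_supersupp (msupp_uniq f) (f := F i)).
    rewrite raddf_sum /= (big_nth 0%MM) big_mkord; apply: eq_bigr => m _.
    by rewrite mevalZ mevalX.
  by move=> m; apply: contraLR => /(hF0 i); rewrite mcoeff_msupp negbK => ->.
apply: frep_ext (_ : frep _ (fun i => \sum_(m <- msupp f) (F i)@_m * \prod_l s l i ^+ m l)) _.
  apply: frep_sum => m; apply: frepM => //; apply: frep_prod => l.
  exact: frepX.
by move=> i; rewrite FE.
Qed.

End FilteredProduct.

(** * The functions [ell] *)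

Section Ell.
Variables (p : nat) (m : forall n : nat, 'I_(p ^ n) -> {ffun 'I_n -> 'I_p}).
Arguments m : clear implicits.
Hypothesis m_enum : forall n : nat, bijective (m n).

Section OneField.
Variables (K : fieldType) (de : K -> K).
Hypotheses (hde : derivation de) (hp : p \in [pchar K]).

Let p_gt0 : (0 < p)%N := prime_gt0 (pcharf_prime hp).

Lemma derivation_pder : pder (fun _ => True) de.
Proof.
have [hD hM] := hde; have h0 : de 0 = 0.
  by have /eqP := hD 0 0; rewrite addr0 -subr_eq subrr eq_sym => /eqP.
split; first exact: subf_full; last by move=> x y _ _; apply: hM.
move=> x y _ _; apply/eqP; rewrite eq_sym subr_eq -hD subrK; exact/eqP.
Qed.

Lemma const_subf : subf (diff_constant de).
Proof.
have hd := derivation_pder; rewrite /diff_constant; split.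
- exact: (pder1 hd).
- by move=> x y hx hy; rewrite (pderB hd) // hx hy subrr.
- by move=> x y hx hy; rewrite (pderM hd) // hx hy mul0r mulr0 addr0.
- move=> x hx; have [->|x0] := eqVneq x 0; first by rewrite invr0 (pder0 hd).
  by rewrite (pderV hd) // hx oppr0 mul0r.
Qed.

Lemma de_expp x : de (x ^+ p) = 0.
Proof.
have hd := derivation_pder.
have h n : de (x ^+ n) = x ^+ n.-1 * de x *+ n.
  elim: n => [|n IH]; first by rewrite expr0 (pder1 hd).
  rewrite exprS (pderM hd) // IH /=; case: n {IH} => [|n].
    by rewrite expr0 mulr1 mulr0n mulr0 addr0 mul1r.
  by rewrite /= -mulrnAr mulrA -exprS mulrnAr [de x * _]mulrC -mulrS.
by rewrite h -mulr_natr (pcharf0 hp) mulr0.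
Qed.

Lemma const_expp x : diff_constant de (x ^+ p).
Proof. exact: de_expp. Qed.

(** As for separability above, denominators are made p-th powers and exponents are reduced modulo
    [p]. It is important that the roots [c e] stay in [F]. *)
Lemma pmonomial_span (F : K -> Prop) n (a : 'I_n -> K) x : subf F ->
  (forall j, F (a j)) -> fadj (ppow p F) a x ->
  exists c : {ffun 'I_n -> 'I_p} -> K, (forall e, F (c e)) /\
    x = \sum_e c e ^+ p * pmonomial e a.
Proof.
move=> hF Fa hx.
have Fg (f : {mpoly K[n]}) : (forall mm, ppow p F f@_mm) -> F f.@[a].
  by move=> hf; apply: subf_meval => // mm; have [y Fy ->] := hf mm; apply: subfX.
have [f [g [hf hg g0 ->]]] := fadj_frac (ppow_subf hp hF) hx.
pose h := f * g ^+ p.-1.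
have hh : coefin (ppow p F) h.
  have hFp := ppow_subf hp hF.
  by apply: (coefinM hFp) => //; apply: (coefin_exp hFp).
have -> : f.@[a] / g.@[a] = h.@[a] / g.@[a] ^+ p.
  rewrite mevalM rmorphXn /= -{2}(prednK p_gt0) exprSr invfM.
  by rewrite mulrA mulfK // expf_neq0.
have /choice [c hc'] : forall mm, exists y, F y /\ h@_mm = y ^+ p.
  by move=> mm; have [y] := hh mm; exists y.
have hc mm : h@_mm = c mm ^+ p by have [] := hc' mm.
pose eps (mm : 'X_{1..n}) : {ffun 'I_n -> 'I_p} := [ffun k => Ordinal (ltn_pmod (mm k) p_gt0)].
pose quo (mm : 'X_{1..n}) : K := \prod_k a k ^+ (mm k %/ p).
exists (fun e => (\sum_(mm <- msupp h | eps mm == e) c mm * quo mm) / g.@[a]).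
split=> [e|].
  apply: subf_div => //; last exact: Fg.
  apply: subf_sum => // mm _; apply: subfM => //; first by have [] := hc' mm.
  by apply: subf_prod => // k _; apply: subfX.
rewrite [h.@[a]]mevalE mulr_suml (partition_big eps xpredT) //=; apply: eq_bigr => e _.
rewrite exprMn [X in _ = X * _ * _](expp_sum hp) !mulr_suml exprVn; apply: eq_bigr => mm /eqP <-.
rewrite hc exprMn; have -> : \prod_i a i ^+ mm i = quo mm ^+ p * pmonomial (eps mm) a.
  rewrite /quo /pmonomial -prodrXl -big_split; apply: eq_bigr => k _ /=.
  by rewrite ffunE /= -exprM -exprD -divn_eq.
by ring.
Qed.

(** If the last entry were not in the field generated by the others over the p-th powers, it would
    have degree [p] over that field, and the p-monomials of the whole tuple would be independent. *)
Lemma p_dep_span n (x : 'I_n.+1 -> K) : (forall j, diff_constant de (x j)) ->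
  diff_p_indep p de (tuple_init x) -> ~ diff_p_indep p de x ->
  exists c : {ffun 'I_n -> 'I_p} -> K,
    x ord_max = \sum_e c e ^+ p * pmonomial e (tuple_init x).
Proof.
move=> hx [_ ha] nx; set a := tuple_init x in ha *.
suff /(pmonomial_span (@subf_full K) (fun _ => I)) [c [_ ->]] :
  fadj (ppow p (fun _ => True)) a (x ord_max) by exists c.
apply: contrapT => hb; apply: nx; split => // c c0.
have hF : subf (fadj (ppow p (fun _ => True)) a) by apply: fadj_subf; apply: (ppow_subf hp); exact: subf_full.
pose ext (e' : {ffun 'I_n -> 'I_p}) (i : 'I_p) : {ffun 'I_n.+1 -> 'I_p} :=
  [ffun j => if unlift ord_max j is Some j' then e' j' else i].
pose res (e : {ffun 'I_n.+1 -> 'I_p}) : {ffun 'I_n -> 'I_p} := [ffun j => e (lift ord_max j)].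
have extK e : ext (res e) (e ord_max) = e.
  by apply/ffunP => j; rewrite ffunE; case: unliftP => [j' ->|-> //]; rewrite ffunE.
have extmax e' i : ext e' i ord_max = i by rewrite ffunE unlift_none.
have resK e' i : res (ext e' i) = e' by apply/ffunP => j; rewrite !ffunE liftK.
have wid (j : 'I_n) : widen_ord (leqnSn n) j = lift ord_max j.
  by apply: val_inj; rewrite /= /bump leqNgt ltn_ord.
have monE e : pmonomial e x = pmonomial (res e) a * x ord_max ^+ e ord_max.
  rewrite /pmonomial big_ord_recr /=; congr (_ * _); apply: eq_bigr => j _.
  by rewrite ffunE /a /tuple_init wid.
pose cf (i : nat) := if insub i is Some i' then
  \sum_e' c (ext e' i') ^+ p * pmonomial e' a else 0.
have cfE (i : 'I_p) : cf i = \sum_e' c (ext e' i) ^+ p * pmonomial e' a.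
  by rewrite /cf valK.
have q0 : \poly_(i < p) cf i = 0.
  apply: (poly_small_vanish hp hF _ hb).
  - by apply: fadj_base; exists (x ord_max).
  - move=> i; rewrite coef_poly; case: ifP => hi; last by apply: subf0.
    rewrite (cfE (Ordinal hi)); apply: subf_sum => // e' _; apply: subfM => //.
      by apply: fadj_base; exists (c (ext e' (Ordinal hi))).
    by apply: subf_prod => // j _; apply: subfX => //; apply: fadj_gen.
  - exact: size_poly.
  rewrite horner_poly -[RHS]c0.
  under eq_bigr do rewrite cfE mulr_suml.
  rewrite pair_bigA /=.
  rewrite (reindex (fun e : {ffun 'I_n.+1 -> 'I_p} => (e ord_max, res e))) /=.
    by apply: eq_bigr => e _; rewrite extK monE mulrA.
  exists (fun ie : 'I_p * {ffun 'I_n -> 'I_p} => ext ie.2 ie.1) => [e|[i e']] _ /=.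
    by rewrite extK.
  by rewrite extmax resK.
move=> e; rewrite -(extK e).
apply: (ha (fun e' => c (ext e' (e ord_max)))).
by rewrite -cfE; have := coef_poly p cf (e ord_max); rewrite q0 coef0 ltn_ord.
Qed.

Lemma sum_enum n (F : {ffun 'I_n -> 'I_p} -> K) :
  \sum_(i < p ^ n) F (m n i) = \sum_e F e.
Proof.
have [g gK hK] := m_enum n.
by rewrite [RHS](reindex (m n)) //; exists g => i _; [apply: gK|apply: hK].
Qed.

(** Every differential field of characteristic [p] constructed later thereby becomes a structure for
    the full language. *)
Lemma ell_exists : exists ell, ell_spec de m ell.
Proof.
have key n (x : 'I_n.+1 -> K) : exists c : 'I_(p ^ n) -> K,
    (ell_degenerate p de x -> forall i, c i = 0) /\
    (~ ell_degenerate p de x ->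
      x ord_max = \sum_(i < p ^ n) c i ^+ p * pmonomial (m n i) (tuple_init x)).
  have [hd|hd] := pselect (ell_degenerate p de x); first by exists (fun _ => 0).
  have h1 : forall j, diff_constant de (x j).
    by apply: contrapT => h; apply: hd; apply: Or31.
  have h2 : diff_p_indep p de (tuple_init x).
    by apply: contrapT => h; apply: hd; apply: Or32.
  have h3 : ~ diff_p_indep p de x by move=> h; apply: hd; apply: Or33.
  have [c hc] := p_dep_span h1 h2 h3.
  exists (fun i => c (m n i)); split => // _.
  by rewrite (sum_enum (fun e => c e ^+ p * pmonomial e (tuple_init x))).
have key2 n : exists c : ('I_n.+1 -> K) -> 'I_(p ^ n) -> K,
    forall x, (ell_degenerate p de x -> forall i, c x i = 0) /\
    (~ ell_degenerate p de x ->
      x ord_max = \sum_(i < p ^ n) c x i ^+ p * pmonomial (m n i) (tuple_init x)).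
  by have [c hc] := choice (@key n); exists c; exact: hc.
exists (fun n i x => sval (cid (key2 n)) x i) => n x.
by case: (cid (key2 n)) => c /= hc; apply: hc.
Qed.

Lemma ell_nondegenerate n (x : 'I_n.+1 -> K) : ~ ell_degenerate p de x ->
  [/\ forall j, diff_constant de (x j), diff_p_indep p de (tuple_init x) &
      ~ diff_p_indep p de x].
Proof.
move=> hd; split.
- by apply: contrapT => h; apply: hd; apply: Or31.
- by apply: contrapT => h; apply: hd; apply: Or32.
- by move=> h; apply: hd; apply: Or33.
Qed.

Lemma ell_unique ell n (x : 'I_n.+1 -> K) (c : 'I_(p ^ n) -> K) :
  ell_spec de m ell -> ~ ell_degenerate p de x ->
  x ord_max = \sum_(i < p ^ n) c i ^+ p * pmonomial (m n i) (tuple_init x) ->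
  forall i, c i = ell n i x.
Proof.
move=> hell hx hc i; have [_ /(_ hx) he] := hell n x.
have [_ [_ hi] _] := ell_nondegenerate hx.
have [g gK hK] := m_enum n.
have : (c (g (m n i)) - ell n (g (m n i)) x) ^+ p = 0.
  apply: (hi (fun e => c (g e) - ell n (g e) x)).
  rewrite -(sum_enum (fun e => (c (g e) - ell n (g e) x) ^+ p * pmonomial e (tuple_init x))).
  under eq_bigr do rewrite (exppB hp) mulrBl gK.
  by rewrite sumrB -hc -he subrr.
by move=> /eqP; rewrite (expp_eq0 hp) subr_eq0 gK => /eqP.
Qed.

End OneField.

(** * Homomorphisms compatible with the coordinate functions *)

Section TwoFields.
Variables (K L : fieldType) (dK : K -> K) (dL : L -> L) (h : K -> L).
Hypotheses (hK : derivation dK) (hL : derivation dL).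
Hypotheses (hpK : p \in [pchar K]) (hpL : p \in [pchar L]).

Definition dhom : Prop :=
  [/\ h 1 = 1, forall x y, h (x - y) = h x - h y,
      forall x y, h (x * y) = h x * h y & forall x, h (dK x) = dL (h x)].

Hypothesis hh : dhom.

Definition dhom_rrel : rrel (fun x y => y = h x).
Proof.
have [h1 hB hM hd] := hh; split => //.
- by move=> x y _ _ -> ->.
- by move=> x y _ _ -> ->.
Qed.

Lemma dhom0 : h 0 = 0.
Proof. by rewrite (rrel0 dhom_rrel). Qed.
Lemma dhomD x y : h (x + y) = h x + h y.
Proof. by apply/esym; apply: (rrelD dhom_rrel). Qed.
Lemma dhomN x : h (- x) = - h x.
Proof. by apply/esym; apply: (rrelN dhom_rrel). Qed.
Lemma dhomX x n : h (x ^+ n) = h x ^+ n.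
Proof. by apply/esym; apply: (rrelX dhom_rrel). Qed.
Lemma dhom_eq0 x : (h x == 0) = (x == 0).
Proof.
have [h1 _ hM _] := hh; apply/eqP/eqP => [hx|->]; last exact: dhom0.
apply/eqP; apply: contraT => x0.
have : h (x * x^-1) = 1 by rewrite mulfV.
by rewrite hM hx mul0r => /eqP; rewrite eq_sym oner_eq0.
Qed.
Lemma dhom_inj : injective h.
Proof.
have [_ hB _ _] := hh; move=> x y e; apply/eqP; rewrite -subr_eq0 -dhom_eq0 hB e.
by rewrite subrr.
Qed.
Lemma dhomV x : h x^-1 = (h x)^-1.
Proof.
have [h1 _ hM _] := hh; have [->|x0] := eqVneq x 0; first by rewrite invr0 dhom0 invr0.
have hx0 : h x != 0 by rewrite dhom_eq0.
by apply: (mulfI hx0); rewrite -hM !mulfV.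
Qed.
Lemma dhom_sum (I : Type) (r : seq I) (P : pred I) (G : I -> K) :
  h (\sum_(i <- r | P i) G i) = \sum_(i <- r | P i) h (G i).
Proof. by apply/esym; apply: (rrel_sum dhom_rrel). Qed.
Lemma dhom_prod (I : Type) (r : seq I) (P : pred I) (G : I -> K) :
  h (\prod_(i <- r | P i) G i) = \prod_(i <- r | P i) h (G i).
Proof. by apply/esym; apply: (rrel_prod dhom_rrel). Qed.

(** Only families of constants are concerned, since the p-monomials of a differentially
    p-independent tuple are constants. *)
Definition sep_hom : Prop := forall n (u : 'I_n -> K),
  (forall i, diff_constant dK (u i)) -> lin_indep_over_Kp p u ->
  lin_indep_over_Kp p (fun i => h (u i)).

Lemma lin_indep_pullback (I : finType) (u : I -> K) :
  lin_indep_over_Kp p (fun i => h (u i)) -> lin_indep_over_Kp p u.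
Proof.
have [_ _ hM _] := hh.
move=> hi c c0 i; apply: dhom_inj; rewrite dhom0 dhomX.
apply: (hi (fun i => h (c i))); rewrite -[RHS]dhom0 -[X in _ = h X]c0 dhom_sum.
by apply: eq_bigr => j _; rewrite hM dhomX.
Qed.

Lemma dhom_diff_p_indep n (a : 'I_n -> K) : sep_hom ->
  diff_p_indep p dL (fun j => h (a j)) <-> diff_p_indep p dK a.
Proof.
have [_ _ hM hd] := hh.
have cE x : diff_constant dL (h x) <-> diff_constant dK x.
  by rewrite /diff_constant -hd; split=> [/eqP|->]; [rewrite dhom_eq0 => /eqP|apply: dhom0].
have mE e : pmonomial e (fun j => h (a j)) = h (pmonomial (p := p) e a).
  by rewrite /pmonomial dhom_prod; apply: eq_bigr => j _; rewrite dhomX.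
move=> hs; split=> -[h1 h2]; split; try by move=> j; apply/cE.
- apply: lin_indep_pullback => c c0; apply: h2; rewrite -[RHS]c0.
  by apply: eq_bigr => e _; rewrite mE.
- move=> c c0 e.
  have hi : lin_indep_over_Kp p (fun k => h (pmonomial (p := p) (@enum_val {ffun 'I_n -> 'I_p} xpredT k) a)).
    apply: hs.
      move=> k; apply: (subf_prod (const_subf hK)) => j _.
      by apply: (subfX (const_subf hK)).
    move=> c' c0' k.
    have := h2 (fun e => c' (enum_rank e)) _ (enum_val k); rewrite enum_valK; apply.
    rewrite -[RHS]c0'; under eq_bigr => e' _ do rewrite -{2}(enum_rankK e').
    rewrite (reindex (@enum_val _ xpredT)) /=; last first.
      by exists enum_rank => k' _; [apply: enum_valK|apply: enum_rankK].
    by apply: eq_bigr => k' _; rewrite enum_valK.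
  have := hi (fun k => c (enum_val k)) _ (enum_rank e); rewrite enum_rankK; apply.
  rewrite -[RHS]c0 [RHS](reindex (@enum_val _ xpredT)) /=; last first.
    by exists enum_rank => k' _; [apply: enum_valK|apply: enum_rankK].
  by apply: eq_bigr => k' _; rewrite mE.
Qed.

(** Degeneracy is the same on both sides, and in the other case the images of the coordinates
    satisfy the equation that determines the coordinates of the image. *)
Lemma ell_embedding ellK ellL n (i : 'I_(p ^ n)) (x : 'I_n.+1 -> K) : sep_hom ->
  ell_spec dK m ellK -> ell_spec dL m ellL ->
  h (ellK n i x) = ellL n i (fun j => h (x j)).
Proof.
move=> hs hK' hL'; have [_ _ hM hd] := hh.
have cE y : diff_constant dL (h y) <-> diff_constant dK y.
  by rewrite /diff_constant -hd; split=> [/eqP|->]; [rewrite dhom_eq0 => /eqP|apply: dhom0].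
have dE : ell_degenerate p dL (fun j => h (x j)) <-> ell_degenerate p dK x.
  have e1 : diff_p_indep p dL (tuple_init (fun j => h (x j))) <->
      diff_p_indep p dK (tuple_init x) := dhom_diff_p_indep (tuple_init x) hs.
  have e2 := dhom_diff_p_indep x hs.
  split=> -[].
  - by move=> h1; apply: Or31 => h2; apply: h1 => j; apply/cE.
  - by move=> h1; apply: Or32 => /e1.
  - by move=> /e2; apply: Or33.
  - by move=> h1; apply: Or31 => h2; apply: h1 => j; apply/cE.
  - by move=> h1; apply: Or32 => /e1.
  - by move=> /e2; apply: Or33.
have [hd'|hd'] := pselect (ell_degenerate p dK x).
  have [/(_ hd') -> _] := hK' n x; have [/(_ (dE.2 hd')) -> _] := hL' n (fun j => h (x j)).
  exact: dhom0.
have nd : ~ ell_degenerate p dL (fun j => h (x j)) by move/dE.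
apply: (ell_unique hpL (c := fun i => h (ellK n i x)) hL' nd).
have [_ /(_ hd') ->] := hK' n x; rewrite dhom_sum; apply: eq_bigr => k _.
by rewrite hM dhomX /pmonomial dhom_prod; congr (_ * _); apply: eq_bigr => j _; rewrite dhomX.
Qed.

End TwoFields.
End Ell.

(** * Ultraproducts *)

Lemma dchoice (I : Type) (T : I -> Type) (P : forall i, T i -> Prop) :
  (forall i, exists x, P i x) -> exists f : forall i, T i, forall i, P i (f i).
Proof. by move=> h; exists (fun i => sval (cid (h i))) => i; case: cid. Qed.

Section Los.
Variables (L : language) (I : Type) (U : (I -> Prop) -> Prop)
  (A : I -> structure L) (B : structure L) (cls : (forall i, A i) -> B).

(** An ultraproduct is characterized by its class map, so that truth can be transferred to a
    structure whose carrier was built as a field. *)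
Definition is_uprod : Prop :=
  [/\ forall b, exists s, b = cls s,
      forall s t, cls s = cls t <-> U (fun i => s i = t i) &
      forall f (x : 'I_(arity f) -> forall i, A i),
        interp (fun j => cls (x j)) = cls (fun i => interp (fun j => x j i))].

Hypotheses (hU : ultra U) (hB : is_uprod) (hA : forall i, exists a : A i, True).

Lemma ultra_not P : U (fun i => ~ P i) <-> ~ U P.
Proof.
have [[_ US UI UN] UC] := hU; split=> [h h'|h].
  by apply: UN; apply: US (UI _ _ h h') => i [].
by have [] := UC P.
Qed.

Lemma ultra_impl P Q : (U P -> U Q) <-> U (fun i => P i -> Q i).
Proof.
have [[_ US UI UN] UC] := hU; split=> [h|h hP].
  have [/h|] := UC P; first by apply: US.
  by apply: US => i nP /nP.
by apply: US (UI _ _ h hP) => i [].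
Qed.

Lemma ultra_and P Q : U (fun i => P i /\ Q i) <-> U P /\ U Q.
Proof.
have [[_ US UI UN] UC] := hU; split=> [h|[]]; last exact: UI.
by split; apply: US h => i [].
Qed.

Lemma ultra_or P Q : U (fun i => P i \/ Q i) <-> U P \/ U Q.
Proof.
have [[_ US UI UN] UC] := hU; split=> [h|[]]; try by apply: US; tauto.
have [|nP] := UC P; first by left.
by right; apply: US (UI _ _ h nP) => i [[]].
Qed.

Lemma los_eval n (t : term L n) (v : 'I_n -> forall i, A i) :
  eval (fun j => cls (v j)) t = cls (fun i => eval (fun j => v j i) t).
Proof.
elim: t => [//|f args IH] /=; have [_ _ <-] := hB.
by congr interp; apply/funext.
Qed.

Lemma scons_cls n (s : forall i, A i) (v : 'I_n -> forall i, A i) :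
  scons (cls s) (fun j => cls (v j)) = fun j => cls (scons s v j).
Proof. by apply/funext => j; rewrite /scons; case: unlift. Qed.

Lemma scons_pt n (s : forall i, A i) (v : 'I_n -> forall i, A i) i :
  (fun j => scons s v j i) = scons (s i) (fun j => v j i).
Proof. by apply/funext => j; rewrite /scons; case: unlift. Qed.

Theorem los n (phi : formula L n) (v : 'I_n -> forall i, A i) :
  holds phi (fun j => cls (v j)) <-> U (fun i => holds phi (fun j => v j i)).
Proof.
have [[UT US UI UN] UC] := hU; have [surj ceq cint] := hB.
elim: phi v => {n} [n|n s t|n a IHa b IHb|n a IHa b IHb|n a IHa b IHb|n a IH|n a IH] v /=.
- by split => // /UN.
- by rewrite !los_eval ceq.
- by rewrite -ultra_impl IHa IHb.
- by rewrite ultra_and IHa IHb.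
- by rewrite ultra_or IHa IHb.
- split=> [h|h x].
    (* At each index [s i] is a counterexample if there is one, so truth at [s i] gives truth
       everywhere. *)
    have [s hs] : exists s : forall i, A i, forall i,
        holds a (scons (s i) (fun j => v j i)) ->
        forall x, holds a (scons x (fun j => v j i)).
      apply: (@dchoice I A (fun i y => holds a (scons y (fun j => v j i)) ->
        forall x, holds a (scons x (fun j => v j i)))) => i; have [y _] := hA i.
      have [hx|hx] := pselect (forall x, holds a (scons x (fun j => v j i))).
        by exists y.
      have [x nx] : exists x, ~ holds a (scons x (fun j => v j i)).
        by apply: contrapT => nx; apply: hx => x; apply: contrapT => h'; apply: nx; exists x.
      by exists x.
    have := h (cls s); rewrite scons_cls => /IH; apply: US => i.
    by rewrite scons_pt; apply: hs.
  have [s ->] := surj x; rewrite scons_cls; apply/IH.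
  by apply: US h => i h; rewrite scons_pt; apply: h.
- split=> [[x]|h].
    have [s ->] := surj x; rewrite scons_cls => /IH; apply: US => i.
    by rewrite scons_pt; exists (s i).
have [s hs] : exists s : forall i, A i, forall i,
    (exists x, holds a (scons x (fun j => v j i))) ->
    holds a (scons (s i) (fun j => v j i)).
  apply: (@dchoice I A (fun i y => (exists x, holds a (scons x (fun j => v j i))) ->
    holds a (scons y (fun j => v j i)))) => i; have [y _] := hA i.
  have [[x hx]|hx] := pselect (exists x, holds a (scons x (fun j => v j i))).
    by exists x.
  by exists y.
exists (cls s); rewrite scons_cls; apply/IH; apply: US h => i.
by rewrite scons_pt; apply: hs.
Qed.

End Los.

(** * The class of differential fields *)

Section DFields.
Variables (p : nat) (m : forall n : nat, 'I_(p ^ n) -> {ffun 'I_n -> 'I_p}).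
Arguments m : clear implicits.
Hypothesis m_enum : forall n : nat, bijective (m n).

Record dfield := DField {
  dcar :> fieldType;
  ddel : dcar -> dcar;
  dell : forall n, 'I_(p ^ n) -> ('I_n.+1 -> dcar) -> dcar;
  ddf : DF_field p ddel;
  dell_spec : ell_spec ddel m dell }.

Definition dstr (A : dfield) : structure (L_dl p) := dl_structure (@ddel A) (@dell A).
Definition sdc (A : dfield) : Prop := separably_diff_closed (@ddel A).

Lemma dder (A : dfield) : derivation (@ddel A). Proof. by case: (ddf A). Qed.
Lemma dpchar (A : dfield) : p \in [pchar A]. Proof. by case: (ddf A). Qed.

Section UltraproductOfFields.
Variables (I : Type) (U : (I -> Prop) -> Prop) (A : I -> dfield).
Hypothesis hU : ultra U.

Let K i : fieldType := A i.

Lemma up_spec : fp_spec U (K := K) (fun _ => True).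
Proof.
have [hF hC] := hU; split => // s _; have [h|h] := hC (fun i => s i = 0).
  by left.
by right; case: hF => _ US _ _; apply: US h => i /eqP.
Qed.

Definition upfield : fieldType := fpfield up_spec.
Local Notation rep := (@frep I U K (fun _ => True) up_spec).

Lemma up_cls_ex (s : forall i, A i) : exists x : upfield, rep x s.
Proof. exact: frep_ex. Qed.

Definition upcls (s : forall i, A i) : upfield := sval (cid (up_cls_ex s)).
Lemma up_rep s : rep (upcls s) s.
Proof. by rewrite /upcls; case: cid. Qed.
Lemma up_eq s t : upcls s = upcls t <-> U (fun i => s i = t i).
Proof. exact: frep_eq (up_rep s) (up_rep t). Qed.
Lemma up_cls x s : rep x s -> x = upcls s.
Proof.
move=> h; apply/(frep_eq h (up_rep s)); have [[UT US _ _] _] := hU.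
by apply: US UT.
Qed.
Lemma up_surj x : exists s, x = upcls s.
Proof. by have [s /up_cls ->] := frep_surj x; exists s. Qed.

Lemma upB s t : upcls (fun i => s i - t i) = upcls s - upcls t.
Proof. by apply/esym/up_cls; apply: frepB; apply: up_rep. Qed.
Lemma upM s t : upcls (fun i => s i * t i) = upcls s * upcls t.
Proof. by apply/esym/up_cls; apply: frepM; apply: up_rep. Qed.
Lemma up1 : upcls (fun i => 1) = 1.
Proof. by apply/esym/up_cls; apply: frep1. Qed.
Lemma upD s t : upcls (fun i => s i + t i) = upcls s + upcls t.
Proof. by apply/esym/up_cls; apply: frepD; apply: up_rep. Qed.
Lemma upN s : upcls (fun i => - s i) = - upcls s.
Proof. by apply/esym/up_cls; apply: frepN; apply: up_rep. Qed.
Lemma up0 : upcls (fun i => 0) = 0.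
Proof. by apply/esym/up_cls; apply: frep0. Qed.
Lemma upV s : upcls (fun i => (s i)^-1) = (upcls s)^-1.
Proof. by apply/esym/up_cls; apply: frepV; apply: up_rep. Qed.

Definition uprep (x : upfield) : forall i, A i := sval (cid (up_surj x)).
Lemma uprepK x : upcls (uprep x) = x.
Proof. by rewrite /uprep; case: cid. Qed.

Definition updel (x : upfield) : upfield := upcls (fun i => ddel (uprep x i)).
Lemma updelE s : updel (upcls s) = upcls (fun i => ddel (s i)).
Proof.
apply/up_eq; have : upcls (uprep (upcls s)) = upcls s by rewrite uprepK.
by move=> /up_eq; have [[_ US _ _] _] := hU; apply: US => i ->.
Qed.

Lemma up_ex : exists i : I, True.
Proof.
apply: contrapT => h; have [[UT US _ UN] _] := hU; apply: UN; apply: US UT => i _.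
by apply: h; exists i.
Qed.

Lemma up_derivation : derivation updel.
Proof.
split=> x y; have [s ->] := up_surj x; have [t ->] := up_surj y.
- rewrite -upD !updelE -upD; apply/up_eq; have [[UT US _ _] _] := hU.
  by apply: US UT => i _; have [-> _] := dder (A i).
- rewrite -upM !updelE -!upM -upD; apply/up_eq; have [[UT US _ _] _] := hU.
  by apply: US UT => i _; have [_ ->] := dder (A i).
Qed.

Lemma up_pchar : p \in [pchar upfield].
Proof. by apply: fp_pchar up_ex => i; apply: dpchar. Qed.

Lemma ultra_fin (J : finType) (P : J -> I -> Prop) : (forall j, U (P j)) ->
  U (fun i => forall j, P j i).
Proof.
move=> h; have [[UT US UI _] _] := hU.
have : U (fun i => forall j, j \in enum J -> P j i).
  elim: (enum J) => [|j r IH]; first by apply: US UT.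
  apply: US (UI _ _ (h j) IH) => i [h1 h2] j'.
  by rewrite inE => /orP [/eqP -> //|/h2].
by apply: US => i hi j; apply: hi; rewrite mem_enum.
Qed.

Lemma up_sum (J : Type) (r : seq J) (s : J -> forall i, A i) :
  upcls (fun i => \sum_(j <- r) s j i) = \sum_(j <- r) upcls (s j).
Proof. by apply/esym/up_cls; apply: frep_sum => j; apply: up_rep. Qed.
Lemma upX s k : upcls (fun i => s i ^+ k) = upcls s ^+ k.
Proof. by apply/esym/up_cls; apply: frepX; apply: up_rep. Qed.
Lemma up_prod (J : Type) (r : seq J) (s : J -> forall i, A i) :
  upcls (fun i => \prod_(j <- r) s j i) = \prod_(j <- r) upcls (s j).
Proof. by apply/esym/up_cls; apply: frep_prod => j; apply: up_rep. Qed.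

Lemma up_lin_indep (J : finType) (u : J -> forall i, A i) :
  lin_indep_over_Kp p (fun j => upcls (u j)) <->
  U (fun i => lin_indep_over_Kp p (fun j => u j i)).
Proof.
have [[UT US UI UN] UC] := hU; split=> [h|h c c0 j].
  apply: contrapT => /(ultra_not hU) nh.
  have [c hc] : exists c : forall i, J -> A i, forall i,
      ~ lin_indep_over_Kp p (fun j => u j i) ->
      \sum_j c i j ^+ p * u j i = 0 /\ ~ forall j, c i j ^+ p = 0.
    apply: (@dchoice I (fun i => J -> A i) (fun i ci =>
      ~ lin_indep_over_Kp p (fun j => u j i) ->
      \sum_j ci j ^+ p * u j i = 0 /\ ~ forall j, ci j ^+ p = 0)) => i.
    apply: contrapT => hn; apply: (hn); exists (fun _ => 0) => hi.
    case: hi => c c0; apply: contrapT => cn.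
    by apply: hn; exists c => _; split => // h0; apply: cn; apply: h0.
  have c0 j : upcls (fun i => c i j) = 0.
    apply/eqP; rewrite -(expp_eq0 up_pchar); apply/eqP.
    apply: (h (fun j => upcls (fun i => c i j))).
    under eq_bigr do rewrite -upX -upM; rewrite -up_sum -[RHS]up0.
    by apply/up_eq; apply: US nh => i /hc [].
  have c0' : U (fun i => forall j, c i j = 0).
    by apply: ultra_fin => j; apply/up_eq; rewrite c0 up0.
  apply: UN; apply: US (UI _ _ c0' nh) => i [e /hc [_]]; apply=> j.
  by rewrite e expr0n (gtn_eqF (prime_gt0 (pcharf_prime up_pchar))).
have [s hs] : exists s : J -> forall i, A i, forall j, c j = upcls (s j).
  exact: (@dchoice J (fun _ => forall i, A i) (fun j s => c j = upcls s) (fun j => up_surj (c j))).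
have : U (fun i => \sum_j s j i ^+ p * u j i = 0).
  apply/up_eq; rewrite up_sum up0 -[RHS]c0; apply: eq_bigr => k _.
  by rewrite upM upX hs.
move=> h0; rewrite hs -upX -up0; apply/up_eq.
by apply: US (UI _ _ h h0) => i [hi /hi].
Qed.

Lemma up_const s : diff_constant updel (upcls s) <-> U (fun i => diff_constant (@ddel (A i)) (s i)).
Proof. by rewrite /diff_constant updelE -up0; apply: up_eq. Qed.

Lemma up_infinite_degree : infinite_degree p updel.
Proof.
move=> n; have [[UT US UI UN] UC] := hU.
have [u hu] : exists u : forall i, 'I_n -> A i, forall i,
    (forall j, diff_constant (@ddel (A i)) (u i j)) /\ lin_indep_over_Kp p (u i).
  apply: (@dchoice I (fun i => 'I_n -> A i) (fun i u =>
    (forall j, diff_constant (@ddel (A i)) (u j)) /\ lin_indep_over_Kp p u)) => i.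
  by have [_ _] := ddf (A i); apply.
exists (fun j => upcls (fun i => u i j)); split.
  by move=> j; apply/up_const; apply: US UT => i _; have [] := hu i.
by apply/up_lin_indep; apply: US UT => i _; have [] := hu i.
Qed.

Lemma up_DF : DF_field p updel.
Proof. by split; [exact: up_derivation|exact: up_pchar|exact: up_infinite_degree]. Qed.

Lemma up_pindep n (x : 'I_n -> forall i, A i) :
  diff_p_indep p updel (fun j => upcls (x j)) <->
  U (fun i => diff_p_indep p (@ddel (A i)) (fun j => x j i)).
Proof.
have [[UT US UI UN] UC] := hU.
rewrite /diff_p_indep ultra_and //.
have -> : (forall j, diff_constant updel (upcls (x j))) <->
    U (fun i => forall j, diff_constant (@ddel (A i)) (x j i)).
  split=> [h|h j]; first by apply: ultra_fin => j; apply/up_const.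
  by apply/up_const; apply: US h.
rewrite -(up_lin_indep (fun e : {ffun 'I_n -> 'I_p} => fun i => pmonomial e (fun j => x j i))).
have -> // : (fun e : {ffun 'I_n -> 'I_p} => pmonomial e (fun j => upcls (x j))) =
  (fun e : {ffun 'I_n -> 'I_p} => upcls (fun i => pmonomial e (fun j => x j i))).
by apply/funext => e; rewrite /pmonomial up_prod; apply: eq_bigr => j _; rewrite upX.
Qed.

Lemma ell_degenerateN (L : fieldType) (de : L -> L) n (x : 'I_n.+1 -> L) :
  ~ ell_degenerate p de x <-> [/\ forall j, diff_constant de (x j),
      diff_p_indep p de (tuple_init x) & ~ diff_p_indep p de x].
Proof. by split=> [/ell_nondegenerate //|[h1 h2 h3] []]. Qed.

Lemma up_nondegenerate n (x : 'I_n.+1 -> forall i, A i) :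
  ~ ell_degenerate p updel (fun j => upcls (x j)) <->
  U (fun i => ~ ell_degenerate p (@ddel (A i)) (fun j => x j i)).
Proof.
have [[UT US UI UN] UC] := hU; rewrite ell_degenerateN; split.
- move=> [h1 h2 h3].
  have k1 : U (fun i => forall j, diff_constant (@ddel (A i)) (x j i)).
    by apply: ultra_fin => j; apply/up_const.
  have k2 : U (fun i => diff_p_indep p (@ddel (A i)) (tuple_init (fun j => x j i))).
    exact: (up_pindep (fun j => x (widen_ord (leqnSn n) j))).1 h2.
  have k3 : U (fun i => ~ diff_p_indep p (@ddel (A i)) (fun j => x j i)).
    by apply/ultra_not => // /up_pindep.
  by apply: US (UI _ _ k1 (UI _ _ k2 k3)) => i [? [? ?]]; apply/ell_degenerateN.
- move=> h; split.
  + by move=> j; apply/up_const; apply: US h => i /ell_degenerateN [].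
  + apply: (up_pindep (fun j => x (widen_ord (leqnSn n) j))).2.
    by apply: US h => i /ell_degenerateN [].
  + move=> /up_pindep; apply/ultra_not => //.
    by apply: US h => i /ell_degenerateN [].
Qed.

Lemma up_ell ell n (l : 'I_(p ^ n)) (x : 'I_n.+1 -> forall i, A i) :
  ell_spec updel m ell ->
  ell n l (fun j => upcls (x j)) = upcls (fun i => dell l (fun j => x j i)).
Proof.
move=> hell; have [[UT US UI UN] UC] := hU.
have [hd|hd] := pselect (ell_degenerate p updel (fun j => upcls (x j))).
  have [/(_ hd) -> _] := hell n (fun j => upcls (x j)).
  have : U (fun i => ell_degenerate p (@ddel (A i)) (fun j => x j i)).
    have [//|/up_nondegenerate //] := UC (fun i => ell_degenerate p (@ddel (A i)) (fun j => x j i)).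
  move=> h; rewrite -up0; apply/up_eq; apply: US h => i hi.
  by have [/(_ hi) ->] := @dell_spec (A i) _ (fun j => x j i).
apply/esym; apply: (ell_unique m_enum up_pchar (c := fun l => upcls (fun i => dell l (fun j => x j i))) hell hd).
have /up_nondegenerate h := hd.
under eq_bigr => l' _.
  have -> : pmonomial (m n l') (tuple_init (fun j => upcls (x j))) =
      upcls (fun i => pmonomial (m n l') (tuple_init (fun j => x j i))).
    rewrite /pmonomial up_prod; apply: eq_bigr => j _; rewrite upX //.
  rewrite -upX -upM; over.
rewrite -up_sum; apply/up_eq; apply: US h => i hi.
by have [_ /(_ hi)] := @dell_spec (A i) _ (fun j => x j i).
Qed.

Lemma up_iter s k : iter k updel (upcls s) = upcls (fun i => iter k (@ddel (A i)) (s i)).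
Proof. by elim: k => [|k IH] //=; rewrite IH updelE. Qed.

Lemma up_meval n (f : {mpoly upfield[n]}) : exists F : forall i, {mpoly (A i)[n]},
  [/\ forall mm, f@_mm = upcls (fun i => (F i)@_mm),
      forall i mm, mm \notin msupp f -> (F i)@_mm = 0 &
      forall s, diff_eval updel f (upcls s) =
         upcls (fun i => diff_eval (@ddel (A i)) (F i) (s i))].
Proof.
have [F [h1 h2]] := fp_lift f; exists F; split => //.
  by move=> mm; apply: up_cls.
move=> s; apply: up_cls; apply: (fp_meval h1 h2) => l.
by rewrite up_iter; apply: up_rep.
Qed.

Lemma order_of_deriv (L : fieldType) n (f : {mpoly L[n]}) k : f^`M(k) != 0 -> occurs k f.
Proof.
move=> h; have [mm hmm] : exists mm, f^`M(k)@_mm != 0.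
  apply: contrapT => nh; case/eqP: h; apply/mpolyP => mm; rewrite mcoeff0.
  by apply/eqP; apply: contraT => hm; case: nh; exists mm.
exists (mm + U_(k))%MM; last by rewrite mnmDE mnm1E eqxx addn1.
rewrite mcoeff_msupp; apply: contraNneq hmm => e.
by rewrite mcoeff_deriv e mul0rn.
Qed.

Lemma up_mpoly_neq0 n (f : {mpoly upfield[n]}) (F : forall i, {mpoly (A i)[n]}) :
  (forall mm, f@_mm = upcls (fun i => (F i)@_mm)) -> f != 0 -> U (fun i => F i != 0).
Proof.
move=> hF f0; have [[UT US UI UN] UC] := hU.
have [mm hmm] : exists mm, f@_mm != 0.
  apply: contrapT => nh; case/eqP: f0; apply/mpolyP => mm; rewrite mcoeff0.
  by apply/eqP; apply: contraT => hm; case: nh; exists mm.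
have [h|h] := UC (fun i => (F i)@_mm = 0).
  by case/eqP: hmm; rewrite hF -up0; apply/up_eq.
by apply: US h => i hi; apply: contra_notN hi => /eqP ->; rewrite mcoeff0.
Qed.

(** Order bounds hold at every index because the supports of the representatives lie in those of [f]
    and [g], whereas nonvanishing of [g] and of the separant holds almost everywhere. *)
Lemma up_sdc : U (fun i => sdc (A i)) -> separably_diff_closed updel.
Proof.
move=> hs N f g k [hk1 hk2] sf g0 glt; have [[UT US UI UN] UC] := hU.
have [F [F1 F2 F3]] := up_meval f; have [G [G1 G2 G3]] := up_meval g.
have UF : U (fun i => (F i)^`M(k) != 0).
  apply: up_mpoly_neq0 sf => mm; rewrite mcoeff_deriv F1.
  rewrite (up_cls (frepMn _ (up_rep _))); apply/up_eq; apply: US UT => i _.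
  by rewrite mcoeff_deriv.
have UG : U (fun i => G i != 0) by apply: up_mpoly_neq0 g0.
have H : U (fun i => exists a : A i, diff_eval (@ddel (A i)) (F i) a = 0 /\
    diff_eval (@ddel (A i)) (G i) a != 0).
  apply: US (UI _ _ hs (UI _ _ UF UG)) => i [hsi [hFi hGi]].
  apply: (hsi N (F i) (G i) k) => //.
  - split; first exact: order_of_deriv.
    move=> j [e he ej]; apply: hk2; exists e => //.
    by apply: contraLR he => /(F2 i); rewrite mcoeff_msupp negbK => ->.
  - move=> j [e he ej]; apply: glt; exists e => //.
    by apply: contraLR he => /(G2 i); rewrite mcoeff_msupp negbK => ->.
have [s hs'] : exists s : forall i, A i, forall i,
    (exists a : A i, diff_eval (@ddel (A i)) (F i) a = 0 /\
    diff_eval (@ddel (A i)) (G i) a != 0) ->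
    diff_eval (@ddel (A i)) (F i) (s i) = 0 /\ diff_eval (@ddel (A i)) (G i) (s i) != 0.
  apply: (@dchoice I A (fun i y => (exists a : A i, diff_eval (@ddel (A i)) (F i) a = 0 /\
    diff_eval (@ddel (A i)) (G i) a != 0) ->
    diff_eval (@ddel (A i)) (F i) y = 0 /\ diff_eval (@ddel (A i)) (G i) y != 0)) => i.
  have [[a ha]|h] := pselect (exists a : A i, diff_eval (@ddel (A i)) (F i) a = 0 /\
    diff_eval (@ddel (A i)) (G i) a != 0); first by exists a.
  by exists 0.
exists (upcls s); rewrite F3 G3; split.
  by rewrite -up0; apply/up_eq; apply: US H => i /hs' [].
apply/eqP; rewrite -up0 => /up_eq h; apply: UN.
by apply: US (UI _ _ H h) => i [/hs' [_ /eqP]].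
Qed.

Theorem ultraproduct : exists (B : dfield) (cls : (forall i, A i) -> B),
  [/\ is_uprod U (A := fun i => dstr (A i)) (B := dstr B) cls,
      U (fun i => sdc (A i)) -> sdc B,
      (forall s t, cls (fun i => s i - t i) = cls s - cls t) /\
      (forall s t, cls (fun i => s i * t i) = cls s * cls t),
      cls (fun i => 1) = 1 /\ forall s, cls (fun i => ddel (s i)) = ddel (cls s) &
      forall (J : finType) (u : J -> forall i, A i),
        U (fun i => lin_indep_over_Kp p (fun j => u j i)) ->
        lin_indep_over_Kp p (fun j => cls (u j))].
Proof.
have [ell hell] := ell_exists m_enum updel up_pchar.
exists (DField up_DF hell), upcls; split => //=.
- split; [exact: up_surj|exact: up_eq|].
  case=> [||||||| n l] x; rewrite /= ?up1 ?up0 ?upD ?upN ?upM ?upV ?updelE //.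
  by rewrite (up_ell _ _ hell).
- exact: up_sdc.
- by split; [exact: upB|exact: upM].
- by split; [exact: up1|move=> s; rewrite updelE].
- by move=> J u /up_lin_indep.
Qed.

End UltraproductOfFields.
End DFields.

(** * Realizing finite systems in separably differentially closed fields *)

Section Realization.
Variables (p : nat) (m : forall n : nat, 'I_(p ^ n) -> {ffun 'I_n -> 'I_p}).
Arguments m : clear implicits.
Hypothesis m_enum : forall n : nat, bijective (m n).

Local Notation dfield := (dfield m).
Local Notation del := (@ddel p m _).

(** An elementary extension, with those of its consequences listed in algebraic form that the
    constructions use. *)
Definition ext (N N' : dfield) (i : N -> N') : Prop :=
  [/\ dhom (@ddel p m N) (@ddel p m N') i,
      elementary (M := dstr N) (N := dstr N') i, sdc N -> sdc N' &
      forall (J : finType) (u : J -> N), lin_indep_over_Kp p u ->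
        lin_indep_over_Kp p (fun j => i (u j))].

Lemma ext_id (N : dfield) : ext (fun x : N => x). Proof. by split. Qed.

Lemma ext_comp (N N' N'' : dfield) (i : N -> N') (j : N' -> N'') : ext i -> ext j ->
  ext (fun x => j (i x)).
Proof.
move=> [[a1 a2 a3 a4] b c d] [[a1' a2' a3' a4'] b' c' d']; split.
- by split=> [|x y|x y|x]; rewrite ?a1 ?a1' ?a2 ?a2' ?a3 ?a3' ?a4 ?a4'.
- by move=> n phi v; rewrite b b'.
- by move=> /c /c'.
- by move=> J u /d /d'.
Qed.

Record upower (N : dfield) (I : Type) (U : (I -> Prop) -> Prop) (N' : dfield)
    (cls : (I -> N) -> N') : Prop := UPower {
  up_ultra : ultra U;
  up_isu : is_uprod U (A := fun _ => dstr N) (B := dstr N') cls;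
  up_sdcP : sdc N -> sdc N';
  upBP : forall s t, cls (fun i => s i - t i) = cls s - cls t;
  upMP : forall s t, cls (fun i => s i * t i) = cls s * cls t;
  up1P : cls (fun i => 1) = 1;
  upDP : forall s, cls (fun i => del (s i)) = del (cls s);
  upLI : forall (J : finType) (u : J -> I -> N),
    U (fun i => lin_indep_over_Kp p (fun j => u j i)) ->
    lin_indep_over_Kp p (fun j => cls (u j)) }.

(** The requirements are arbitrary predicates and not formulas; accordingly the conclusion speaks of
    the representative [s] at almost all indices and not of its class. *)
Lemma realize (N : dfield) (Fam : (N -> Prop) -> Prop) :
  (forall l : list (N -> Prop), exists a, forall Q, List.In Q l -> Fam Q -> Q a) ->
  exists (I : Type) (U : (I -> Prop) -> Prop) (N' : dfield) (cls : (I -> N) -> N')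
    (s : I -> N), upower U cls /\ forall Q, Fam Q -> U (fun i => Q (s i)).
Proof.
move=> /choice [s hs]; have [U [hU UL]] := ultra_list (N -> Prop).
have [N' [cls [h1 h2 [h3 h4] [h5 h6] h7]]] := ultraproduct m_enum (fun _ => N) hU.
exists (list (N -> Prop)), U, N', cls, s; split.
  split => // hN; apply: h2; have [[UT US _ _] _] := hU; exact: US UT.
move=> Q hQ; have [[_ US _ _] _] := hU; apply: US (UL Q) => l hl.
exact: hs.
Qed.

Section UPower.
Variables (N : dfield) (I : Type) (U : (I -> Prop) -> Prop) (N' : dfield)
  (cls : (I -> N) -> N').
Hypothesis hup : upower U cls.

Definition upi (x : N) : N' := cls (fun _ => x).

Lemma upcE s t : cls s = cls t <-> U (fun i => s i = t i).
Proof. by have [_ h _] := up_isu hup; apply: h. Qed.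

Lemma up0P : cls (fun _ => 0) = 0.
Proof.
by have := upBP hup (fun _ => 1) (fun _ => 1); rewrite !subrr.
Qed.

Lemma upNP s : cls (fun i => - s i) = - cls s.
Proof.
rewrite -[RHS]sub0r -up0P -(upBP hup); congr cls; apply/funext => i.
by rewrite sub0r.
Qed.

Lemma upDDP s t : cls (fun i => s i + t i) = cls s + cls t.
Proof.
rewrite -[cls t]opprK -upNP -(upBP hup); congr cls; apply/funext => i.
by rewrite opprK.
Qed.

Lemma upXP s k : cls (fun i => s i ^+ k) = cls s ^+ k.
Proof.
elim: k => [|k IH]; first by rewrite expr0 -(up1P hup); congr cls; apply/funext.
by rewrite exprS -IH -(upMP hup); congr cls; apply/funext => i; rewrite exprS.
Qed.

Lemma upsumP (J : Type) (r : seq J) (s : J -> I -> N) :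
  cls (fun i => \sum_(j <- r) s j i) = \sum_(j <- r) cls (s j).
Proof.
elim: r => [|j r IH].
  by rewrite big_nil -up0P; congr cls; apply/funext => i; rewrite big_nil.
by rewrite big_cons -IH -upDDP; congr cls; apply/funext => i; rewrite big_cons.
Qed.

Lemma upprodP (J : Type) (r : seq J) (s : J -> I -> N) :
  cls (fun i => \prod_(j <- r) s j i) = \prod_(j <- r) cls (s j).
Proof.
elim: r => [|j r IH].
  by rewrite big_nil -(up1P hup); congr cls; apply/funext => i; rewrite big_nil.
by rewrite big_cons -IH -(upMP hup); congr cls; apply/funext => i; rewrite big_cons.
Qed.

Lemma upiterP s k : iter k del (cls s) = cls (fun i => iter k del (s i)).
Proof. by elim: k => //= k ->; rewrite (upDP hup). Qed.

Lemma upi_ext : ext upi.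
Proof.
have hU := up_ultra hup; have [[UT US _ UN] _] := hU; split.
- split.
  + exact: (up1P hup).
  + by move=> x y; apply: (upBP hup).
  + by move=> x y; apply: (upMP hup).
  + by move=> x; apply: (upDP hup).
- move=> n phi v.
  rewrite (los hU (up_isu hup) (fun _ => ex_intro _ (0 : N) Logic.I) phi (fun j _ => v j)).
  split=> [h|h]; first by apply: US UT.
  by apply: contrapT => nh; apply: UN; apply: US h.
- exact: (up_sdcP hup).
- by move=> J u hu; apply: (upLI hup); apply: US UT.
Qed.

Lemma upmevalP n (f : {mpoly N[n]}) (g : {mpoly N'[n]}) (s : 'I_n -> I -> N) :
  (forall mm, g@_mm = upi f@_mm) ->
  g.@[fun l => cls (s l)] = cls (fun i => f.@[fun l => s l i]).
Proof.
move=> hg; have gf : {subset msupp g <= msupp f}.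
  move=> mm; apply: contraLR => /memN_msupp_eq0 h; rewrite mcoeff_msupp negbK hg h.
  by rewrite /upi up0P.
rewrite (mpoly_supersupp (msupp_uniq f) gf) raddf_sum /=.
have -> : (fun i => f.@[fun l => s l i]) = (fun i =>
    \sum_(k < size (msupp f)) f@_(nth 0%MM (msupp f) k) * \prod_l s l i ^+ nth 0%MM (msupp f) k l).
  by apply/funext => i; rewrite mevalE (big_nth 0%MM) big_mkord.
rewrite upsumP; apply: eq_bigr => k _; rewrite mevalZ mevalX hg (upMP hup) upprodP.
by congr (_ * _); apply: eq_bigr => l _; rewrite upXP.
Qed.

End UPower.

Lemma phom_comp (K : fieldType) (N N' : dfield) (R : K -> N -> Prop) (i : N -> N') :
  dhom (@ddel p m N) (@ddel p m N') i -> phom R ->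
  phom (fun x y => exists2 z, R x z & y = i z).
Proof.
move=> hi hR; have [h1 hB hM _] := hi; have rR := phom_rrel hR; split.
- split.
  + by exists 1; [apply: (rrel1 rR)|rewrite h1].
  + move=> x y _ _ [z hz ->] [z' hz' ->]; exists (z - z'); last by rewrite hB.
    exact: (rrelB rR).
  + move=> x y _ _ [z hz ->] [z' hz' ->]; exists (z * z'); last by rewrite hM.
    exact: (rrelM rR).
- by move=> _ [z hz ->]; rewrite (phom0 hR hz) (dhom0 hi).
- move=> x q [z hz _] x0; have [r hr _] := phomV hR hz x0.
  by exists (i r), r.
Qed.

Lemma phom_neq0 (K N : fieldType) (R : K -> N -> Prop) x y : phom R -> R x y ->
  (x == 0) = (y == 0).
Proof.
move=> hR h; apply/eqP/eqP => [x0|y0]; first by rewrite x0 in h; apply: phom0 h.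
apply/eqP; apply: contraT => x0; have [r _ e] := phomV hR h x0.
by move/eqP: e; rewrite y0 mul0r eq_sym oner_eq0.
Qed.

Lemma mrel_neq0 (K N : fieldType) (R : K -> N -> Prop) n (f : {mpoly K[n]})
    (g : {mpoly N[n]}) : phom R -> mrel R f g -> (f == 0) = (g == 0).
Proof.
move=> hR h; apply/eqP/eqP => [f0|g0]; first by rewrite f0 in h; apply: phom_mrel0 h.
apply/mpolyP => mm; rewrite mcoeff0; apply/eqP; rewrite (phom_neq0 hR (h mm)) g0.
by rewrite mcoeff0.
Qed.

Section Widening.
Variables (K : fieldType) (n : nat).

Lemma meval_mwiden (f : {mpoly K[n]}) (v : 'I_n.+1 -> K) :
  (mwiden f).@[v] = f.@[fun l => v (widen_ord (leqnSn n) l)].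
Proof.
have hf : forall mm, (fun _ : K => True) f@_mm by [].
move: f hf; apply: (mpoly_coef_ind (F := fun _ => True)).
- by move=> c _; rewrite mwidenC !mevalC.
- by rewrite mwiden0 !meval0.
- by rewrite mwiden1 !meval1.
- by move=> i; rewrite mwidenX mnmwiden1 !mevalXU.
- by move=> f g ef eg; rewrite mwidenD !mevalD ef eg.
- by move=> f g ef eg; rewrite mwidenM !mevalM ef eg.
Qed.

Lemma mwiden_max (f : {mpoly K[n]}) mm : (mwiden f)@_mm != 0 -> mm ord_max = 0%N.
Proof.
rewrite (@mwidenE _ _ f (msize f)) // raddf_sum /=; apply: contra_neq_eq => h.
rewrite big1 // => k _; rewrite mcoeffZ mcoeffX; case: eqP => [e|]; last by rewrite mulr0.
by rewrite -e mnmwiden_ordmax in h.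
Qed.

Lemma mderiv_mwiden_max (f : {mpoly K[n]}) : (mwiden f)^`M(ord_max) = 0.
Proof.
apply/mpolyP => mm; rewrite mcoeff_deriv mcoeff0.
have [-> |/mwiden_max] := eqVneq ((mwiden f)@_(mm + U_(ord_max))) 0; first by rewrite mul0rn.
by rewrite mnmDE mnm1E eqxx addn1.
Qed.

Lemma mderivXn (i : 'I_n) k : ('X_i ^+ k : {mpoly K[n]})^`M(i) = 'X_i ^+ k.-1 *+ k.
Proof.
elim: k => [|k IH]; first by rewrite expr0 -mpolyC1 mderivC mulr0n.
have e1 : ('X_i : {mpoly K[n]})^`M(i) = 1.
  rewrite mderivX mnm1E eqxx scale1r.
  have -> : (U_(i) - U_(i))%MM = 0%MM by apply/mnmP => j; rewrite mnmBE subnn mnm0E.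
  by rewrite mpolyX0.
rewrite exprS mderivM e1 mul1r IH /= mulrnAr; case: k {IH} => [|k]; first by rewrite expr0 mulr0n addr0.
by rewrite -exprS -mulrS.
Qed.

End Widening.

(* Adjoining [x_0, ..., x_n] and sending them to the successive derivatives of a
   generic solution in an ultrapower. *)
Lemma generic_step (N : dfield) (K : fieldType) (R : K -> N -> Prop) n (x : nat -> K)
    (E1 := fadj (rdom R) (fun l : 'I_n => x l)) : sdc N -> phom R ->
  malgindep (rdom R) (fun l : 'I_n => x l) -> sepalg E1 (x n) ->
  exists (N' : dfield) (i : N -> N') (R' : K -> N' -> Prop) (a : N'),
  [/\ ext i, phom R', forall u v, R u v -> R' u (i v),
      forall l, (l <= n)%N -> R' (x l) (iter l del a) &
      forall u, rdom R' u <-> fadj E1 (fun _ : unit => x n) u].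
Proof.
move=> hN hR hx hsep; have hE := rdom_subf hR.
have hE1 : subf E1 by apply: fadj_subf.
have rR := phom_rrel hR.
have dE1 : rdom (idrel E1) = E1.
  by apply/funext => u; apply/propext; split=> [[y []]|hu] //; exists u.
have [h [hhE hw hd h0 hmin]] : exists h : {poly K}, [/\ forall i, E1 h`_i,
    h.[x n] = 0, h^`().[x n] != 0, h != 0 & forall f : {poly K},
    (forall i, E1 f`_i) -> f.[x n] = 0 -> (size f < size h)%N -> f = 0].
  have [|h [h' [h1 h2 h3 h4 h5]]] := @sepalg_minpoly K K (idrel E1) (x n) (idrel_phom hE1).
    by rewrite dE1.
  rewrite dE1 in h5; exists h; split => // i; by have [] := h1 i.
set d := size h; pose xn (l : 'I_n) := x l.
have /choice [ab hab] : forall i : 'I_d, exists ab : {mpoly K[n]} * {mpoly K[n]},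
    [/\ coefin (rdom R) ab.1, coefin (rdom R) ab.2, ab.2.@[xn] != 0 &
        h`_i = ab.1.@[xn] / ab.2.@[xn]].
  by move=> i; have [a [b hb]] := fadj_frac hE (hhE i); exists (a, b).
(* A common denominator of the coefficients of [h]. It makes [q h] the value of a polynomial over
   the domain of [R] in [x 0, ..., x n]. *)
pose q : {mpoly K[n]} := \prod_i (ab i).2.
pose C (i : 'I_d) : {mpoly K[n]} := (ab i).1 * \prod_(j | j != i) (ab j).2.
have qR : coefin (rdom R) q by apply: coefin_prod => // i _; have [] := hab i.
have CR i : coefin (rdom R) (C i).
  apply: coefinM => //; first by have [] := hab i.
  by apply: coefin_prod => // j _; have [] := hab j.
have q0 : q.@[xn] != 0.
  by rewrite rmorph_prod; apply/prodf_neq0 => i _; have [] := hab i.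
have qC (i : 'I_d) : q.@[xn] * h`_i = (C i).@[xn].
  have [_ _ b0 ->] := hab i; rewrite /q (bigD1 i) //= !mevalM.
  by rewrite mulrC mulrA divfK.
have /choice [C' hC'] : forall i, exists g : {mpoly N[n]}, mrel R (C i) g.
  by move=> i; apply: (mrel_ex rR); apply: CR.
have [q' hq'] := mrel_ex rR qR.
pose poly_of (L : fieldType) (c : 'I_d -> {mpoly L[n]}) : {mpoly L[n.+1]} :=
  \sum_i mwiden (c i) * 'X_ord_max ^+ i.
pose xs (l : 'I_n.+1) := x l.
have evE (L : fieldType) (c : 'I_d -> {mpoly L[n]}) (v : nat -> L) :
    (poly_of L c).@[fun l : 'I_n.+1 => v l] =
    \sum_i (c i).@[fun l : 'I_n => v l] * v n ^+ i.
  rewrite raddf_sum; apply: eq_bigr => i _ /=.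
  by rewrite mevalM rmorphXn /= mevalXU meval_mwiden.
have derE (L : fieldType) (c : 'I_d -> {mpoly L[n]}) :
    (poly_of L c)^`M(ord_max) = \sum_i mwiden (c i) * ('X_ord_max ^+ i.-1 *+ i).
  rewrite raddf_sum; apply: eq_bigr => i _ /=.
  by rewrite mderivM mderiv_mwiden_max mul0r add0r mderivXn.
pose f := poly_of K C; pose f' := poly_of N C'.
have ff' : mrel R f f'.
  apply: (mrel_sum rR) => i _; apply: (mrelM rR); first exact: mrel_mwiden.
  elim: (val i) => [|k IH]; first by rewrite !expr0; apply: (mrel1 rR).
  by rewrite !exprS; apply: (mrelM rR) => //; apply: (mrelXm rR).
(* The separant is nonzero since its value at the [x l] is [q] times the derivative of [h] at
   [x n]. *)
have fd0 : f^`M(ord_max) != 0.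
  apply: contra_eq_neq (erefl (f^`M(ord_max)).@[xs]) => e.
  rewrite {1}e meval0 eq_sym derE raddf_sum /=.
  have -> : \sum_(i < d) (mwiden (C i) * ('X_ord_max ^+ i.-1 *+ i)).@[xs] =
      q.@[xn] * h^`().[x n].
    have -> : h^`().[x n] = \sum_(i < d) h`_i * (x n ^+ i.-1 *+ i).
      have {1}-> : h = \sum_(i < d) h`_i *: 'X^i by rewrite -poly_def coefK.
      rewrite linear_sum horner_sum; apply: eq_bigr => i _.
      by rewrite linearZ /= derivXn hornerZ hornerMn hornerXn.
    rewrite mulr_sumr; apply: eq_bigr => i _.
    by rewrite mulrA qC mevalM mevalMn rmorphXn /= mevalXU meval_mwiden.
  by rewrite mulf_neq0.
have f'd0 : f'^`M(ord_max) != 0 by rewrite -(mrel_neq0 hR (mrel_deriv rR _ ff')).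
pose jet (b : N) (l : 'I_n) := iter l del b.
(* A generic solution: it annihilates [f'] and no nonzero polynomial of order below [n] over the
   image of [R]. *)
pose Fam (Q : N -> Prop) := Q = (fun b => diff_eval del f' b = 0) \/
  exists g g', [/\ mrel R g g', g != 0 & Q = fun b => g'.@[jet b] != 0].
have [|I [U [N' [cls [s [hup hs]]]]]] := @realize N Fam.
  move=> l.
  (* Finitely many inequations are replaced by one, for the product, which is the form allowed by
     the axiom. *)
  have [G [G0 hG]] : exists G : {mpoly N[n]}, G != 0 /\ forall Q, List.In Q l ->
      forall g g', mrel R g g' -> g != 0 -> Q = (fun b => g'.@[jet b] != 0) ->
      forall b, G.@[jet b] != 0 -> Q b.
    elim: l => [|Q l [G [G0 hG]]]; first by exists 1; split => //; apply: oner_neq0.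
    have [[g [g' [h1 h2 h3]]]|nQ] := pselect (exists g g', [/\ mrel R g g', g != 0 &
        Q = fun b => g'.@[jet b] != 0]).
      exists (g' * G); split; first by rewrite mulf_neq0 // -(mrel_neq0 hR h1).
      move=> Q' /= [<-|hQ'] k k' hk k0 e b; rewrite mevalM mulf_eq0 negb_or => /andP [b1 b2].
        by rewrite h3.
      exact: hG hQ' _ _ hk k0 e _ b2.
    exists G; split => // Q' /= [<-|hQ'] k k' hk k0 e b; last exact: hG hQ' _ _ hk k0 e b.
    by case: nQ; exists k, k'.
  have [||||b [b1 b2]] := hN n.+1 f' (mwiden G) ord_max.
  - split; first exact: order_of_deriv.
    by move=> j _; rewrite -ltnS.
  - exact: f'd0.
  - by apply: contra_neq G0 => e; apply: (@inj_mwiden _ _); rewrite e mwiden0.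
  - move=> j [e he ej]; rewrite ltnNge; apply/negP => hj.
    have jm : j = ord_max by apply/val_inj/eqP; rewrite eqn_leq hj -ltnS ltn_ord.
    by move: ej; rewrite jm (@mwiden_max _ _ G) // -mcoeff_msupp.
  exists b => Q hQ [->//|[g [g' [h1 h2 h3]]]].
  apply: hG hQ _ _ h1 h2 h3 _ _; move: b2; rewrite /diff_eval meval_mwiden.
  by [].
have hext := upi_ext hup; have hU := up_ultra hup; have [[UT US UI UN] UC] := hU.
have hdh : dhom (@ddel p m N) (@ddel p m N') (upi cls) by case: hext.
pose a := cls s.
pose Ri x y := exists2 z, R x z & y = upi cls z.
have hRi : phom Ri := phom_comp hdh hR.
have jetE l : iter l del a = cls (fun i => iter l del (s i)) := upiterP hup s l.
pose ja (l : 'I_n) := iter l (@ddel p m N') a.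
have evU (g : {mpoly N[n]}) (g' : {mpoly N'[n]}) : (forall mm, g'@_mm = upi cls g@_mm) ->
    g'.@[ja] = cls (fun i => g.@[jet (s i)]).
  move=> hg; rewrite -(upmevalP hup (fun (l : 'I_n) i => iter l del (s i)) hg).
  by apply: meval_eq => l; rewrite /ja jetE.
have liftR (g : {mpoly K[n]}) (g' : {mpoly N'[n]}) : mrel Ri g g' ->
    exists2 g0, mrel R g g0 & forall mm, g'@_mm = upi cls g0@_mm.
  move=> hg; have [|g0 hg0] := @mrel_ex _ _ R rR n g.
    by move=> mm; have [z hz _] := hg mm; exists z.
  exists g0 => // mm; have [z hz ->] := hg mm.
  by rewrite (phom_fun hR hz (hg0 mm)).
have dRi : rdom Ri = rdom R.
  apply/funext => u; apply/propext; split=> [[y [z hz _]]|[z hz]]; first by exists z.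
  by exists (upi cls z), z.
have [||hR1 _] := @adjoin_mpoly K N' Ri n xn ja hRi.
- move=> g g' hg g0; have e : g = 0.
    apply: hx => // mm; have [z hz _] := hg mm; by exists z.
  by rewrite e in hg; rewrite (phom_mrel0 hRi hg) meval0.
- move=> g g' hg g0; have [g1 hg1 e] := liftR _ _ hg.
  have gn0 : g != 0 by apply: contraNneq g0 => ->; rewrite meval0.
  exists (g'.@[ja])^-1; rewrite mulfV // (evU _ _ e) -(up0P hup).
  apply/eqP => /(upcE hup) hz; apply: UN.
  have hg2 : U (fun i => g1.@[jet (s i)] != 0).
    by apply: (hs (fun b => g1.@[jet b] != 0)); right; exists g, g1.
  by apply: US (UI _ _ hz hg2) => i [->]; rewrite eqxx.
set R1 := adjoin Ri xn ja in hR1.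
have rR1 := phom_rrel hR1.
have dR1 u : rdom R1 u <-> E1 u by rewrite (rdom_adjoin u hR1) dRi.
have [h' hh'] : exists h', prel R1 h h'.
  by apply: (prel_ex rR1) => i; apply/dR1; apply: hhE.
have mR1 (g : {mpoly K[n]}) (g0 : {mpoly N[n]}) : mrel R g g0 ->
    R1 g.@[xn] (cls (fun i => g0.@[jet (s i)])).
  move=> hg; have [|g' hg'] := @mrel_ex _ _ Ri (phom_rrel hRi) n g.
    by move=> mm; exists (upi cls g0@_mm), g0@_mm.
  have [g1 hg1 e] := liftR _ _ hg'.
  have e01 : g1 = g0 by apply/mpolyP => mm; apply: (phom_fun hR (hg1 mm)).
  rewrite -e01 -(evU _ _ e); apply: (mrel_meval rR1) => [mm|l].
    exact: adj_base.
  exact: (@adj_gen _ _ Ri _ xn ja l).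
(* It is [q h] that comes from [f']; the image of [q] is nonzero and can be multiplied in. *)
have hroot : h'.[iter n del a] = 0.
  have sh : (size h' <= d)%N := phom_prel_size hR1 hh'.
  set qa := cls (fun i => q'.@[jet (s i)]).
  have Rq : R1 q.@[xn] qa := mR1 _ _ hq'.
  have qa0 : qa != 0 by rewrite -(phom_neq0 hR1 Rq).
  apply: (mulfI qa0); rewrite mulr0 (horner_coef_wide _ sh) mulr_sumr.
  transitivity (\sum_(i < d) cls (fun k => (C' i).@[jet (s k)] * iter n del (s k) ^+ i)).
    apply: eq_bigr => i _; rewrite mulrA (upMP hup) (upXP hup) -jetE; congr (_ * _).
    apply: (phom_fun hR1 (x := q.@[xn] * h`_i)); first exact: (rrelM rR1).
    by rewrite qC; apply: mR1.
  rewrite -(upsumP hup) -(up0P hup); apply/(upcE hup).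
  have hU0 : U (fun i => diff_eval del f' (s i) = 0).
    by apply: (hs (fun b => diff_eval del f' b = 0)); left.
  apply: US hU0 => i; rewrite /diff_eval.
  rewrite (_ : f'.@[_] = \sum_j (C' j).@[fun l : 'I_n => iter l del (s i)] * iter n del (s i) ^+ j) //.
  exact: (evE N C' (fun l => iter l del (s i))).
have [|hR' _] := adjoin_root hR1 hh' hw hroot h0.
  by move=> g hg; apply: hmin => j; apply/dR1.
exists N', (upi cls), (adjoin R1 (fun _ : unit => x n) (fun _ => iter n del a)), a.
split => //.
- by move=> u v huv; apply: adj_base; apply: adj_base; exists v.
- move=> l; rewrite leq_eqVlt => /orP [/eqP ->|hl].
    exact: (@adj_gen _ _ R1 unit (fun _ => x n) (fun _ => iter n del a) tt).
  by apply: adj_base; apply: (@adj_gen _ _ Ri _ xn ja (Ordinal hl)).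
- move=> u; rewrite (rdom_adjoin u hR').
  by have -> : rdom R1 = E1 by apply/funext => y; apply/propext.
Qed.

End Realization.

Lemma rmorph_derivation (K L : fieldType) (j : {rmorphism K -> L}) (d : K -> K) :
  derivation d -> exists d', pder (fun y => exists x, y = j x) d' /\
    forall x, d' (j x) = j (d x).
Proof.
move=> hd; have pd := derivation_pder hd; have j_inj : injective j := fmorph_inj j.
have /choice [f hf] : forall x : L, exists y : L, forall u, x = j u -> y = j (d u).
  move=> x; have [[u ->]|h] := pselect (exists u, x = j u).
    by exists (j (d u)) => v /j_inj ->.
  by exists 0 => u hu; case: h; exists u.
have fE u : f (j u) = j (d u) by apply: hf.
exists f; split => //; split; first split.
- by exists 1; rewrite rmorph1.
- by move=> _ _ [u ->] [v ->]; exists (u - v); rewrite rmorphB.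
- by move=> _ _ [u ->] [v ->]; exists (u * v); rewrite rmorphM.
- by move=> _ [u ->]; exists u^-1; rewrite fmorphV.
- by move=> _ _ [u ->] [v ->]; rewrite -rmorphB !fE (pderB pd) // rmorphB.
- by move=> _ _ [u ->] [v ->]; rewrite -rmorphM !fE (pderM pd) // rmorphD !rmorphM.
Qed.

(** * Realization of finite systems through cyclic vectors *)

Section Embedding.
Variables (p : nat) (m : forall n : nat, 'I_(p ^ n) -> {ffun 'I_n -> 'I_p}).
Arguments m : clear implicits.
Hypothesis m_enum : forall n : nat, bijective (m n).

Local Notation dfield := (dfield m).
Local Notation del := (@ddel p m _).

(** The axiom in order 0 with [g = 1]: a separably differentially closed field is separably
    closed. *)
Lemma sdc_root (N : dfield) (h : {poly N}) : sdc N -> h^`() != 0 ->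
  exists b, h.[b] = 0.
Proof.
move=> hN hd; pose f : {mpoly N[1]} := \sum_(i < size h) h`_i *: 'X_ord0 ^+ i.
have fE (v : 'I_1 -> N) : f.@[v] = h.[v ord0].
  rewrite raddf_sum horner_coef; apply: eq_bigr => i _ /=.
  by rewrite mevalZ rmorphXn /= mevalXU.
have dE (v : 'I_1 -> N) : f^`M(ord0).@[v] = h^`().[v ord0].
  have {1}-> : h = \sum_(i < size h) h`_i *: 'X^i by rewrite -poly_def coefK.
  rewrite (raddf_sum (mderiv ord0)) (raddf_sum (meval v)) linear_sum horner_sum; apply: eq_bigr => i _ /=.
  by rewrite derivZ derivXn hornerZ hornerMn hornerXn mderivZ mderivXn mevalZ mevalMn rmorphXn /= mevalXU.
have sep : f^`M(ord0) != 0.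
  apply: contra_neq hd => e; apply/polyP => i; rewrite coef0.
  rewrite coef_deriv; have /mpolyP/(_ [multinom i | _ < 1]) := e.
  rewrite mcoeff_deriv mcoeff0 mnmE.
  have fc j : (f)@_[multinom j | _ < 1] = h`_j.
    rewrite raddf_sum /=.
    have mE (k : nat) : ('X_ord0 ^+ k : {mpoly N[1]})@_[multinom j | _ < 1] = (k == j)%:R.
      rewrite mcoeffXn; congr (nat_of_bool _)%:R; apply/eqP/eqP => [/mnmP/(_ ord0)|->].
        by rewrite mulmnE mnm1E eqxx mul1n mnmE.
      by apply/mnmP => l; rewrite mulmnE mnm1E !mnmE (ord1 l) eqxx mul1n.
    under eq_bigr do rewrite mcoeffZ mE.
    have [hj|hj] := ltnP j (size h).
      rewrite (bigD1 (Ordinal hj)) //= eqxx mulr1 big1 ?addr0 // => k.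
      by rewrite -val_eqE /= => /negPf ->; rewrite mulr0.
    rewrite nth_default // big1 // => k _.
    by rewrite ltn_eqF ?mulr0 // (leq_trans (ltn_ord k)).
  have -> : ([multinom i | _ < 1] + U_(ord0))%MM = [multinom i.+1 | _ < 1].
    by apply/mnmP => l; rewrite mnmDE mnm1E !mnmE (ord1 l) eqxx addn1.
  by rewrite fc.
have [|||b [hb _]] := hN 1%N f 1 ord0 _ sep.
- split; first exact: order_of_deriv.
  by move=> j _; rewrite (ord1 j).
- exact: oner_neq0.
- move=> j [e]; rewrite -mpolyC1 msuppC oner_eq0 inE => /eqP ->.
  by rewrite mnm0E.
by exists b; move: hb; rewrite /diff_eval fE.
Qed.

Lemma tower_iso (N : dfield) (K : fieldType) us (R : K -> N -> Prop) : sdc N ->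
  phom R -> tower (rdom R) us -> exists R' : K -> N -> Prop,
    [/\ phom R', forall x y, R x y -> R' x y &
        forall x, rdom R' x <-> fadjs (rdom R) us x].
Proof.
move=> hN; elim: us R => [|u us IH] R hR /=; first by exists R.
move=> [hu]; have [h [h' [hh hw hd h0 min]]] := sepalg_minpoly hR hu.
have rR := phom_rrel hR.
have hd' : h'^`() != 0.
  apply: contraNneq hd => e; suff -> : h^`() = 0 by rewrite horner0.
  apply/polyP => i; rewrite coef0; apply/eqP.
  by rewrite (phom_neq0 hR (prel_deriv rR hh i)) e coef0.
have [b hb] := sdc_root hN hd'.
have [hA _] := adjoin_root hR hh hw hb h0 min.
have dA : rdom (adjoin R (fun _ : unit => u) (fun _ => b)) = fadj (rdom R) (fun _ : unit => u).
  by apply/funext => x; apply/propext; apply: rdom_adjoin.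
rewrite -dA => ht; have [R' [h1 h2 h3]] := IH _ hA ht.
exists R'; split; first exact: h1.
  by move=> x y hxy; apply: h2; apply: adj_base.
by move=> x; rewrite h3 dA.
Qed.

(** The pairs at which [R] intertwines [D] with the derivation of [N]. They form a partial
    homomorphism again, so compatibility needs checking on generators only. *)
Definition dpairs (N : dfield) (K : fieldType) (R : K -> N -> Prop) (D : K -> K)
  (x : K) (y : N) : Prop := R x y /\ R (D x) (del y).

Lemma dpairs_phom (N : dfield) (K : fieldType) (R : K -> N -> Prop) (D : K -> K) :
  phom R -> pder (rdom R) D -> phom (dpairs R D).
Proof.
move=> hR hD; have rR := phom_rrel hR.
have hde := derivation_pder (dder N).
split; first split.
- by split; [apply: (rrel1 rR)|rewrite (pder1 hD) (pder1 hde); apply: (rrel0 rR)].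
- move=> x y q r [h1 h2] [h3 h4]; split; first exact: (rrelB rR).
  rewrite (pderB hD) ?(pderB hde) //; [exact: (rrelB rR)|by exists q|by exists r].
- move=> x y q r [h1 h2] [h3 h4]; split; first exact: (rrelM rR).
  rewrite (pderM hD) ?(pderM hde) //; [|by exists q|by exists r].
  by apply: (rrelD rR); apply: (rrelM rR).
- by move=> q [h _]; exact: (phom0 hR h).
- move=> x q [h1 h2] x0; have [r hr e] := phomV hR h1 x0; exists r; split => //.
  have q0 : q != 0 by rewrite -(phom_neq0 hR h1).
  have er : r = q^-1 by apply: (mulfI q0); rewrite e mulfV.
  rewrite (pderV hD) ?er ?(pderV hde) //; last by exists q.
  apply: (rrelM rR); first exact: (rrelN rR).
  have hx2 : R (x ^+ 2) (q ^+ 2) by apply: (rrelX rR).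
  by apply: (phomVr hR hx2); rewrite mulfV // expf_neq0.
Qed.

(** Differentiating the polynomial of a separable algebraic element expresses its derivative through
    those of the coefficients. The minimal polynomial is taken over the domain of [dpairs], so this
    expression corresponds on the two sides. *)
Lemma tower_compatible (N : dfield) (K : fieldType) (R : K -> N -> Prop) (D : K -> K)
    (T := dpairs R D) us F :
  phom R -> pder (rdom R) D -> (forall x, rdom R x -> rdom R (D x)) ->
  subf F -> (forall x, F x -> rdom T x) -> (forall u, u \in us -> rdom R u) ->
  tower F us -> forall u, u \in us -> rdom T u.
Proof.
move=> hR hD sD; have rR := phom_rrel hR.
have hde := derivation_pder (dder N).
have hT : phom T := dpairs_phom hR hD.
elim: us F => // u us IH F hF FT uR /= [hu ht].
have uT : rdom T u.
  have hu' : sepalg (rdom T) u by have [h [h1 h2 h3]] := hu; exists h; split => // i; apply: FT.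
  have [h [h' [hh hw hd h0 min]]] := sepalg_minpoly hT hu'.
  have [v hv] : rdom R u by apply: uR; rewrite inE eqxx.
  exists v; split => //.
  have hhR : prel R h h' by move=> i; have [] := hh i.
  have hv0 : h'.[v] = 0 by apply: (phom0 hR); rewrite -hw; apply: (prel_horner rR).
  have hdR : R h^`().[u] h'^`().[v] by apply: (prel_horner rR) => //; apply: prel_deriv.
  have hd' : h'^`().[v] != 0 by rewrite -(phom_neq0 hR hdR).
  have drule (L : fieldType) (E : L -> Prop) (d : L -> L) (g : {poly L}) (w : L) :
      pder E d -> (forall i, E g`_i) -> E w -> g.[w] = 0 -> g^`().[w] != 0 ->
      d w = - (\sum_(i < size g) d g`_i * w ^+ i) / g^`().[w].
    move=> hd1 hg hw' gw gd.
    have rD := phom_rrel (drel_phom hd1).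
    have [G hG] : exists G, prel (drel E d) g G.
      by apply: (prel_ex rD) => i; exists (g`_i, d g`_i).
    have [_] : drel E d g.[w] G.[(w, d w)] by apply: (prel_horner rD).
    rewrite (drel_horner hd1 _ _ hG) gw (pder0 hd1) => -[] /eqP.
    by rewrite addrC addr_eq0 => /eqP <-; rewrite mulrC mulKf.
  have hRu : rdom R u by exists v.
  rewrite (drule _ _ _ _ _ hD (fun i => ex_intro _ _ (hhR i)) hRu hw hd).
  rewrite (drule _ _ _ _ _ hde (fun _ => I) I hv0 hd').
  apply: (rrelM rR); last first.
    by apply: (phomVr hR hdR); rewrite mulfV.
  apply: (rrelN rR); have sh : (size h' <= size h)%N := phom_prel_size hR hhR.
  have -> : \sum_(i < size h') del h'`_i * v ^+ i = \sum_(i < size h) del h'`_i * v ^+ i.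
    rewrite (big_ord_widen _ (fun i => del h'`_i * v ^+ i) sh) big_mkcond /=.
    apply: eq_bigr => i _; case: ltnP => // hi.
    by rewrite nth_default // (pder0 hde) mul0r.
  apply: (rrel_sum rR) => i _; apply: (rrelM rR); first by have [] := hh i.
  exact: (rrelX rR).
have IH' := IH (fadj F (fun _ : unit => u)) (fadj_subf _ hF) _ _ ht.
move=> w; rewrite inE => /orP [/eqP -> //|hw]; apply: IH' => //.
  by apply: fadj_min => //; apply: rdom_subf.
by move=> y hy; apply: uR; rewrite inE hy orbT.
Qed.

(** Compatibility is obtained for [D], which agrees with the given derivation at [w k] as soon as
    that derivative is one of the listed elements. *)
Theorem generic_realization (N : dfield) (M K : fieldType) (j : {rmorphism M -> K})
    (dM : M -> M) (R : M -> N -> Prop) q (w : 'I_q -> M) (c : 'I_(q * q.+1).+1 -> K) :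
  sdc N -> p \in [pchar M] -> derivation dM -> phom R ->
  (forall x y, R x y -> R (dM x) (del y)) -> malgindep (fun y => exists x, y = j x) c ->
  good_over p (fadj (fun y => exists2 x, rdom R x & y = j x) c) ->
  exists (N' : dfield) (i : N -> N') (R' : M -> N' -> Prop),
  [/\ ext i, phom R', forall x y, R x y -> R' x (i y) &
      forall k, (exists l, w l = dM (w k)) ->
        exists2 z, R' (w k) z & R' (dM (w k)) (del z)].
Proof.
move=> hN hp hdM hR Rd alg Egood.
set r := (q * q.+1).+1 in c alg Egood.
have hpK : p \in [pchar K] by rewrite (fmorph_pchar j).
have j_inj : injective j := fmorph_inj j.
have pM := derivation_pder hdM.
have rR := phom_rrel hR.
pose RK x y := exists2 u, x = j u & R u y.
have hRK : phom RK.
  split; first split.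
  - by exists 1; rewrite ?rmorph1 //; apply: (rrel1 rR).
  - move=> x y z t [u -> h1] [v -> h2]; exists (u - v); first by rewrite rmorphB.
    exact: (rrelB rR).
  - move=> x y z t [u -> h1] [v -> h2]; exists (u * v); first by rewrite rmorphM.
    exact: (rrelM rR).
  - move=> y [u e hu]; apply: (phom0 hR).
    by have -> : 0 = u by apply: j_inj; rewrite -e rmorph0.
  - move=> x y [u -> hu]; rewrite fmorph_eq0 => u0; have [z hz _] := phomV hR hu u0.
    by exists z; exists u^-1; rewrite ?fmorphV.
pose E := rdom RK.
have EE : E = (fun y => exists2 x, rdom R x & y = j x).
  apply/funext => x; apply/propext; split=> [[y [u -> hu]]|[u [y hu] ->]].
    by exists u => //; exists y.
  by exists y, u.
have hE : subf E := rdom_subf hRK.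
have [deK [pJ hdeK]] := rmorph_derivation j hdM.
pose J y := exists x, y = j x; have hJ : subf J := pder_subf pJ.
pose wK k := j (w k).
have GJ x : fadj E wK x -> J x.
  apply: fadj_min => //; last by move=> k; exists (w k).
  by move=> y; rewrite EE => -[u _ ->]; exists u.
have pG : pder (fadj E wK) deK by apply: (pder_sub _ GJ pJ); apply: fadj_subf.
have sE x : E x -> E (deK x).
  rewrite EE => -[u [y hu] ->]; rewrite hdeK; exists (dM u) => //.
  by exists (del y); apply: Rd.
have alg' : malgindep (fadj E wK) c.
  by move=> f hf; apply: alg => mm; apply: GJ.
rewrite -EE in Egood.
have [m0 [v [D /= [hv tw [pD sD] [DE Dc] [Dv Dw]]]]] := cyclic_vector hpK hE pG sE alg' Egood.
pose cn (i : nat) := if (i < (q * q.+1).+1)%N then c (inord i) else 0.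
have {}Dc : forall i, D (cn i) = cn i.+1 := Dc.
have cnE : (fun l : 'I_r => cn l) = c.
  by apply/funext => l; rewrite /cn ltn_ord inord_val.
have cn0 : cn r = 0 by rewrite /cn ltnn.
(* The jets go to the derivatives of a generic solution of the linear equation [x_r = 0]: with
   [cn r = 0] the required separable polynomial is [X]. *)
have [||N1 [i1 [R1 [a1 [e1 hR1 RR1 R1c dR1]]]]] :=
    @generic_step p m m_enum N K RK r cn hN hRK.
- by rewrite cnE => f hf; apply: alg' => mm; apply: fadj_base; apply: hf.
- rewrite cn0 cnE; exists 'X; split; rewrite ?hornerX // ?derivX ?hornerC ?oner_neq0 //.
  move=> i; rewrite coefX; case: eqP => _.
    by apply: subf1; apply: fadj_subf.
  by apply: subf0; apply: fadj_subf.
have hE1 : subf (fadj E c) := fadj_subf c hE.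
have {}dR1 : rdom R1 = fadj E c.
  apply/funext => u; apply/propext; rewrite dR1 cnE cn0; split; last by apply: fadj_base.
  by apply: fadj_min => // _; apply: subf0.
(* Next the cyclic vector, with [v m0] separable algebraic over the preceding derivatives; the [w k]
   then follow by adjoining roots. *)
have [|||N2 [i2 [R2 [a2 [e2 hR2 RR2 R2v dR2]]]]] :=
    @generic_step p m m_enum N1 K R1 m0 v _ hR1.
- by case: e1 => _ _ + _; apply.
- by rewrite dR1.
- by rewrite dR1; case: tw.
have hE2 : subf (fadj (fadj E c) (fun l : 'I_m0 => v l)) by apply: fadj_subf.
have {}dR2 : rdom R2 = fadj (fadj (fadj E c) (fun l : 'I_m0 => v l)) (fun _ : unit => v m0).
  by apply/funext => u; apply/propext; rewrite dR2 dR1.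
have [||Rf [hRf R2f dRf]] := @tower_iso N2 K (codom wK) R2 _ hR2.
- by case: e2 => _ _ + _; apply; case: e1 => _ _ + _; apply.
- by rewrite dR2; case: tw.
have {}dRf : rdom Rf = fadjs (fadj (fadj E c) (fun l : 'I_m0 => v l)) (v m0 :: codom wK).
  by apply/funext => u; apply/propext; rewrite dRf dR2.
have {}pD : pder (rdom Rf) D by rewrite dRf.
have {}sD : forall x, rdom Rf x -> rdom Rf (D x) by rewrite dRf.
have Rff x y : R x y -> Rf (j x) (i2 (i1 y)).
  by move=> h; apply: R2f; apply: RR2; apply: RR1; exists x.
have [d1 _ _ _] := e1; have [d2 _ _ _] := e2.
have d1d x : i1 (del x) = del (i1 x) by case: d1.
have d2d x : i2 (del x) = del (i2 x) by case: d2.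
have hT := dpairs_phom hRf pD.
have Tin x : fadj (fadj E c) (fun l : 'I_m0 => v l) x -> rdom (dpairs Rf D) x.
  apply: fadj_min; first exact: rdom_subf.
    apply: fadj_min; first exact: rdom_subf.
      move=> y Ey; have := Ey; rewrite EE => -[u [z hz] e]; rewrite {}e in Ey *.
      exists (i2 (i1 z)); split; first exact: Rff.
      by rewrite DE // hdeK -d2d -d1d; apply: Rff; apply: Rd.
    move=> l; have -> : c l = cn l by rewrite -cnE.
    exists (i2 (iter l del a1)); split.
      by apply: R2f; apply: RR2; apply: R1c; apply: ltnW.
    by rewrite Dc -d2d -iterS; apply: R2f; apply: RR2; apply: R1c.
  move=> l; exists (iter l del a2); split; first by apply: R2f; apply: R2v; apply: ltnW.
  by rewrite Dv // -iterS; apply: R2f; apply: R2v.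
have key := tower_compatible hRf pD sD hE2 Tin.
exists N2, (fun x => i2 (i1 x)), (fun x y => Rf (j x) y); split.
- exact: ext_comp e1 e2.
- have rRf := phom_rrel hRf; split; first split.
  + by rewrite rmorph1; apply: (rrel1 rRf).
  + by move=> x y z t h1 h2; rewrite rmorphB; apply: (rrelB rRf).
  + by move=> x y z t h1 h2; rewrite rmorphM; apply: (rrelM rRf).
  + by move=> z; rewrite rmorph0; apply: (phom0 hRf).
  + move=> x z h1 x0; have [|t ht _] := phomV hRf h1; first by rewrite fmorph_eq0.
    by exists t; rewrite fmorphV.
- exact: Rff.
- move=> k [l hl].
  have wk : wK k \in v m0 :: codom wK by rewrite inE codom_f orbT.
  have [|z [hz1 hz2]] := key (v m0 :: codom wK) _ tw _ wk.
    by move=> u hu; rewrite dRf; apply: fadjs_mem.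
  exists z => //; move: hz2; rewrite Dw; first by rewrite hdeK.
  by rewrite hdeK -hl; apply: (@fadj_gen _ _ _ wK).
Qed.

Theorem finite_realization (N : dfield) (M : fieldType) (dM : M -> M)
    (R : M -> N -> Prop) q (w : 'I_q -> M) : sdc N -> p \in [pchar M] ->
  derivation dM -> phom R -> (forall x y, R x y -> R (dM x) (del y)) ->
  good2 p R -> exists (N' : dfield) (i : N -> N') (R' : M -> N' -> Prop),
  [/\ ext i, phom R', forall x y, R x y -> R' x (i y) &
      forall k, (exists l, w l = dM (w k)) ->
        exists2 z, R' (w k) z & R' (dM (w k)) (del z)].
Proof.
move=> hN hp hdM hR Rd good.
apply: (@generic_realization N M _ (ffc M (q * q.+1).+1) dM R q w (@ffx M _) hN hp hdM hR Rd).
  exact: ff_algindep.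
by apply: ff_good => //; [apply: rdom_subf|apply: good2_over].
Qed.
End Embedding.

(** * Adjoining constants *)

Section Constants.
Variables (p : nat) (m : forall n : nat, 'I_(p ^ n) -> {ffun 'I_n -> 'I_p}).
Arguments m : clear implicits.
Hypothesis m_enum : forall n : nat, bijective (m n).

Local Notation dfield := (dfield m).
Local Notation del := (@ddel p m _).

Definition rran (K N : fieldType) (R : K -> N -> Prop) (y : N) : Prop := exists x, R x y.

Lemma rran_subf (K N : fieldType) (R : K -> N -> Prop) : phom R -> subf (rran R).
Proof.
move=> hR; have rR := phom_rrel hR; split.
- by exists 1; apply: (rrel1 rR).
- by move=> x y [u hu] [v hv]; exists (u - v); apply: (rrelB rR).
- by move=> x y [u hu] [v hv]; exists (u * v); apply: (rrelM rR).
- move=> y [u hu]; have [->|y0] := eqVneq y 0.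
    by rewrite invr0; exists 0; apply: (rrel0 rR).
  by exists u^-1; apply: (phomVr hR hu); rewrite mulfV.
Qed.

Lemma good2_rran (K N : fieldType) (R : K -> N -> Prop) : phom R -> good2 p R ->
  good_over p (rran R).
Proof.
move=> hR good n e /choice [x hx]; have rR := phom_rrel hR.
have [|s [kap [kap' [al [h1 h2 h3 h4 h5]]]]] := good n x.
  by move=> i; exists (e i).
have [al' hal] : exists al' : 'I_n -> 'I_s -> N, forall i j, R (al i j) (al' i j).
  have /choice [f hf] : forall ij : 'I_n * 'I_s, exists y, R (al ij.1 ij.2) y.
    by move=> [i j]; apply: h2.
  by exists (fun i j => f (i, j)) => i j; apply: (hf (i, j)).
exists s, kap', al'; split => //.
- by move=> j; exists (kap j).
- by move=> i j; exists (al i j).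
move=> i; apply: (phom_fun hR (hx i)); rewrite h5.
by apply: (rrel_sum rR) => j _; apply: (rrelM rR) => //; apply: (rrelX rR).
Qed.

(** Of [n + 1] constants independent over p-th powers, not all lie in the span of [n] elements: a
    left kernel vector of the matrix of p-th roots of coordinates would give a relation. *)
Lemma span_avoid (N : dfield) n (e : 'I_n -> N) : exists a : N,
  del a = 0 /\ ~ exists y : 'I_n -> N, a = \sum_i y i ^+ p * e i.
Proof.
have hp := dpchar N; have [_ _ hinf] := ddf N.
have [u [cu iu]] := hinf n.+1.
apply: contrapT => H.
have /choice [y hy] : forall j, exists y : 'I_n -> N, u j = \sum_i y i ^+ p * e i.
  by move=> j; apply: contrapT => nh; apply: H; exists (u j); split => //; apply: cu.
pose Y := \matrix_(j, i) y j i.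
have : (0 < \rank (kermx Y))%N.
  by rewrite mxrank_ker subn_gt0; apply: leq_ltn_trans (rank_leq_col Y) _.
rewrite lt0n mxrank_eq0 => /rowV0Pn [v /sub_kermxP vY v0].
have [j hj] := matrix0Pn _ v0; move: hj => [k]; rewrite (ord1 j) => /negP; apply.
rewrite -(expp_eq0 hp); apply/eqP; apply: (iu (fun k => v 0 k)).
under eq_bigr => j' _ do rewrite hy mulr_sumr.
rewrite exchange_big big1 //= => i _.
under eq_bigr => j' _ do rewrite mulrA -exprMn.
rewrite -mulr_suml -(expp_sum hp); suff -> : \sum_i0 v 0 i0 * y i0 i = 0.
  by rewrite expr0n (gtn_eqF (prime_gt0 (pcharf_prime hp))) mul0r.
have /matrixP/(_ 0 i) := vY; rewrite !mxE => e0; rewrite -[RHS]e0.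
by apply: eq_bigr => l _; rewrite !mxE.
Qed.

(* A constant outside the span over the p-th powers of finitely many elements
   exists because the degree [[C_N : N^p]] is infinite. *)
Lemma generic_constant (N : dfield) (F : N -> Prop) :
  exists (N' : dfield) (i : N -> N') (b : N'),
  [/\ ext i, del b = 0 & ~ pspan p (fun y => exists2 x, F x & y = i x) b].
Proof.
pose Fam (Q : N -> Prop) := exists n (e : 'I_n -> N), (forall i, F (e i)) /\
  Q = fun a => del a = 0 /\ ~ exists y : 'I_n -> N, a = \sum_i y i ^+ p * e i.
have [|I [U [N' [cls [s [hup hs]]]]]] := realize m_enum (Fam := Fam).
  move=> l; suff [n [e he]] : exists n (e : 'I_n -> N), forall Q, List.In Q l -> Fam Q ->
      forall a, del a = 0 -> (~ exists y : 'I_n -> N, a = \sum_i y i ^+ p * e i) -> Q a.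
    by have [a [a0 ha]] := span_avoid e; exists a => Q hQ fQ; apply: he.
  elim: l => [|Q l [n [e he]]]; first by exists 0%N, (fun _ => 0).
  have [[n1 [e1 [h1 ->]]]|nQ] := pselect (Fam Q); last first.
    by exists n, e => Q' /= [<- //|]; apply: he.
  pose ee (i : 'I_(n + n1)) := match split i with inl k => e k | inr k => e1 k end.
  have sumE (y : 'I_(n + n1) -> N) : \sum_i y i ^+ p * ee i =
      \sum_i y (lshift n1 i) ^+ p * e i + \sum_i y (rshift n i) ^+ p * e1 i.
    rewrite big_split_ord /=; congr (_ + _); apply: eq_bigr => k _; rewrite /ee.
      by rewrite (unsplitK (inl k)).
    by rewrite (unsplitK (inr k)).
  have z0 : (0 : N) ^+ p = 0.
    by rewrite expr0n (gtn_eqF (prime_gt0 (pcharf_prime (dpchar N)))).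
  exists (n + n1)%N, ee => Q' /= [<- _|hQ' fQ'] a a0 ha.
    split => // -[y hy]; apply: ha.
    exists (fun i => match split i with inl k => 0 | inr k => y k end); rewrite sumE hy.
    rewrite [X in _ = X + _]big1 ?add0r => [|k _]; last by rewrite (unsplitK (inl k)) z0 mul0r.
    by apply: eq_bigr => k _; rewrite (unsplitK (inr k)).
  apply: he => // -[y hy]; apply: ha.
  exists (fun i => match split i with inl k => y k | inr k => 0 end); rewrite sumE hy.
  rewrite [X in _ = _ + X]big1 ?addr0 => [|k _]; last by rewrite (unsplitK (inr k)) z0 mul0r.
  by apply: eq_bigr => k _; rewrite (unsplitK (inl k)).
have hU := up_ultra hup; have [[UT US UI UN] UC] := hU; have [isu _ _] := up_isu hup.
exists N', (upi cls), (cls s); split; first exact: upi_ext hup.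
  rewrite -(upDP hup) -(up0P hup); apply/(upcE hup).
  (* The requirement for the empty family suffices to see that the class is a constant. *)
  pose Q (a : N) := del a = 0 /\ ~ exists y : 'I_0 -> N, a = \sum_i y i ^+ p * (fun _ : 'I_0 => 0) i.
  have /hs : Fam Q by exists 0%N, (fun _ => 0); split => // -[].
  by apply: US => i [].
move=> [n [y [e [/(_ _)/cid2-/all_sig2 [x Fx ex] hb]]]].
have /choice [t ht] : forall k, exists t, y k = cls t by move=> k; apply: isu.
pose Q (a : N) := del a = 0 /\ ~ exists y : 'I_n -> N, a = \sum_i y i ^+ p * x i.
have /hs hQ : Fam Q by exists n, x.
have h0 : U (fun i => s i = \sum_k t k i ^+ p * x k).
  apply/(upcE hup); rewrite hb (upsumP hup); apply: eq_bigr => k _.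
  by rewrite (upMP hup) (upXP hup) ht ex.
apply: UN; apply: US (UI _ _ hQ h0) => i [[_ h]] e0; apply: h.
by exists (fun k => t k i).
Qed.

Lemma adjoin_stable (N : dfield) (M : fieldType) (dM : M -> M) (R : M -> N -> Prop)
    (I : Type) (w : I -> M) (v : I -> N) : derivation dM -> phom (adjoin R w v) ->
  (forall x y, R x y -> R (dM x) (del y)) ->
  (forall i, adjoin R w v (dM (w i)) (del (v i))) ->
  forall x y, adjoin R w v x y -> adjoin R w v (dM x) (del y).
Proof.
move=> hdM hA hR hw x y hxy.
have hD : pder (rdom (adjoin R w v)) dM.
  exact: (pder_sub (rdom_subf hA) _ (derivation_pder hdM)).
have hT := dpairs_phom hA hD.
suff [] : dpairs (adjoin R w v) dM x y by [].
apply: adjoin_min hxy; first exact: phom_rrel hT.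
- by move=> x1 q r; apply: (phomVr hT).
- by move=> x1 q h; split; apply: adj_base => //; apply: hR.
- by move=> i; split => //; apply: adj_gen.
Qed.

Definition good_system (M : dfield) (N : dfield) (R : M -> N -> Prop) : Prop :=
  [/\ phom R, forall x y, R x y -> R (del x) (del y) & good2 p R].

Lemma good_system_ext (M N N' : dfield) (i : N -> N') (R : M -> N -> Prop) :
  ext i -> good_system R -> good_system (fun x y => exists2 z, R x z & y = i z).
Proof.
move=> [hi _ _ hl] [hR sR gR]; split.
- exact: phom_comp.
- by move=> x _ [z hz ->]; exists (del z); [apply: sR|case: hi].
move=> n e he; have [|s [kap [kap' [al [h1 h2 h3 h4 h5]]]]] := gR n e.
  by move=> k; have [_ [z hz _]] := he k; exists z.
exists s, kap, (fun j => i (kap' j)), al; split => //.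
- by move=> j; exists (kap' j).
- by move=> k j; have [z hz] := h2 k j; exists (i z), z.
- by apply/(pindep_full (dpchar N')); apply: hl; apply/(pindep_full (dpchar N)).
Qed.

(** If [b] is not yet in the compositum with the p-th powers, it is transcendental over the domain,
    and so is the generic constant [b'] over the image. Sending [b] to [b'] is therefore consistent,
    and powers of exponent below [p] keep the families independent on both sides. *)
Lemma add_constant (M N : dfield) (R : M -> N -> Prop) (b : M) : sdc N ->
  good_system R -> del b = 0 -> exists (N' : dfield) (i : N -> N') (R' : M -> N' -> Prop),
  [/\ ext i, good_system R', forall x y, R x y -> R' x (i y) & pspan p (rdom R') b].
Proof.
move=> hN gsR b0.
have [hb|hb] := pselect (pspan p (rdom R) b).
  exists N, id, R; split => //; exact: ext_id.
have [N' [i [b' [hi b'0 hb']]]] := generic_constant (rran R).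
have [hRi sRi gRi] := good_system_ext hi gsR.
set Ri := fun x y => exists2 z, R x z & y = i z in hRi sRi gRi.
have dRi : rdom Ri = rdom R.
  apply/funext => u; apply/propext; split=> [[y [z hz _]]|[z hz]]; first by exists z.
  by exists (i z), z.
have rRi : rran Ri = (fun y => exists2 x, rran R x & y = i x).
  apply/funext => y; apply/propext; split=> [[x [z hz ->]]|[z [x hx] ->]].
    by exists z => //; exists x.
  by exists x, z.
have hpM := dpchar M; have hpN' := dpchar N'.
rewrite -dRi in hb; rewrite -rRi in hb'.
have alg := algindep_pspan hpM (rdom_subf hRi) (good2_over gRi) hb.
have alg' := algindep_pspan hpN' (rran_subf hRi) (good2_rran hRi gRi) hb'.
have [||hA _] := @adjoin_mpoly M N' Ri 1 (fun _ => b) (fun _ => b') hRi.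
- move=> f g hfg f0; have e : f = 0 by apply: alg => // mm; exists g@_mm; apply: hfg.
  by rewrite e in hfg; rewrite (phom_mrel0 hRi hfg) meval0.
- move=> f g hfg f0; exists (g.@[fun _ => b'])^-1; rewrite mulfV //.
  apply: contraNneq f0 => g0; have e : g = 0.
    by apply: alg' => // mm; exists f@_mm; apply: hfg.
  by have := mrel_neq0 hRi hfg; rewrite e eqxx => /eqP ->; rewrite meval0.
exists N', i, (adjoin Ri (fun _ : 'I_1 => b) (fun _ => b')); split => //.
- split => //.
  + apply: adjoin_stable => //; first exact: dder.
    by move=> _; rewrite b0 b'0; apply: adj_base; apply: (rrel0 (phom_rrel hRi)).
  + apply: good2_adjoin => // t kap kap' hk ik ik'; split.
      apply: (pindep_powprod1 hpM (rdom_subf hRi)) => //.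
      by move=> j; exists (kap' j).
    apply: (pindep_powprod1 hpN' (rran_subf hRi)) => //.
    by move=> j; exists (kap j).
- by move=> x y hxy; apply: adj_base; exists y.
- apply: pspan_base; exists b'.
  exact: (@adj_gen _ _ Ri 'I_1 (fun _ => b) (fun _ => b') ord0).
Qed.

Lemma add_constants (M N : dfield) (R : M -> N -> Prop) (us : seq M) : sdc N ->
  good_system R -> (forall u, u \in us -> del u = 0) ->
  exists (N' : dfield) (i : N -> N') (R' : M -> N' -> Prop),
  [/\ ext i, good_system R', forall x y, R x y -> R' x (i y) &
      forall u, u \in us -> pspan p (rdom R') u].
Proof.
elim: us N R => [|u us IH] N R hN gsR hu.
  by exists N, id, R; split => //; exact: ext_id.
have [|N1 [i1 [R1 [e1 gs1 h1 s1]]]] := add_constant (b := u) hN gsR.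
  by apply: hu; rewrite inE eqxx.
have [||N2 [i2 [R2 [e2 gs2 h2 s2]]]] := IH N1 R1 _ gs1.
- by case: e1 => _ _ + _; apply.
- by move=> v hv; apply: hu; rewrite inE hv orbT.
exists N2, (fun x => i2 (i1 x)), R2; split => //; first exact: ext_comp e1 e2.
  by move=> x y h; apply: h2; apply: h1.
move=> v; rewrite inE => /orP [/eqP ->|]; last exact: s2.
by apply: pspan_sub s1 => y [z hz]; exists (i2 z); apply: h2.
Qed.

(* The constants among [zs] get coordinates in a family [kap] that is
   independent over the p-th powers on both sides, and these coordinates are
   realized together with [zs]. *)
Theorem finite_system (M N : dfield) (R : M -> N -> Prop) (zs : seq M) : sdc N ->
  good_system R -> exists (N' : dfield) (i : N -> N') (R' : M -> N' -> Prop),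
  [/\ ext i, phom R', forall x y, R x y -> R' x (i y),
      forall z, z \in zs -> exists2 y, R' z y & R' (del z) (del y) &
      forall n (u : 'I_n -> M) (v : 'I_n -> N'), (forall k, u k \in zs) ->
        (forall k, del (u k) = 0) -> (forall k, R' (u k) (v k)) ->
        lin_indep_over_Kp p u -> lin_indep_over_Kp p v].
Proof.
move=> hN gsR; have hpM := dpchar M.
pose us := [seq z <- zs | del z == 0].
have [|N1 [i1 [R1 [e1 [hR1 sR1 gR1] h1 s1]]]] := @add_constants M N R us hN gsR.
  by move=> u; rewrite mem_filter => /andP [/eqP].
have [s [kap [kap' [be [hk ik ik' hbe]]]]] : exists s (kap : 'I_s -> M) (kap' : 'I_s -> N1)
    (be : M -> 'I_s -> M), [/\ forall j, R1 (kap j) (kap' j), pindep p (fun _ => True) kap,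
      pindep p (fun _ => True) kap' & forall u, u \in us -> u = \sum_j be u j ^+ p * kap j].
  have /choice [nye hnye] : forall u : M, exists nye : {n : nat & (('I_n -> M) * ('I_n -> M))%type},
      u \in us -> (forall k, rdom R1 ((projT2 nye).2 k)) /\
        u = \sum_k (projT2 nye).1 k ^+ p * (projT2 nye).2 k.
    move=> u; have [hu|_] := boolP (u \in us).
      have [n [y [e he]]] := s1 u hu; by exists (existT _ n (y, e)).
    by exists (existT _ 0%N (fun _ => 0, fun _ => 0)).
  pose n u := projT1 (nye u); pose y u := (projT2 (nye u)).1; pose e u := (projT2 (nye u)).2.
  pose J : finType := {l : 'I_(size us) & 'I_(n us`_l)}.
  have [|s [kap [kap' [al [h2 h3 h4 h5 h6]]]]] := good2_finType (I := J)
      (e := fun lk => e us`_(tag lk) (tagged lk)) gR1.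
    by move=> [l k] /=; have [|he _] := hnye us`_l; [apply: mem_nth|apply: he].
  have /choice [be hbe] : forall u : M, exists be : 'I_s -> M,
      u \in us -> u = \sum_j be j ^+ p * kap j.
    move=> u; have [hu|_] := boolP (u \in us); last by exists (fun _ => 0).
    have hl : (index u us < size us)%N by rewrite index_mem.
    pose l := Ordinal hl; have ul : us`_l = u by rewrite nth_index.
    have [he hue] := hnye _ hu; rewrite -{}ul in hue *.
    exists (fun j => \sum_(k < n us`_l) y us`_l k * al (Tagged (fun l : 'I_(size us) => 'I_(n us`_l)) k) j) => _.
    rewrite [LHS]hue -/(y _) -/(e _).
    under [RHS]eq_bigr => j _ do rewrite (expp_sum hpM) mulr_suml.
    rewrite exchange_big; apply: eq_bigr => k _ /=.
    have := h6 (Tagged (fun l : 'I_(size us) => 'I_(n us`_l)) k) => /= ->.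
    by rewrite mulr_sumr; apply: eq_bigr => j _; rewrite exprMn mulrA.
  by exists s, kap, kap', be.
pose W := zs ++ flatten [seq codom (be u) | u <- us].
(* Derivatives are added because compatibility at an element requires its derivative to be in the
   list. *)
pose W2 := W ++ map del W.
have hN1 : sdc N1 by case: e1 => _ _ + _; apply.
have [N2 [i2 [R2 [e2 hR2 h2 hw]]]] := finite_realization m_enum
  (fun k : 'I_(size W2) => W2`_k) hN1 hpM (dder M) hR1 sR1 gR1.
have inW z : z \in W -> exists2 y, R2 z y & R2 (del z) (del y).
  move=> hz; have hk1 : (index z W2 < size W2)%N by rewrite index_mem mem_cat hz.
  have hl : (index (del z) W2 < size W2)%N.
    by rewrite index_mem mem_cat map_f ?orbT.
  have [|y hy1 hy2] := hw (Ordinal hk1).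
    by exists (Ordinal hl); rewrite /= !nth_index // -index_mem.
  by move: hy1 hy2; rewrite /= nth_index -?index_mem // => hy1 hy2; exists y.
exists N2, (fun x => i2 (i1 x)), R2; split => //.
- exact: ext_comp e1 e2.
- by move=> x y h; apply: h2; apply: h1.
- by move=> z hz; apply: inW; rewrite mem_cat hz.
move=> n u v hu cu hv iu.
have {}hu k : u k \in us by rewrite mem_filter cu eqxx hu.
have /choice [be' hbe'] : forall kj : 'I_n * 'I_s, exists y, R2 (be (u kj.1) kj.2) y.
  move=> [k j] /=; have [|y hy _] := inW (be (u k) j); last by exists y.
  rewrite mem_cat; apply/orP; right; apply/flatten_mapP; exists (u k) => //.
  exact: codom_f.
have rR2 := phom_rrel hR2; have hpN2 := dpchar N2.
have hv' k : v k = \sum_j be' (k, j) ^+ p * i2 (kap' j).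
  apply: (phom_fun hR2 (hv k)); rewrite (hbe _ (hu k)).
  apply: (rrel_sum rR2) => j _; apply: (rrelM rR2); last exact: h2.
  by apply: (rrelX rR2); apply: (hbe' (k, j)).
apply/(pindep_full hpN2).
have ik2 : pindep p (fun _ => True) (fun j => i2 (kap' j)).
  have [_ _ _ hl] := e2.
  by apply/(pindep_full hpN2); apply: hl; apply/(pindep_full (dpchar N1)).
apply/(pindep_coords hpN2 (@subf_full _) (fun _ _ => I) ik2 hv') => x _ hx.
(* In coordinates the claim is that a linear system over the image of [R2] has only the trivial
   solution. A solution in the image pulls back to [M], where independence of [u] kills it;
   [descent] treats the solutions outside the image. *)
have key : forall x : 'I_n -> N2, (forall i, rran R2 (x i)) ->
    (forall j, \sum_i x i * be' (i, j) = 0) -> forall i, x i = 0.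
  move=> x1 /choice [t ht] hx1 k.
  have t0 j : \sum_i t i * be (u i) j = 0.
    have hr : R2 (\sum_i t i * be (u i) j) (\sum_i x1 i * be' (i, j)).
      by apply: (rrel_sum rR2) => l _; apply: (rrelM rR2) => //; apply: (hbe' (l, j)).
    by apply/eqP; rewrite (phom_neq0 hR2 hr) hx1.
  have /(pindep_full hpM) iu' := iu.
  have := (pindep_coords hpM (@subf_full _) (fun _ _ => I) ik (fun k => hbe _ (hu k))).1 iu'.
  move=> /(_ t (fun _ => I) t0 k) tk; apply/eqP.
  by rewrite -(phom_neq0 hR2 (ht k)) tk.
apply: (descent (rran_subf hR2) _ key) => //.
by move=> k j; exists (be (u k) j); apply: (hbe' (k, j)).
Qed.

End Constants.

(** * Quantifier-free types *)

Section Wronskian.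
Variables (K : fieldType) (d : K -> K).
Hypothesis hd : derivation d.

Lemma const_sub_subf (A : K -> Prop) : subf A -> subf (fun x => A x /\ d x = 0).
Proof.
move=> hA; have hC := const_subf hd; split.
- by split; [apply: subf1|apply: (subf1 hC)].
- by move=> x y [h1 h2] [h3 h4]; split; [apply: subfB|apply: (subfB hC)].
- by move=> x y [h1 h2] [h3 h4]; split; [apply: subfM|apply: (subfM hC)].
- by move=> x [h1 h2]; split; [apply: subfV|apply: (subfV hC)].
Qed.

(* If [sum x_i d^j u_i = 0] for all [j], then so does [d x]; a solution of
   minimal support with an entry [1] therefore consists of constants. *)
Lemma wronskian (A : K -> Prop) n (u : 'I_n -> K) : subf A ->
  (forall x, A x -> A (d x)) -> (forall i, A (u i)) ->
  indep (fun x => A x /\ d x = 0) u -> indep (diff_constant d) u.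
Proof.
move=> hA sA Au iu c cc c0.
have pd := derivation_pder hd.
have dsum (x y : 'I_n -> K) : d (\sum_i x i * y i) =
    \sum_i d (x i) * y i + \sum_i x i * d (y i).
  rewrite (pder_sum pd) // -big_split; apply: eq_bigr => i _ /=.
  by rewrite (pderM pd).
have hal (i : 'I_n) j : A (iter j d (u i)) by apply: pder_iter.
apply: (descent hA hal); last first.
  elim=> [//|j IH]; have := dsum c (fun i => iter j d (u i)).
  rewrite IH (pder0 pd) [X in _ = X + _]big1 ?add0r //.
  by move=> i _; rewrite cc mul0r.
move=> x Ax hx; have [k] := ubnP #|[pred i | x i != 0]|.
elim: k x Ax hx => // k IH x Ax hx hk i0.
have [//|xi0] := eqVneq (x i0) 0.
pose y i := x i / x i0.
have Ay i : A (y i) by apply: subf_div.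
have hy j : \sum_i y i * iter j d (u i) = 0.
  under eq_bigr => i _ do rewrite /y mulrAC.
  by rewrite -mulr_suml hx mul0r.
have dy i : d (y i) = 0.
  apply: (IH (fun i => d (y i))) => [i'|j|]; first exact: sA.
    have := dsum y (fun i => iter j d (u i)).
    by rewrite hy (pder0 pd) (hy j.+1) addr0 => <-.
  have yi0 : d (y i0) = 0 by rewrite /y divff // (pder1 pd).
  have : (#|[pred i | d (y i) != 0%R]| < #|[pred i | x i != 0%R]|)%N.
    apply: proper_card; apply/properP; split.
      apply/subsetP => l; rewrite !inE; apply: contraNneq => xl.
      by rewrite /y xl mul0r (pder0 pd).
    by exists i0; rewrite !inE // yi0 eqxx.
  by move=> hlt; apply: leq_trans hlt _; rewrite -ltnS.
have : y i0 = 0 by apply: (iu y) => //; apply: (hy 0%N).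
by rewrite /y divff // => /eqP; rewrite oner_eq0.
Qed.

End Wronskian.

(** * The embedding test for tuples of equal quantifier-free type *)

Section Test.
Variables (p : nat) (m : forall n : nat, 'I_(p ^ n) -> {ffun 'I_n -> 'I_p}).
Arguments m : clear implicits.
Hypothesis m_enum : forall n : nat, bijective (m n).

Local Notation dfield := (dfield m).
Local Notation del := (@ddel p m _).

Lemma dstr_embedding (M N : dfield) (h : M -> N) :
  dhom (@ddel p m M) (@ddel p m N) h -> sep_hom p (@ddel p m M) h ->
  embedding (M := dstr M) (N := dstr N) h.
Proof.
move=> hh hs; split; first exact: dhom_inj hh.
case=> [||||||| n i] x /=.
- exact: dhom0 hh.
- by case: hh.
- exact: dhomD hh _ _.
- exact: dhomN hh _.
- by case: hh.
- exact: dhomV hh _.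
- by case: hh.
- exact: (ell_embedding m_enum (dder M) (dpchar N) hh i x hs (@dell_spec _ _ M) (@dell_spec _ _ N)).
Qed.

Section Terms.
Variables (M N : dfield) (n : nat) (a : 'I_n -> M) (b : 'I_n -> N).
Hypothesis hab : forall phi : formula (L_dl p) n, quantifier_free phi ->
  holds (M := dstr M) phi a <-> holds (M := dstr N) phi b.

(** The isomorphism between the substructures generated by the two tuples. *)
Definition trel (x : M) (y : N) : Prop := exists t : term (L_dl p) n,
  x = eval (M := dstr M) a t /\ y = eval (M := dstr N) b t.

Lemma trel_app (f : dl_symbol p) (x : 'I_(dl_arity f) -> M) (y : 'I_(dl_arity f) -> N) :
  (forall j, trel (x j) (y j)) ->
  trel (@interp (L_dl p) (dstr M) f x) (@interp (L_dl p) (dstr N) f y).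
Proof.
move=> /choice [t ht]; exists (@App (L_dl p) n f t).
have -> : x = fun j => eval (M := dstr M) a (t j) by apply/funext => j; have [] := ht j.
by have -> : y = fun j => eval (M := dstr N) b (t j) by apply/funext => j; have [] := ht j.
Qed.

Lemma trel_eq x x' y y' : trel x y -> trel x' y' -> x = x' <-> y = y'.
Proof. by move=> [t [-> ->]] [t' [-> ->]]; apply: (hab (phi := FEq t t')). Qed.

Lemma trel0 : trel 0 0.
Proof. by apply: (@trel_app (SZero p) (fun _ => 0) (fun _ => 0)) => -[]. Qed.
Lemma trel1 : trel 1 1.
Proof. by apply: (@trel_app (SOne p) (fun _ => 0) (fun _ => 0)) => -[]. Qed.
Lemma trelD x x' y y' : trel x y -> trel x' y' -> trel (x + x') (y + y').
Proof.
move=> h h'; apply: (@trel_app (SAdd p) (fun j => if j == ord0 then x else x')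
  (fun j => if j == ord0 then y else y')) => j; by case: ifP.
Qed.
Lemma trelM x x' y y' : trel x y -> trel x' y' -> trel (x * x') (y * y').
Proof.
move=> h h'; apply: (@trel_app (SMul p) (fun j => if j == ord0 then x else x')
  (fun j => if j == ord0 then y else y')) => j; by case: ifP.
Qed.
Lemma trelN x y : trel x y -> trel (- x) (- y).
Proof. by move=> h; apply: (@trel_app (SOpp p) (fun _ => x) (fun _ => y)). Qed.
Lemma trelV x y : trel x y -> trel x^-1 y^-1.
Proof. by move=> h; apply: (@trel_app (SInv p) (fun _ => x) (fun _ => y)). Qed.
Lemma trel_del x y : trel x y -> trel (del x) (del y).
Proof. by move=> h; apply: (@trel_app (SDelta p) (fun _ => x) (fun _ => y)). Qed.
Lemma trel_ell k i (x : 'I_k.+1 -> M) (y : 'I_k.+1 -> N) :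
  (forall j, trel (x j) (y j)) -> trel (dell i x) (dell i y).
Proof. by move=> h; apply: (@trel_app (SEll (n := k) i) x y). Qed.

Lemma trel_phom : phom trel.
Proof.
split; first split.
- exact: trel1.
- by move=> x x' y y' h h'; apply: trelD => //; apply: trelN.
- by move=> x x' y y' h h'; apply: trelM.
- by move=> y h; apply/esym; apply/(trel_eq trel0 h).
- by move=> x y h _; exists y^-1; apply: trelV.
Qed.

Let rR := phom_rrel trel_phom.

Lemma trel_const x y : trel x y -> del x = 0 <-> del y = 0.
Proof. by move=> h; apply: trel_eq; [apply: trel_del|apply: trel0]. Qed.

Definition snoc (K : Type) k (x : 'I_k -> K) (c : K) (j : 'I_k.+1) : K :=
  if unlift ord_max j is Some j' then x j' else c.

Lemma snoc_init (K : fieldType) k (x : 'I_k -> K) c : tuple_init (snoc x c) = x.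
Proof.
apply/funext => j; rewrite /tuple_init /snoc.
have -> : widen_ord (leqnSn k) j = lift ord_max j.
  by apply: val_inj; rewrite /= /bump leqNgt ltn_ord.
by rewrite liftK.
Qed.

Lemma snoc_last (K : Type) k (x : 'I_k -> K) c : snoc x c ord_max = c.
Proof. by rewrite /snoc unlift_none. Qed.

(** By contraposition: if [c] depended on [x], the functions [dell] would recover it. For a constant
    [c], dependence on a differentially p-independent [x] thus entails an equality of terms, which
    can be tested on either side. *)
Lemma diff_p_indep_snoc (K : dfield) k (x : 'I_k -> K) c :
  del c = 0 -> diff_p_indep p (@ddel p m K) x ->
  c <> \sum_i dell i (snoc x c) ^+ p * pmonomial (m k i) x ->
  diff_p_indep p (@ddel p m K) (snoc x c).
Proof.
move=> c0 ix hc; apply: contrapT => h; apply: hc.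
have nd : ~ ell_degenerate p (@ddel p m K) (snoc x c).
  apply/ell_degenerateN; split; rewrite ?snoc_init //.
  by move=> j; rewrite /snoc; case: unlift => //; case: ix.
by have [_ /(_ nd)] := @dell_spec _ _ K k (snoc x c); rewrite snoc_last snoc_init.
Qed.

Lemma diff_p_indep0 (K : dfield) (x : 'I_0 -> K) : diff_p_indep p (@ddel p m K) x.
Proof.
split=> [[]//|c c0 e]; rewrite -[RHS]c0 (bigD1 e) //= big1 ?addr0 => [|i].
  by rewrite /pmonomial big_ord0 mulr1.
by case/eqP; apply/ffunP => -[].
Qed.

(** A greedy choice made on both sides at once, since the test deciding whether [c] is added is an
    equality of terms. A rejected [c] has coordinates given by the functions [dell], so their p-th
    roots lie in the domain: this is where closure under these functions is used. *)
Lemma trel_pbasis (cs : seq M) : (forall c, c \in cs -> rdom trel c /\ del c = 0) ->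
  exists k (x : 'I_k -> M) (y : 'I_k -> N), [/\ forall j, trel (x j) (y j),
    diff_p_indep p (@ddel p m M) x, diff_p_indep p (@ddel p m N) y &
    forall c, c \in cs -> fadj (ppow p (rdom trel)) x c].
Proof.
have hE : subf (rdom trel) := rdom_subf trel_phom.
have hEp := ppow_subf (dpchar M) hE.
elim: cs => [|c cs IH] hcs.
  exists 0%N, (fun _ => 0), (fun _ => 0); split => //; try exact: diff_p_indep0; by case.
have [|k [x [y [hxy ix iy hx]]]] := IH.
  by move=> c' h; apply: hcs; rewrite inE h orbT.
have [[c' hc'] c0] := hcs c (mem_head _ _).
have c'0 : del c' = 0 by apply/(trel_const hc').
have hs j : trel (snoc x c j) (snoc y c' j).
  by rewrite /snoc; case: unlift.
pose S := \sum_i dell i (snoc x c) ^+ p * pmonomial (m k i) x.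
pose S' := \sum_i dell i (snoc y c') ^+ p * pmonomial (m k i) y.
have hmon i : trel (pmonomial (m k i) x) (pmonomial (m k i) y).
  by apply: (rrel_prod rR) => j _; apply: (rrelX rR).
have hSS : trel S S'.
  apply: (rrel_sum rR) => i _; apply: (rrelM rR) => //.
  by apply: (rrelX rR); apply: trel_ell.
have [cS|cS] := eqVneq c S.
  exists k, x, y; split => // c1; rewrite inE => /orP [/eqP ->|]; last exact: hx.
  rewrite cS; have hF := fadj_subf x hEp.
  apply: subf_sum => // i _; apply: subfM => //.
    apply: fadj_base; exists (dell i (snoc x c)) => //.
    by exists (dell i (snoc y c')); apply: trel_ell.
  by apply: subf_prod => // j _; apply: subfX => //; apply: fadj_gen.
have cS' : c' <> S' by move=> e; case/eqP: cS; apply/(trel_eq hc' hSS).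
exists k.+1, (snoc x c), (snoc y c'); split => //.
- by apply: diff_p_indep_snoc => //; apply/eqP.
- by apply: diff_p_indep_snoc.
have hF := fadj_subf (snoc x c) hEp.
move=> c1; rewrite inE => /orP [/eqP ->|/hx].
  by rewrite -[X in fadj _ _ X](snoc_last x c); apply: fadj_gen.
apply: fadj_min => // [z hz|j]; first exact: fadj_base.
have -> : x j = snoc x c (widen_ord (leqnSn k) j) by rewrite -[in LHS](snoc_init x c).
exact: fadj_gen.
Qed.

(** Expand the elements over the constants of the domain, then these constants in p-monomials. On
    both sides the first family stays independent over all constants by the Wronskian argument, and
    p-th powers and p-monomials are constants, so the products are independent over p-th powers. *)
Lemma trel_good : good2 p trel.
Proof.
move=> k e he; have hE : subf (rdom trel) := rdom_subf trel_phom.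
have hpM := dpchar M; have hpN := dpchar N.
pose S (x : M) := rdom trel x /\ del x = 0.
have hS : subf S := const_sub_subf (dder M) hE.
have [s [bb [kk [ib hbb Sk hk]]]] := basis_extract e hS.
have Eb j : rdom trel (bb j) by have [i ->] := hbb j.
have /choice [bb' hb'] := Eb.
have [|q [x [y [hxy ix iy hx]]]] := @trel_pbasis [seq kk ij.1 ij.2 | ij : 'I_k * 'I_s].
  by move=> c /mapP [ij _ ->]; apply: Sk.
have Ex j : rdom trel (x j) by exists (y j).
have /choice [al hal] : forall ij : 'I_k * 'I_s, exists c : {ffun 'I_q -> 'I_p} -> M,
    (forall e, rdom trel (c e)) /\ kk ij.1 ij.2 = \sum_e c e ^+ p * pmonomial e x.
  move=> ij; apply: (pmonomial_span hpM hE Ex); apply: hx.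
  by apply/mapP; exists ij => //; rewrite mem_enum.
have iB : indep (diff_constant (@ddel p m M)) bb.
  apply: (wronskian (dder M) hE) => // z [z' hz]; by exists (del z'); apply: trel_del.
have iB' : indep (diff_constant (@ddel p m N)) bb'.
  apply: (wronskian (dder N) (rran_subf trel_phom)).
  - by move=> z' [z hz]; exists (del z); apply: trel_del.
  - by move=> j; exists (bb j).
  move=> c' hc' c0.
  have /choice [c hc] : forall j, exists c, trel c (c' j) by move=> j; have [[c]] := hc' j; exists c.
  have hs : trel (\sum_j c j * bb j) (\sum_j c' j * bb' j).
    by apply: (rrel_sum rR) => j _; apply: (rrelM rR).
  have cz : forall j, c j = 0.
    apply: ib; last by apply/eqP; rewrite (phom_neq0 trel_phom hs) c0.
    by move=> j; split; [exists (c' j)|apply/(trel_const (hc j)); have [] := hc' j].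
  by move=> j; apply/eqP; rewrite -(phom_neq0 trel_phom (hc j)) cz.
pose J : finType := ('I_s * {ffun 'I_q -> 'I_p})%type.
pose ev (l : 'I_#|J|) : J := enum_val l.
have ind (L : dfield) (z : 'I_q -> L) (g : 'I_s -> L) :
    diff_p_indep p (@ddel p m L) z -> indep (diff_constant (@ddel p m L)) g ->
    pindep p (fun _ => True) (fun je : J => pmonomial je.2 z * g je.1).
  move=> [cz iz] ig c _ c0 [j e'].
  have hC := const_subf (dder L); have hpL := dpchar L.
  have : forall j, \sum_e c (j, e) ^+ p * pmonomial e z = 0.
    apply: (ig (fun j => \sum_e c (j, e) ^+ p * pmonomial e z)).
      move=> l; apply: (subf_sum hC) => e1 _; apply: (subfM hC).
        exact: (const_expp (dder L) hpL).
      by apply: (subf_prod hC) => l' _; apply: (subfX hC); apply: cz.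
    rewrite -[RHS]c0.
    transitivity (\sum_j \sum_e (c (j, e) ^+ p * (pmonomial e z * g j))).
      apply: eq_bigr => l _; rewrite mulr_suml; apply: eq_bigr => e1 _.
      by rewrite mulrA.
    by rewrite pair_bigA; apply: eq_big => [je|[j1 e1] _].
  move=> /(_ j) hj; apply/eqP; rewrite -(expp_eq0 hpL); apply/eqP.
  exact: (iz (fun e1 => c (j, e1)) hj).
exists #|J|, (fun l => pmonomial (ev l).2 x * bb (ev l).1),
  (fun l => pmonomial (ev l).2 y * bb' (ev l).1), (fun i l => al (i, (ev l).1) (ev l).2).
split.
- move=> l; apply: (rrelM rR) => //.
  by apply: (rrel_prod rR) => j _; apply: (rrelX rR).
- by move=> i l; have [h _] := hal (i, (ev l).1); apply: h.
- exact: (pindep_reindex (enum_val_bij J) (ind _ _ _ ix iB)).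
- exact: (pindep_reindex (enum_val_bij J) (ind _ _ _ iy iB')).
move=> i; rewrite hk.
rewrite /ev -(big_enum_val (A := {: J}) (fun je => al (i, je.1) je.2 ^+ p * (pmonomial je.2 x * bb je.1))) /=.
transitivity (\sum_j \sum_e (al (i, j) e ^+ p * (pmonomial e x * bb j))).
  apply: eq_bigr => j _; have [_ /= ->] := hal (i, j); rewrite mulr_suml.
  by apply: eq_bigr => e1 _; rewrite mulrA.
by rewrite pair_bigA; apply: eq_big => [je|[j1 e1] _].
Qed.

Lemma trel_system : good_system trel.
Proof. by split; [exact: trel_phom|exact: trel_del|exact: trel_good]. Qed.

End Terms.

Lemma In_mem (T : eqType) (x : T) (l : seq T) : List.In x l <-> x \in l.
Proof.
elim: l => [|y l IH] //=; rewrite inE; split=> [[->|/IH ->]|/orP [/eqP ->|/IH]];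
  rewrite ?eqxx ?orbT //; by [left|right].
Qed.

(** For a finite list [Z] the relation obtained respects the derivations, and independence of
    constants, only on [Z]. In the ultraproduct over all lists it becomes a map defined on [M] with
    both properties everywhere. *)
Theorem embedding_test (M N : dfield) n (a : 'I_n -> M) (b : 'I_n -> N) : sdc N ->
  (forall phi : formula (L_dl p) n, quantifier_free phi ->
     holds (M := dstr M) phi a <-> holds (M := dstr N) phi b) ->
  exists (N' : dfield) (k : N -> N') (h : M -> N'),
  [/\ sdc N', elementary (M := dstr N) (N := dstr N') k,
      embedding (M := dstr M) (N := dstr N') h & forall i, h (a i) = k (b i)].
Proof.
move=> hN hab; pose T := {N' : dfield & ((N -> N') * (M -> N' -> Prop))%type}.
have /choice [f hf] : forall Z : list M, exists S : T,
  [/\ ext (projT2 S).1, phom (projT2 S).2,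
      forall x y, trel a b x y -> (projT2 S).2 x ((projT2 S).1 y),
      forall z, z \in Z -> exists2 y, (projT2 S).2 z y & (projT2 S).2 (del z) (del y) &
      forall n (u : 'I_n -> M) (v : 'I_n -> projT1 S), (forall k, u k \in Z) ->
        (forall k, del (u k) = 0) -> (forall k, (projT2 S).2 (u k) (v k)) ->
        lin_indep_over_Kp p u -> lin_indep_over_Kp p v].
  move=> Z; have [N' [i [R' H]]] := finite_system m_enum Z hN (trel_system hab).
  by exists (existT _ N' (i, R')).
pose A Z := projT1 (f Z).
pose ii Z : N -> A Z := (projT2 (f Z)).1.
pose RR Z : M -> A Z -> Prop := (projT2 (f Z)).2.
have hR Z : phom (RR Z) by have [] := hf Z.
have [U [hU UL]] := ultra_list M; have [[UT US UI UN] UC] := hU.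
have [N' [cls [isu usdc [uB uM] [u1 ud] uli]]] := ultraproduct m_enum A hU.
have [_ ceq _] := isu.
(* Off the list [Z] the value is 0; every [x] belongs to almost all lists. *)
have [hz hhz] : exists hz : forall Z, M -> A Z, forall Z x, x \in Z ->
    RR Z x (hz Z x) /\ RR Z (del x) (del (hz Z x)).
  apply: (@dchoice _ (fun Z => M -> A Z) (fun Z g => forall x, x \in Z ->
    RR Z x (g x) /\ RR Z (del x) (del (g x)))) => Z.
  suff /choice [g hg] : forall x, exists y, x \in Z -> RR Z x y /\ RR Z (del x) (del y).
    by exists g.
  move=> x; have [xZ|_] := boolP (x \in Z); last by exists 0.
  by have [_ _ _ /(_ x xZ) [y h1 h2] _] := hf Z; exists y.
have UR x : U (fun Z => RR Z x (hz Z x)).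
  by apply: US (UL x) => Z /In_mem /hhz [].
pose h x := cls (fun Z => hz Z x).
have hE x (s : forall Z, A Z) : U (fun Z => RR Z x (s Z)) -> h x = cls s.
  move=> hs; apply/ceq; apply: US (UI _ _ (UR x) hs) => Z [h1 h2].
  exact: (phom_fun (hR Z) h1 h2).
have dh : dhom (@ddel p m M) (@ddel p m N') h.
  split.
  - rewrite -u1; apply: hE; apply: US UT => Z _; exact: (rrel1 (phom_rrel (hR Z))).
  - move=> x y; rewrite -uB; apply: hE; apply: US (UI _ _ (UR x) (UR y)) => Z [h1 h2].
    exact: (rrelB (phom_rrel (hR Z))).
  - move=> x y; rewrite -uM; apply: hE; apply: US (UI _ _ (UR x) (UR y)) => Z [h1 h2].
    exact: (rrelM (phom_rrel (hR Z))).
  - move=> x; rewrite -ud; apply: hE; apply: US (UL x) => Z /In_mem.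
    by move=> /hhz [].
exists N', (fun y => cls (fun Z => ii Z y)), h; split.
- apply: usdc; apply: US UT => Z _; have [[_ _ + _] _ _ _ _] := hf Z; exact.
- move=> k phi v.
  rewrite (los hU isu (fun Z => ex_intro _ (0 : A Z) Logic.I) phi (fun j Z => ii Z (v j))).
  have el Z : holds (M := dstr N) phi v <-> holds (M := dstr (A Z)) phi (fun j => ii Z (v j)).
    by have [[_ + _ _] _ _ _ _] := hf Z; apply.
  split=> [hv|hv]; first by apply: US UT => Z _; apply/el.
  apply: contrapT => nv; apply: UN; apply: US hv => Z /el //.
- apply: dstr_embedding => // k u cu iu; apply: uli.
  have : U (fun Z => forall j, u j \in Z).
    by apply: (ultra_fin hU) => j; apply: US (UL (u j)) => Z /In_mem.
  apply: US => Z hu; have [_ _ _ _ H] := hf Z.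
  by apply: (H k u) => // j; have [] := hhz Z _ (hu j).
move=> i; apply: hE; apply: US UT => Z _.
by have [_ _ H _ _] := hf Z; apply: H; exists (Var _ i).
Qed.

End Test.

(** * Separably differentially closed extensions *)

Section SeparableExtension.
Variables (F : fieldType) (p : nat).
Hypothesis hp : p \in [pchar F].

(** By the Leibniz rule, a product with nonzero derivative has a factor with nonzero derivative;
    descend until it is irreducible. *)
Lemma separable_factor (f : {poly F}) : f^`() != 0 ->
  exists h, [/\ irreducible_poly h, h %| f & h^`() != 0].
Proof.
have [n] := ubnP (size f); elim: n f => // n IH f hn fd.
have f0 : f != 0 by apply: contraNneq fd => ->; rewrite deriv0.
have sf : (1 < size f)%N.
  by rewrite ltnNge; apply: contra fd => /size1_polyC ->; rewrite derivC.
have [irr|nirr] := pselect (irreducible_poly f); first by exists f.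
have [q [q1 qf nqf]] : exists q : {poly F}, [/\ size q != 1%N, q %| f & ~ q %= f].
  apply: contrapT => h; apply: nirr; split => // q q1 qf.
  by apply: contrapT => nq; apply: h; exists q.
have q0 : q != 0 by apply: contraTneq qf => ->; rewrite dvd0p.
have sq : (size q < size f)%N.
  rewrite ltn_neqAle dvdp_leq // andbT; apply/negP => h; apply: nqf.
  by rewrite -(dvdp_size_eqp qf).
have [r rE] := dvdpP _ _ qf.
have r0 : r != 0 by apply: contraNneq f0; rewrite rE => ->; rewrite mul0r.
have sr : (size r < size f)%N.
  have : (0 < size q)%N by rewrite lt0n size_poly_eq0.
  rewrite rE size_mul //; move: (size q) q1 (size r) => [|[|a]] // _ b _.
  by rewrite !addnS ltnS leq_addr.
have [rd|rd] := eqVneq r^`() 0; last first.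
  have [|h [h1 h2 h3]] := IH r _ rd; first by apply: leq_trans sr _.
  by exists h; split => //; rewrite rE dvdp_mulr.
have [qd|qd] := eqVneq q^`() 0; last first.
  have [|h [h1 h2 h3]] := IH q _ qd; first by apply: leq_trans sq _.
  by exists h; split => //; rewrite rE dvdp_mull.
by move: fd; rewrite rE derivM rd qd mul0r mulr0 addr0 eqxx.
Qed.

(** Independence survives because [z], being separable, lies in [F(z^p)], so the powers of [z^p]
    form a basis of [L]. If [c j] is [q_j] evaluated at [z], its p-th power has the p-th powers of
    the coefficients of [q_j] as coordinates in this basis. *)
Lemma separable_extension (f : {poly F}) : f^`() != 0 ->
  exists (L : fieldType) (io : {rmorphism F -> L}) (z : L),
  [/\ (map_poly io f).[z] = 0, sepalg (fun y => exists x, y = io x) z,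
      forall x, fadj (fun y => exists x, y = io x) (fun _ : unit => z) x &
      forall (J : finType) (v : J -> F), pindep p (fun _ => True) v ->
        pindep p (fun _ => True) (fun j => io (v j))].
Proof.
move=> fd; have p_gt0 := prime_gt0 (pcharf_prime hp).
have [h [irr hf hd]] := separable_factor fd.
have [L dimL [z hz gen]] := irredp_FAdjoin irr.
pose io : {rmorphism F -> L} := in_alg L.
have hz0 : (map_poly io h).[z] = 0 by apply/eqP: hz.
have hpL : p \in [pchar L] by rewrite (fmorph_pchar io).
pose R y := exists x, y = io x.
have hR : subf R.
  split; first by exists 1; rewrite rmorph1.
  - by move=> _ _ [x ->] [y ->]; exists (x - y); rewrite rmorphB.
  - by move=> _ _ [x ->] [y ->]; exists (x * y); rewrite rmorphM.
  - by move=> _ [x ->]; exists x^-1; rewrite fmorphV.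
have sz : sepalg R z.
  exists (map_poly io h); split => //; first by move=> i; exists h`_i; rewrite coef_map.
  have cop : coprimep h h^`().
    rewrite irreducible_poly_coprime //; apply/negP => /(dvdp_leq hd).
    by rewrite leqNgt lt_size_deriv // -size_poly_gt0; case: irr => /ltnW.
  rewrite deriv_map; apply: (coprimep_root (p := map_poly io h)); first by rewrite coprimep_map.
  exact/eqP.
have mem_subf (E : {subfield L}) : subf (fun x => x \in E).
  split; first exact: rpred1.
  - by move=> x y; apply: rpredB.
  - by move=> x y; apply: rpredM.
  - by move=> x; rewrite rpredV.
have RE (E : {subfield L}) x : R x -> x \in E.
  by move=> [y ->]; apply: (subvP (sub1v E)); apply/vlineP; exists y.
have zE : z \in <<1; z ^+ p>>%VS.
  apply: (sepalg_ppow hpL (mem_subf <<1; z ^+ p>>%AS)); first exact: memv_adjoin.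
  by have [g [h1 h2 h3]] := sz; exists g; split => // i; apply: RE; apply: h1.
have full : <<1; z ^+ p>>%VS = fullv.
  apply/eqP; rewrite eqEsubv subvf -gen /=.
  by apply/FadjoinP; split => //; apply: sub1v.
pose n := \dim {:L}.
have deg_zp : adjoin_degree 1 (z ^+ p) = n.
  by have := dim_Fadjoin 1%AS (z ^+ p); rewrite full dimv1 muln1 => <-.
have deg_z : adjoin_degree 1 z = n.
  by have := dim_Fadjoin 1%AS z; rewrite gen dimv1 muln1 => <-.
have uniq_zp (q : {poly F}) : (size q <= n)%N -> (map_poly io q).[z ^+ p] = 0 -> q = 0.
  move=> sq q0; apply/eqP; apply: contraLR sq => qn0; rewrite -ltnNge.
  have hq : minPoly 1 (z ^+ p) %| map_poly io q.
    apply: minPoly_dvdp; last exact/eqP.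
    by apply/polyOver1P; exists q.
  have := dvdp_leq _ hq; rewrite size_minPoly deg_zp size_map_poly; apply.
  by rewrite map_poly_eq0.
have coords x : exists2 q : {poly F}, (size q <= n)%N & x = (map_poly io q).[z].
  have hx : x \in <<1; z>>%VS by rewrite gen memvf.
  have /polyOver1P [q hq] := Fadjoin_polyOver 1 z x.
  exists q; last by rewrite -hq Fadjoin_poly_eq.
  by rewrite -(size_map_poly io) -hq -deg_z size_Fadjoin_poly.
clearbody io.
have ios (J : finType) (G : J -> F) : io (\sum_j G j) = \sum_j io (G j) by exact: raddf_sum.
have cm (q : {poly F}) i : (map_poly io q)`_i = io q`_i by exact: coef_map.
exists L, io, z; split => //.
- by move/dvdpP: hf => [g ->]; rewrite rmorphM hornerM hz0 mulr0.
- move=> x; have [q _ ->] := coords x; rewrite horner_coef.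
  have hA := fadj_subf (fun _ : unit => z) hR.
  apply: subf_sum => // i _; apply: subfM => //.
    by apply: fadj_base; exists q`_i; exact: cm.
  by apply: subfX => //; apply: (fadj_gen _ (fun _ : unit => z) tt).
move=> J v iv c _ c0.
have /choice [q hq] : forall j, exists q : {poly F}, (size q <= n)%N /\ c j = (map_poly io q).[z].
  by move=> j; have [q] := coords (c j); exists q.
pose Q := \poly_(l < n) \sum_j (q j)`_l ^+ p * v j.
have Q0 : Q = 0.
  apply: uniq_zp; first exact: size_poly.
  rewrite (@horner_coef_wide _ n); last by rewrite size_map_poly size_poly.
  rewrite -[RHS]c0.
  transitivity (\sum_(l < n) \sum_j io (q j)`_l ^+ p * io (v j) * z ^+ p ^+ l).
    apply: eq_bigr => l _; rewrite cm coef_poly ltn_ord ios mulr_suml.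
    by apply: eq_bigr => j _; rewrite rmorphM rmorphXn.
  rewrite exchange_big; apply: eq_bigr => j _; have [sq ->] := hq j.
  rewrite (@horner_coef_wide _ n) ?size_map_poly // (expp_sum hpL) mulr_suml.
  by apply: eq_bigr => l _; rewrite exprMn cm -!exprM [(p * l)%N]mulnC mulrAC.
move=> j; have [sq ->] := hq j; suff -> : q j = 0 by rewrite rmorph0 horner0.
apply/polyP => l; rewrite coef0; have [hl|hl] := ltnP l n; last first.
  by rewrite nth_default // (leq_trans sq).
apply: (iv (fun j => (q j)`_l)) => //.
by have := coef_poly n (fun l => \sum_j (q j)`_l ^+ p * v j) l; rewrite -/Q Q0 coef0 hl.
Qed.

End SeparableExtension.

Lemma mpoly_rmorph_ext (B : fieldType) N (S : comNzRingType)
    (phi psi : {rmorphism {mpoly B[N]} -> S}) :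
  (forall c, phi c%:MP = psi c%:MP) -> (forall i, phi 'X_i = psi 'X_i) -> phi =1 psi.
Proof.
move=> hc hX f; apply: (@mpoly_coef_ind B (fun _ => True) N (fun f => phi f = psi f)) => //.
- by rewrite !rmorph0.
- by rewrite !rmorph1.
- by move=> f1 f2 h1 h2; rewrite !rmorphD h1 h2.
- by move=> f1 f2 h1 h2; rewrite !rmorphM h1 h2.
Qed.

Lemma meval_agree (B : fieldType) N (f : {mpoly B[N]}) (v v' : 'I_N -> B) :
  (forall mm, f@_mm != 0 -> forall l, mm l != 0%N -> v l = v' l) -> f.@[v] = f.@[v'].
Proof.
move=> h; rewrite !mevalE; apply: eq_big_seq => mm; rewrite mcoeff_msupp => hm.
congr (_ * _); apply: eq_bigr => l _; have [->|ml] := eqVneq (mm l) 0%N.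
  by rewrite !expr0.
by rewrite (h mm hm l ml).
Qed.

(** * Solving a single equation in an extension *)

Section OneStep.
Variables (p : nat) (m : forall n : nat, 'I_(p ^ n) -> {ffun 'I_n -> 'I_p}).
Arguments m : clear implicits.
Hypothesis m_enum : forall n : nat, bijective (m n).

Local Notation dfield := (dfield m).
Local Notation del := (@ddel p m _).

Definition dext (A B : dfield) (h : A -> B) : Prop :=
  dhom (@ddel p m A) (@ddel p m B) h /\
  forall (J : finType) (u : J -> A), lin_indep_over_Kp p u ->
    lin_indep_over_Kp p (fun j => h (u j)).

(** The hypotheses of the axiom in terms of coefficients, a form that passes along partial
    homomorphisms. *)
Definition problem (A : dfield) N (f g : {mpoly A[N]}) (k : 'I_N) : Prop :=
  [/\ forall mm, f@_mm != 0 -> forall l : 'I_N, mm l != 0%N -> (l <= k)%N,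
      f^`M(k) != 0, g != 0 &
      forall mm, g@_mm != 0 -> forall l : 'I_N, mm l != 0%N -> (l < k)%N].

Definition solved (A B : dfield) (h : A -> B) N (f g : {mpoly A[N]}) : Prop :=
  exists a (f' g' : {mpoly B[N]}), [/\ forall mm, f'@_mm = h f@_mm,
    forall mm, g'@_mm = h g@_mm, diff_eval del f' a = 0 & diff_eval del g' a != 0].

Lemma one_step (B : dfield) N (f g : {mpoly B[N]}) (k : 'I_N) : problem f g k ->
  exists (C : dfield) (i : B -> C), dext i /\ solved i f g.
Proof.
move=> [fk fd g0 gk]; have hp := dpchar B.
have [F [c [x [tf [hpF evx tf0 tfV cind]]]]] : exists (F : fieldType) (c : {rmorphism B -> F})
    (x : 'I_N -> F) (tf : {mpoly B[N]} -> F), [/\ p \in [pchar F],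
      forall a, (map_mpoly c a).@[x] = tf a, forall a, (tf a == 0) = (a == 0),
      forall y, exists a b, y = tf a / tf b &
      forall t (u : 'I_t -> B), pindep p (fun _ => True) u ->
        pindep p (fun _ => True) (fun l => c (u l))].
  exists (ffield B N), (ffc B N), (@ffx B N), (@FracField.tofrac {mpoly B[N]}); split.
  - exact: ff_pchar.
  - exact: ff_meval.
  - by move=> a; rewrite tofrac_eq0.
  - by move=> y; have [a [b [_ ->]]] := frac_rep y; exists a, b.
  - by move=> t u; apply: ff_pindep0.
(* The polynomial [f] is read in the single variable of index [k]. The field [F] contains a generic
   value for that variable too, and evaluating there shows that the derivative is nonzero. *)
pose vX (l : 'I_N) : {poly F} := if l == k then 'X else (x l)%:P.
pose ev : {rmorphism {mpoly B[N]} -> {poly F}} :=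
  (meval vX \o map_mpoly (polyC \o c))%FUN.
have evC b : ev b%:MP = (c b)%:P by rewrite /ev /= map_mpolyC mevalC.
have evX l : ev 'X_l = vX l by rewrite /ev /= map_mpolyX mevalXU.
clearbody ev.
have evd (a : {mpoly B[N]}) : (ev a)^`() = ev a^`M(k).
  apply: (@mpoly_coef_ind B (fun _ => True) N (fun a => (ev a)^`() = ev a^`M(k))) => //.
  - by move=> b _; rewrite evC derivC mderivC rmorph0.
  - by rewrite mderiv0 !rmorph0 deriv0.
  - by rewrite -mpolyC1 evC derivC mderivC rmorph0.
  - move=> l; rewrite evX mderivX mnm1E /vX; case: eqVneq => [->|lk].
      have -> : (U_(k) - U_(k) = 0 :> 'X_{1..N})%MM.
        by apply/mnmP => i; rewrite mnmBE mnm0E subnn.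
      by rewrite derivX scale1r mpolyX0 rmorph1.
    by rewrite derivC scale0r rmorph0.
  - by move=> a1 a2 h1 h2; rewrite mderivD !rmorphD derivD h1 h2.
  - move=> a1 a2 h1 h2; rewrite mderivM !rmorphM derivM h1 h2 rmorphD !rmorphM.
    by [].
have evh (a : {mpoly B[N]}) : (ev a).[x k] = tf a.
  rewrite -evx.
  apply: (@mpoly_rmorph_ext _ _ _ (horner_eval (x k) \o ev)%FUN (meval x \o map_mpoly c)%FUN).
    by move=> b; rewrite /= /horner_eval evC hornerC map_mpolyC mevalC.
  move=> l; rewrite /= /horner_eval evX map_mpolyX mevalXU /vX.
  by case: eqVneq => [->|_]; rewrite ?hornerX ?hornerC.
have ftd : (ev f)^`() != 0.
  rewrite evd; apply: contraNneq fd => e; have := evh f^`M(k).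
  by rewrite e horner0 => /esym/eqP; rewrite tf0.
have [L [io [z [hz sz gen ind]]]] := separable_extension hpF ftd.
pose j : {rmorphism B -> L} := (io \o c)%FUN.
pose w l := io (x l); pose E0 y := exists b, y = j b.
have hpL : p \in [pchar L] by rewrite (fmorph_pchar io).
have jev (a : {mpoly B[N]}) : (map_mpoly j a).@[w] = io (tf a).
  rewrite -evx.
  apply: (@mpoly_rmorph_ext _ _ _ (meval w \o map_mpoly j)%FUN (io \o (meval x \o map_mpoly c))%FUN).
    by move=> b; rewrite /= !map_mpolyC !mevalC.
  by move=> l; rewrite /= !map_mpolyX !mevalXU.
have [dE [pE dEj]] := rmorph_derivation j (dder B).
have hE0 : subf E0 := pder_subf pE.
have alg : malgindep E0 w.
  move=> q hq q0; have /choice [b hb] := hq.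
  have [q1 hq1] : exists q1 : {mpoly B[N]}, q = map_mpoly j q1.
    exists (\sum_(mm <- msupp q) b mm *: 'X_[mm]).
    rewrite raddf_sum /= {1}(mpolyE q); apply: eq_bigr => mm _.
    by rewrite map_mpolyZ map_mpolyX -hb.
  move: q0; rewrite hq1 jev => /eqP; rewrite fmorph_eq0 tf0 => /eqP ->.
  by rewrite rmorph0.
(* The jet of the solution: the free variables below [k], then the root [z]. Past [k] the entry [z]
   is a filler, as the derivatives of the remaining variables may be chosen at will. *)
pose vs (l : nat) : L := if (l < k)%N then (if insub l is Some l' then w l' else 0) else z.
have vsE (l : 'I_N) : (l < k)%N -> vs l = w l by rewrite /vs => ->; rewrite valK.
have vsk : vs k = z by rewrite /vs ltnn.
have [d1 [pd1 d1E d1w]] := pder_ext_algindep (fun l : 'I_N => vs l.+1) pE alg.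
have ioE y : fadj E0 w (io y).
  have hA := fadj_subf w hE0.
  have tfE (a : {mpoly B[N]}) : fadj E0 w (io (tf a)).
    rewrite -jev; apply: subf_meval => // [mm|l]; last exact: fadj_gen.
    by rewrite mcoeff_map_mpoly; apply: fadj_base; exists a@_mm.
  by have [a [b ->]] := tfV y; rewrite fmorph_div; apply: subf_div.
have sz1 : sepalg (fadj E0 w) z.
  by have [q [h1 h2 h3]] := sz; exists q; split => // l; have [y ->] := h1 l.
have [d [pd dd1]] := pder_ext_sepalg pd1 sz1.
have all y : fadj (fadj E0 w) (fun _ : unit => z) y.
  apply: fadj_min (gen y); first by apply: fadj_subf; apply: fadj_subf.
    by move=> _ [y' ->]; apply: fadj_base.
  by move=> u; apply: (fadj_gen _ (fun _ : unit => z) u).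
have dd : derivation d.
  by split=> y1 y2; [apply: (pderD pd)|apply: (pderM pd)].
have dj b : d (j b) = j (del b).
  by rewrite dd1 ?d1E ?dEj //; [exists b|apply: fadj_base; exists b].
have iter_vs l : (l <= k)%N -> iter l d (vs 0%N) = vs l.
  elim: l => // l IH hl; rewrite iterS IH 1?ltnW //.
  have hlN : (l < N)%N := ltn_trans hl (ltn_ord k).
  have e := vsE (Ordinal hlN) hl; rewrite /= in e.
  by rewrite e dd1 ?d1w //; apply: fadj_gen.
have jind (J : finType) (u : J -> B) : lin_indep_over_Kp p u ->
    lin_indep_over_Kp p (fun l => j (u l)).
  move=> /(pindep_full hp) iu; apply/(pindep_full hpL); apply: ind.
  have := cind _ _ (pindep_reindex (h := enum_val) (enum_val_bij J) iu).
  move=> h; have := pindep_reindex (h := enum_rank) (enum_rank_bij J) h.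
  rewrite (_ : (fun _ => _) = fun l => c (u l)) //.
  by apply/funext => l; rewrite enum_rankK.
have dfL : DF_field p d.
  split => // n; have [_ _ hinf] := ddf B; have [u [cu iu]] := hinf n.
  exists (fun l => j (u l)); split; last exact: jind.
  by move=> l; rewrite /diff_constant dj cu rmorph0.
have [ell hell] := ell_exists m_enum d hpL.
pose C : dfield := DField dfL hell.
exists C, (fun b => j b); split.
  split; last exact: jind.
  by split; rewrite ?rmorph1 // => *; rewrite ?rmorphB ?rmorphM //= dj.
exists (vs 0%N), (map_mpoly j f), (map_mpoly j g).
have mfj (a : {mpoly B[N]}) mm : (map_mpoly j a)@_mm = j a@_mm by exact: mcoeff_map_mpoly.
have j0 : j 0 = 0 by exact: rmorph0.
pose V (l : 'I_N) := if l == k then z else w l.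
split; try by move=> mm; rewrite mcoeff_map_mpoly.
- rewrite /diff_eval /=.
  transitivity (map_mpoly j f).@[V].
    apply: meval_agree => mm hm l ml.
    have hl : (l <= k)%N.
      by apply: (fk mm) => //; apply: contraNneq hm => e; rewrite mfj e j0.
    rewrite iter_vs // /V; case: eqVneq => [->|lk] //.
    by apply: vsE; rewrite ltn_neqAle hl andbT.
  rewrite -[RHS]hz.
  apply: (@mpoly_rmorph_ext _ _ _ (meval V \o map_mpoly j)%FUN (horner_eval z \o (map_poly io \o ev))%FUN).
    by move=> b; rewrite /= /horner_eval evC map_mpolyC mevalC map_polyC hornerC.
  move=> l; rewrite /= /horner_eval evX map_mpolyX mevalXU /vX /V.
  by case: eqVneq => _; rewrite ?map_polyX ?map_polyC ?hornerX ?hornerC.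
- rewrite /diff_eval /=.
  have -> : (map_mpoly j g).@[fun l : 'I_N => iter l d (vs 0%N)] = (map_mpoly j g).@[w].
    apply: meval_agree => mm hm l ml.
    have hl : (l < k)%N.
      by apply: (gk mm) => //; apply: contraNneq hm => e; rewrite mfj e j0.
    by rewrite iter_vs 1?ltnW // vsE.
  by rewrite jev fmorph_eq0 tf0.
Qed.

End OneStep.

(** * Solving all equations *)

Section Closure.
Variables (p : nat) (m : forall n : nat, 'I_(p ^ n) -> {ffun 'I_n -> 'I_p}).
Arguments m : clear implicits.
Hypothesis m_enum : forall n : nat, bijective (m n).

Local Notation dfield := (dfield m).
Local Notation del := (@ddel p m _).

Lemma dext_id (A : dfield) : dext (fun x : A => x).
Proof. by split. Qed.

Lemma dext_comp (A B C : dfield) (h : A -> B) (i : B -> C) : dext h -> dext i ->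
  dext (fun x => i (h x)).
Proof.
move=> [[h1 hB hM hd] hl] [[i1 iB iM id_] il]; split; last by move=> J u /hl /il.
by split=> * /=; rewrite ?h1 ?hB ?hM ?hd ?i1 ?iB ?iM ?id_.
Qed.

Lemma dhom_phom (A B : dfield) (h : A -> B) :
  dhom (@ddel p m A) (@ddel p m B) h -> phom (fun x y => y = h x).
Proof.
move=> hh; split; first exact: dhom_rrel hh.
  by move=> q /= e; rewrite e; exact: (dhom0 hh).
by move=> x q /= e _; exists (h x)^-1; rewrite (dhomV hh).
Qed.

Lemma dhom_iter (A B : dfield) (h : A -> B) n x :
  dhom (@ddel p m A) (@ddel p m B) h -> h (iter n del x) = iter n del (h x).
Proof. by case=> _ _ _ hd; elim: n => //= n IH; rewrite hd IH. Qed.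

Lemma dhom_mpoly (A B : dfield) (h : A -> B) N (f : {mpoly A[N]}) :
  dhom (@ddel p m A) (@ddel p m B) h ->
  exists2 f' : {mpoly B[N]}, forall mm, f'@_mm = h f@_mm &
    forall a, diff_eval del f' (h a) = h (diff_eval del f a).
Proof.
move=> hh; have rh := phom_rrel (dhom_phom hh).
have [|f' hf'] := @mrel_ex _ _ _ rh N f; first by move=> mm; exists (h f@_mm).
exists f' => // a; rewrite /diff_eval; symmetry.
have -> : (fun l : 'I_N => iter l del (h a)) = fun l => h (iter l del a).
  by apply/funext => l; rewrite dhom_iter.
by symmetry; apply: (mrel_meval rh hf').
Qed.

Lemma solved_comp (A B C : dfield) (h : A -> B) (i : B -> C) N (f g : {mpoly A[N]}) :
  dhom (@ddel p m B) (@ddel p m C) i -> solved h f g -> solved (fun x => i (h x)) f g.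
Proof.
move=> hi [a [f' [g' [hf hg f0 g0]]]].
have [f2 hf2 ef2] := dhom_mpoly f' hi; have [g2 hg2 eg2] := dhom_mpoly g' hi.
exists (i a), f2, g2; split.
- by move=> mm; rewrite hf2 hf.
- by move=> mm; rewrite hg2 hg.
- by rewrite ef2 f0 (dhom0 hi).
- by rewrite eg2 (dhom_eq0 hi).
Qed.

Lemma problem_rel (A B : dfield) (R : A -> B -> Prop) N (f g : {mpoly A[N]})
    (f' g' : {mpoly B[N]}) k : phom R -> mrel R f f' -> mrel R g g' ->
  problem f g k -> problem f' g' k.
Proof.
move=> hR hf hg [fk fd g0 gk]; have rR := phom_rrel hR; split.
- by move=> mm; rewrite -(phom_neq0 hR (hf mm)); apply: fk.
- by rewrite -(mrel_neq0 hR (mrel_deriv rR k hf)).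
- by rewrite -(mrel_neq0 hR hg).
- by move=> mm; rewrite -(phom_neq0 hR (hg mm)); apply: gk.
Qed.

Definition prob (A : dfield) : Type := {N : nat & ({mpoly A[N]} * {mpoly A[N]} * 'I_N)%type}.

Definition probP (A : dfield) (q : prob A) : Prop :=
  problem (projT2 q).1.1 (projT2 q).1.2 (projT2 q).2.
Definition solvedP (A B : dfield) (h : A -> B) (q : prob A) : Prop :=
  solved h (projT2 q).1.1 (projT2 q).1.2.

Lemma solve_list (A : dfield) (l : list (prob A)) : exists (B : dfield) (h : A -> B),
  dext h /\ forall q, List.In q l -> probP q -> solvedP h q.
Proof.
elim: l => [|q l [B [h [hh hl]]]]; first by exists A, id; split => //; apply: dext_id.
have [hq|hq] := pselect (probP q); last first.
  by exists B, h; split => // q' /= [<- //|]; exact: hl.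
have dh := hh.1; have ph := dhom_phom dh; have rh := phom_rrel ph.
have [f1 hf1 _] := dhom_mpoly (projT2 q).1.1 dh.
have [g1 hg1 _] := dhom_mpoly (projT2 q).1.2 dh.
have [C [i [hi hs]]] := one_step m_enum (problem_rel ph hf1 hg1 hq).
exists C, (fun x => i (h x)); split; first exact: dext_comp.
move=> q' /= [<- _|h' hq'].
  have [a [f2 [g2 [h1 h2 h3 h4]]]] := hs; exists a, f2, g2; split => // mm.
    by rewrite h1 hf1.
  by rewrite h2 hg1.
by apply: solved_comp (hl _ h' hq'); case: hi.
Qed.

Lemma solve_all (A : dfield) : exists (B : dfield) (h : A -> B),
  dext h /\ forall N (f g : {mpoly A[N]}) k, problem f g k -> solved h f g.
Proof.
have [Bl hBl] := dchoice (@solve_list A); have [hh hhl] := dchoice hBl.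
have [U [hU UL]] := ultra_list (prob A); have [[UT US UI UN] UC] := hU.
have [B [cls [isu _ [uB uM] [u1 ud] uli]]] := ultraproduct m_enum Bl hU.
have [_ ceq _] := isu.
pose H x := cls (fun l => hh l x); have Hext : dext H.
  split; last first.
    move=> J u iu; apply: uli; apply: US UT => l _.
    by have [[_ hl] _] := hhl l; apply: hl.
  have dh l := (hhl l).1.1; split.
  - by rewrite -u1; apply/ceq; apply: US UT => l _; case: (dh l).
  - by move=> x y; rewrite -uB; apply/ceq; apply: US UT => l _; case: (dh l).
  - by move=> x y; rewrite -uM; apply/ceq; apply: US UT => l _; case: (dh l).
  - by move=> x; rewrite -ud; apply/ceq; apply: US UT => l _; case: (dh l).
exists B, H; split => // N f g k hfg.
have hs : U (fun l => solved (hh l) f g).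
  by apply: US (UL (existT _ N (f, g, k))) => l hl; apply: ((hhl l).2 _ hl hfg).
have [s hs'] : exists s : forall l, Bl l, forall l, solved (hh l) f g ->
    exists f' g' : {mpoly (Bl l)[N]}, [/\ forall mm, f'@_mm = hh l f@_mm,
    forall mm, g'@_mm = hh l g@_mm, diff_eval del f' (s l) = 0 & diff_eval del g' (s l) != 0].
  apply: (@dchoice _ Bl (fun l a => solved (hh l) f g ->
    exists f' g' : {mpoly (Bl l)[N]}, [/\ forall mm, f'@_mm = hh l f@_mm,
    forall mm, g'@_mm = hh l g@_mm, diff_eval del f' a = 0 & diff_eval del g' a != 0])) => l.
  have [[a ha]|h] := pselect (solved (hh l) f g); first by exists a.
  by exists 0.
have u0 : cls (fun l => 0) = 0.
  have /ceq e : U (fun l => (1 - 1 : Bl l) = 0) by apply: US UT => l _; rewrite subrr.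
  by rewrite -e uB subrr.
have uD x y : cls (fun l => x l + y l) = cls x + cls y.
  have -> : (fun l => x l + y l) = (fun l => x l - (0 - y l)).
    by apply: functional_extensionality_dep => l; rewrite sub0r opprK.
  by rewrite uB (uB (fun l => 0)) u0 sub0r opprK.
have uX x n : cls (fun l => x l ^+ n) = cls x ^+ n.
  elim: n => [|n IH].
    by rewrite expr0 -u1; apply/ceq; apply: US UT => l _; rewrite expr0.
  by rewrite exprS -IH -uM; apply/ceq; apply: US UT => l _; rewrite exprS.
have usum (J : Type) (r : seq J) (x : J -> forall l, Bl l) :
    cls (fun l => \sum_(j <- r) x j l) = \sum_(j <- r) cls (x j).
  elim: r => [|j r IH].
    by rewrite big_nil -u0; apply/ceq; apply: US UT => l _; rewrite big_nil.
  by rewrite big_cons -IH -uD; apply/ceq; apply: US UT => l _; rewrite big_cons.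
have uprod (J : Type) (r : seq J) (x : J -> forall l, Bl l) :
    cls (fun l => \prod_(j <- r) x j l) = \prod_(j <- r) cls (x j).
  elim: r => [|j r IH].
    by rewrite big_nil -u1; apply/ceq; apply: US UT => l _; rewrite big_nil.
  by rewrite big_cons -IH -uM; apply/ceq; apply: US UT => l _; rewrite big_cons.
have uiter x n : iter n del (cls x) = cls (fun l => iter n del (x l)).
  by elim: n => //= n ->; rewrite ud.
(* Summing over the support of the original [q] gives the value the same shape at every index and in
   the ultraproduct. *)
pose evl (q : {mpoly A[N]}) l : Bl l :=
  \sum_(mm <- msupp q) hh l q@_mm * \prod_(i < N) iter i del (s l) ^+ mm i.
have evE (D : dfield) (h : A -> D) (q : {mpoly A[N]}) (q' : {mpoly D[N]}) a :
    dhom (@ddel p m A) (@ddel p m D) h -> (forall mm, q'@_mm = h q@_mm) ->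
    diff_eval del q' a =
      \sum_(mm <- msupp q) h q@_mm * \prod_(i < N) iter i del a ^+ mm i.
  move=> dh hq; have sub : {subset msupp q' <= msupp q}.
    move=> mm; apply: contraLR => /memN_msupp_eq0 h0.
    by rewrite mcoeff_msupp negbK hq h0 (dhom0 dh).
  rewrite /diff_eval (mpoly_supersupp (msupp_uniq q) sub) raddf_sum /= [RHS](big_nth 0%MM) big_mkord.
  by apply: eq_bigr => i _; rewrite mevalZ mevalX hq.
have evU q q' : (forall mm, q'@_mm = H q@_mm) ->
    diff_eval del q' (cls s) = cls (evl q).
  move=> hq; rewrite (evE B H q q' _ Hext.1 hq) /evl usum; apply: eq_bigr => mm _.
  rewrite uM uprod; congr (_ * _); apply: eq_bigr => i _.
  by rewrite uX uiter.
have [f' hf' _] := dhom_mpoly f Hext.1; have [g' hg' _] := dhom_mpoly g Hext.1.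
exists (cls s), f', g'; split => //.
- rewrite (evU f f' hf') -u0; apply/ceq; apply: US hs => l /hs' [f1 [g1 [h1 _ h3 _]]].
  by rewrite /evl -(evE _ _ f f1 (s l) (hhl l).1.1 h1).
- rewrite (evU g g' hg') -u0; apply/eqP => /ceq e; apply: UN.
  apply: US (UI _ _ hs e) => l [/hs' [f1 [g1 [_ h2 _ h4]]] e0].
  by move: h4; rewrite (evE _ _ g g1 (s l) (hhl l).1.1 h2) -/(evl g l) e0 eqxx.
Qed.

(** * Direct limits of length omega *)

Section Limit.
Variables (A : nat -> dfield) (h : forall n, A n -> A n.+1).
Hypothesis hh : forall n, dext (@h n).

Let K n : fieldType := A n.
Definition cofin (P : nat -> Prop) : Prop := exists n0, forall n, (n0 <= n)%N -> P n.
Definition lcoh (s : forall n, K n) : Prop := cofin (fun n => s n.+1 = h (s n)).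

Lemma cofin2 P Q R : (forall n, P n -> Q n -> R n) -> cofin P -> cofin Q -> cofin R.
Proof.
move=> H [n1 h1] [n2 h2]; exists (maxn n1 n2) => n; rewrite geq_max => /andP [l1 l2].
by apply: H; [apply: h1|apply: h2].
Qed.

Lemma cofin_filter : pfilter cofin.
Proof.
split.
- by exists 0%N.
- by move=> P Q PQ [n0 h0]; exists n0 => n /h0 /PQ.
- by move=> P Q; apply: cofin2.
- by move=> [n0 /(_ n0 (leqnn _))].
Qed.

Lemma lim_spec : fp_spec cofin (K := K) lcoh.
Proof.
have [UT US UI UN] := cofin_filter; have dh n := (hh n).1; split.
- exact: cofin_filter.
- by exists 0%N => n _; case: (dh n).
- by move=> s t; apply: cofin2 => n /= -> ->; case: (dh n).
- by move=> s t; apply: cofin2 => n /= -> ->; case: (dh n).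
- by move=> s [n0 h0]; exists n0 => n hn /=; rewrite (dhomV (dh n)) h0.
move=> s [n0 h0].
have e n : (n0 <= n)%N -> (s n == 0) = (s n0 == 0).
  elim: n => [|n IH]; first by rewrite leqn0 => /eqP ->.
  rewrite leq_eqVlt => /orP [/eqP -> //|hn].
  by rewrite h0 // (dhom_eq0 (dh n)) IH.
have [s0|s0] := boolP (s n0 == 0); [left|right]; exists n0 => n hn.
  by apply/eqP; rewrite e.
by rewrite e.
Qed.

Definition limfield : fieldType := fpfield lim_spec.
Local Notation rep := (@frep nat cofin K lcoh lim_spec).

(** Transport of [x] to later stages. At stages before [n] the value is a default 0, invisible
    modulo [cofin]; [dfwith] performs the cast at stage [n]. *)
Fixpoint tr n (x : A n) k : A k :=
  if k is k'.+1 then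
    if (n <= k')%N then h (tr x k') else dfwith (fun i => 0 : A i) x k'.+1
  else dfwith (fun i => 0 : A i) x 0%N.

Lemma tr_id n (x : A n) : tr x n = x.
Proof. by case: n x => [|n] x /=; rewrite ?ltnn dfwith_in. Qed.

Lemma tr_S n (x : A n) k : (n <= k)%N -> tr x k.+1 = h (tr x k).
Proof. by move=> /= ->. Qed.

Lemma tr_coh n (x : A n) : lcoh (tr x).
Proof. by exists n => k; apply: tr_S. Qed.

Lemma lim_ex n (x : A n) : exists y : limfield, rep y (tr x).
Proof. exact: frep_ex (tr_coh x). Qed.

Definition inj n (x : A n) : limfield := sval (cid (lim_ex x)).
Lemma inj_rep n (x : A n) : rep (inj x) (tr x).
Proof. by rewrite /inj; case: cid. Qed.

Lemma inj_surj n1 (y : limfield) : exists n, (n1 <= n)%N /\ exists x : A n, y = inj x.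
Proof.
have [s hs] := frep_surj y; have [n0 h0] := frep_coh hs.
pose n := maxn n0 n1; exists n; split; first exact: leq_maxr.
exists (s n); apply/(frep_eq hs (inj_rep _)); exists n.
elim=> [|k IH]; first by rewrite leqn0 => /eqP <-; rewrite tr_id.
rewrite leq_eqVlt => /orP [/eqP <-|hk]; first by rewrite tr_id.
rewrite tr_S // -IH // h0 //; apply: leq_trans (leq_maxl _ n1) _; exact: hk.
Qed.

Lemma inj_tr n (x : A n) k : (n <= k)%N -> inj (tr x k) = inj x.
Proof.
move=> hk; apply/(frep_eq (inj_rep _) (inj_rep _)); exists k.
elim=> [|l IH]; first by rewrite leqn0 => /eqP e; subst k; rewrite tr_id.
rewrite leq_eqVlt => /orP [/eqP e|hl]; first by subst k; rewrite tr_id.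
by rewrite !tr_S ?IH // (leq_trans hk).
Qed.

Lemma inj_h n (x : A n) : inj (h x) = inj x.
Proof. by rewrite -(inj_tr x (leqnSn n)) tr_S // tr_id. Qed.

Lemma tr_dhom n k : (n <= k)%N -> dhom (@ddel p m (A n)) (@ddel p m (A k)) (fun x => tr x k).
Proof.
elim: k => [|k IH].
  by rewrite leqn0 => /eqP e; subst n; split=> *; rewrite !tr_id.
rewrite leq_eqVlt => /orP [/eqP e|hk]; first by subst n; split=> *; rewrite !tr_id.
have [t1 tB tM td] := IH hk; have [h1 hB hM hd] := (hh k).1.
by split=> *; rewrite !tr_S // ?t1 ?tB ?tM ?td.
Qed.

Lemma injB n (x y : A n) : inj (x - y) = inj x - inj y.
Proof.
apply/(frep_eq (inj_rep _) (frepB (inj_rep _) (inj_rep _))); exists n => k hk.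
by case: (tr_dhom hk).
Qed.

Lemma injM n (x y : A n) : inj (x * y) = inj x * inj y.
Proof.
apply/(frep_eq (inj_rep _) (frepM (inj_rep _) (inj_rep _))); exists n => k hk.
by case: (tr_dhom hk).
Qed.

Lemma inj1 n : inj (1 : A n) = 1.
Proof.
apply/(frep_eq (inj_rep _) (frep1 lim_spec)); exists n => k hk.
by case: (tr_dhom hk).
Qed.

Lemma inj_rrel n : rrel (fun x y => y = @inj n x).
Proof.
by split=> [|x y q r -> ->|x y q r -> ->]; rewrite ?inj1 ?injB ?injM.
Qed.

Lemma injD n (x y : A n) : inj (x + y) = inj x + inj y.
Proof. by symmetry; apply: (rrelD (inj_rrel n)). Qed.

Lemma inj0 n : inj (0 : A n) = 0.
Proof. by rewrite -(subrr 1) injB subrr. Qed.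

Lemma inj_eq0 n (x : A n) : inj x = 0 -> x = 0.
Proof.
move=> x0; apply/eqP; apply: contra_eqT x0 => x0; apply/eqP => e.
have : inj (x / x) = 0 by rewrite injM e mul0r.
by rewrite divff // inj1 => /eqP; rewrite oner_eq0.
Qed.

Lemma lim_del_ex : exists d : limfield -> limfield, forall n (x : A n), d (inj x) = inj (del x).
Proof.
have /choice [d hd] : forall y : limfield, exists z : limfield,
    forall n (x : A n), y = inj x -> z = inj (del x).
  move=> y; have [n [_ [x ->]]] := inj_surj 0 y; exists (inj (del x)) => k x' e.
  pose l := maxn n k; have hn : (n <= l)%N := leq_maxl _ _; have hk : (k <= l)%N := leq_maxr _ _.
  have e' : tr x l = tr x' l.
    by apply/eqP; rewrite -subr_eq0; apply/eqP/inj_eq0; rewrite injB !inj_tr // e subrr.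
  rewrite -(inj_tr _ hn) -(inj_tr (del x') hk).
  by have [_ _ _ ->] := tr_dhom hn; have [_ _ _ ->] := tr_dhom hk; rewrite e'.
by exists d => n x; apply: hd.
Qed.

Definition limdel : limfield -> limfield := sval (cid lim_del_ex).
Lemma limdelE n (x : A n) : limdel (inj x) = inj (del x).
Proof. by rewrite /limdel; case: cid. Qed.

Lemma inj_common2 (x y : limfield) : exists n (x' y' : A n), x = inj x' /\ y = inj y'.
Proof.
have [n [_ [x1 ->]]] := inj_surj 0 x; have [k [hk [y1 ->]]] := inj_surj n y.
by exists k, (tr x1 k), y1; rewrite inj_tr.
Qed.

Lemma inj_common (J : finType) n0 (y : J -> limfield) :
  exists n (x : J -> A n), (n0 <= n)%N /\ forall j, y j = inj (x j).
Proof.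
have /choice [g hg] : forall j, exists nx : {n : nat & A n}, y j = inj (projT2 nx).
  by move=> j; have [n [_ [x ->]]] := inj_surj 0 (y j); exists (existT _ n x).
pose n := maxn n0 (\max_j projT1 (g j)); exists n, (fun j => tr (projT2 (g j)) n).
split; first exact: leq_maxl.
move=> j; rewrite inj_tr // leq_max; apply/orP; right.
exact: (leq_bigmax (F := fun j => projT1 (g j))).
Qed.

Lemma limdel_derivation : derivation limdel.
Proof.
split=> x y; have [n [x' [y' [-> ->]]]] := inj_common2 x y.
- by rewrite -injD !limdelE (dder (A n)).1 injD.
- by rewrite -injM !limdelE (dder (A n)).2 injD !injM.
Qed.

Lemma lim_pchar : p \in [pchar limfield].
Proof. by apply: fp_pchar => [n|]; [apply: dpchar|exists 0%N]. Qed.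

Lemma tr_lin_indep n k (J : finType) (u : J -> A n) : (n <= k)%N ->
  lin_indep_over_Kp p u -> lin_indep_over_Kp p (fun j => tr (u j) k).
Proof.
move=> hk iu; elim: k hk => [|k IH].
  rewrite leqn0 => /eqP e; subst n.
  by have -> : (fun j => tr (u j) 0) = u by apply/funext => j; rewrite tr_id.
rewrite leq_eqVlt => /orP [/eqP e|hk].
  subst n; by have -> : (fun j => tr (u j) k.+1) = u by apply/funext => j; rewrite tr_id.
have -> : (fun j => tr (u j) k.+1) = fun j => h (tr (u j) k).
  by apply/funext => j; rewrite tr_S.
by apply: (hh k).2; apply: IH.
Qed.

Lemma inj_lin_indep n (J : finType) (u : J -> A n) :
  lin_indep_over_Kp p u -> lin_indep_over_Kp p (fun j => inj (u j)).
Proof.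
move=> iu c c0 j; have [k [x [hk hx]]] := inj_common n c.
have rI := inj_rrel k; rewrite hx (rrelX rI p (erefl (inj (x j)))).
rewrite (tr_lin_indep hk iu (c := x)) ?inj0 //; apply: inj_eq0; rewrite -[RHS]c0.
apply/esym; apply: (rrel_sum rI) => i _; apply: (rrelM rI); last by rewrite inj_tr.
by rewrite hx; apply: (rrelX rI).
Qed.

Lemma lim_DF : DF_field p limdel.
Proof.
split; [exact: limdel_derivation|exact: lim_pchar|].
move=> n; have [_ _ hinf] := ddf (A 0%N); have [u [cu iu]] := hinf n.
exists (fun i => inj (u i)); split; last exact: inj_lin_indep.
by move=> i; rewrite /diff_constant limdelE cu inj0.
Qed.

Hypothesis hs : forall n N (f g : {mpoly (A n)[N]}) k, problem f g k -> solved (@h n) f g.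

(** A problem involves finitely many coefficients, so it comes from some stage and is solved at the
    next one. *)
Lemma limit : exists (D : dfield) (i : A 0%N -> D), dext i /\ sdc D.
Proof.
have [ell hell] := ell_exists m_enum limdel lim_pchar.
pose D : dfield := DField lim_DF hell.
have dI n : dhom (@ddel p m (A n)) (@ddel p m D) (@inj n).
  split; [exact: inj1|exact: injB|exact: injM|by move=> x; rewrite /= limdelE].
exists D, (@inj 0%N); split; first by split; [exact: dI|move=> J u; apply: inj_lin_indep].
move=> N f g k [_ fk] fd g0 gk.
pose S := msupp f ++ msupp g.
have [n [x [_ hx]]] := inj_common 0 (fun l : 'I_(size (msupp f)) => f@_(nth 0%MM (msupp f) l)).
have [n' [y [hn hy]]] := inj_common n (fun l : 'I_(size (msupp g)) => g@_(nth 0%MM (msupp g) l)).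
pose R (y : D) (x : A n') := y = inj x.
have hR : phom R.
  split; first split.
  - by rewrite /R inj1.
  - by move=> a b u v -> ->; rewrite /R injB.
  - by move=> a b u v -> ->; rewrite /R injM.
  - by move=> a /esym /inj_eq0.
  - by move=> a b -> _; exists b^-1; rewrite /R (dhomV (dI n')).
have rR := phom_rrel hR.
have [|f0 hf0] := @mrel_ex _ _ _ rR N f.
  move=> mm; have [hm|hm] := boolP (mm \in msupp f); last first.
    by exists 0; rewrite /R (memN_msupp_eq0 hm) inj0.
  have hl : (index mm (msupp f) < size (msupp f))%N by rewrite index_mem.
  exists (tr (x (Ordinal hl)) n'); rewrite /R inj_tr // -hx /= nth_index //.
have [|g1 hg1] := @mrel_ex _ _ _ rR N g.
  move=> mm; have [hm|hm] := boolP (mm \in msupp g); last first.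
    by exists 0; rewrite /R (memN_msupp_eq0 hm) inj0.
  have hl : (index mm (msupp g) < size (msupp g))%N by rewrite index_mem.
  exists (y (Ordinal hl)); rewrite /R -hy /= nth_index //.
have pf : problem f g k.
  split=> // mm hm l ml.
    by apply: fk; exists mm; rewrite ?mcoeff_msupp // lt0n.
  by apply: gk; exists mm; rewrite ?mcoeff_msupp // lt0n.
have [a [f' [g' [hf' hg' f'0 g'0]]]] := hs (problem_rel hR hf0 hg1 pf).
have [f2 hf2 ef2] := dhom_mpoly f' (dI n'.+1).
have [g2 hg2 eg2] := dhom_mpoly g' (dI n'.+1).
have ef : f2 = f by apply/mpolyP => mm; rewrite hf2 hf' inj_h -hf0.
have eg : g2 = g by apply/mpolyP => mm; rewrite hg2 hg' inj_h -hg1.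
exists (inj a); split; first by rewrite -ef ef2 f'0 inj0.
by rewrite -eg eg2; apply: contra_neq g'0; apply: inj_eq0.
Qed.

End Limit.

Theorem sdc_extension (A : dfield) : exists (D : dfield) (i : A -> D), dext i /\ sdc D.
Proof.
have [nx hnx] := choice solve_all; have [h hh] := dchoice hnx.
pose An n := iter n nx A.
exact: (@limit An (fun n => h (An n)) (fun n => (hh (An n)).1) (fun n => (hh (An n)).2)).
Qed.

End Closure.

(** * First-order logic *)

Section Logic.
Variable L : language.

Lemma scons_eta (T : Type) n (v : 'I_n.+1 -> T) :
  scons (v ord0) (fun j => v (lift ord0 j)) = v.
Proof. by apply/funext => i; rewrite /scons; case: unliftP => [j ->|->]. Qed.

Lemma scons_map (T T' : Type) (h : T -> T') n (x : T) (v : 'I_n -> T) :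
  (fun j => h (scons x v j)) = scons (h x) (fun j => h (v j)).
Proof. by apply/funext => j; rewrite /scons; case: unlift. Qed.

Fixpoint closure n : formula L n -> sentence L :=
  if n is n'.+1 then fun phi => closure (FAll phi) else fun phi => phi.

Lemma valid_all (M : structure L) n (phi : formula L n.+1) :
  valid_in M (FAll phi) <-> valid_in M phi.
Proof.
split=> [h v|h v x]; last exact: h.
by rewrite -(scons_eta v); apply: h.
Qed.

Lemma valid_closure (M : structure L) n (phi : formula L n) :
  valid_in M (closure phi) <-> valid_in M phi.
Proof. by elim: n phi => //= n IH phi; rewrite IH valid_all. Qed.

Lemma class_entails (C : structure L -> Prop) n (phi : formula L n) :
  (forall M, C M -> valid_in M phi) -> entails (theory_of C) phi.
Proof.
move=> h M hM; apply/valid_closure; apply: hM => N CN.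
by apply/valid_closure; apply: h.
Qed.

Lemma class_model (C : structure L -> Prop) M : C M -> is_model (theory_of C) M.
Proof. by move=> CM s; apply. Qed.

Lemma eval_embedding (M N : structure L) (h : M -> N) n (t : term L n) (v : 'I_n -> M) :
  embedding h -> eval (fun j => h (v j)) t = h (eval v t).
Proof.
move=> [_ hi]; elim: t => [//|f args IH] /=.
by rewrite hi; congr interp; apply/funext.
Qed.

Lemma qf_embedding (M N : structure L) (h : M -> N) n (phi : formula L n) (v : 'I_n -> M) :
  embedding h -> quantifier_free phi ->
  holds phi v <-> holds phi (fun j => h (v j)).
Proof.
move=> hh; elim: phi v => {n} [n|n s t|n a IHa b IHb|n a IHa b IHb|n a IHa b IHb|//|//] v //=.
- by rewrite !eval_embedding //; split=> [->//|/hh.1].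
- by move=> [qa qb]; rewrite IHa // IHb.
- by move=> [qa qb]; rewrite IHa // IHb.
- by move=> [qa qb]; rewrite IHa // IHb.
Qed.

Fixpoint rename_term n k (r : 'I_n -> 'I_k) (t : term L n) : term L k :=
  match t with
  | Var i => Var L (r i)
  | App f args => App (fun j => rename_term r (args j))
  end.

Lemma eval_rename (M : structure L) n k (r : 'I_n -> 'I_k) (t : term L n) (u : 'I_k -> M) :
  eval u (rename_term r t) = eval (fun j => u (r j)) t.
Proof. by elim: t => [//|f args IH] /=; congr interp; apply/funext. Qed.

Lemma qf_rename n k (r : 'I_n -> 'I_k) (phi : formula L n) : quantifier_free phi ->
  exists2 psi : formula L k, quantifier_free psi &
    forall (M : structure L) (u : 'I_k -> M), holds psi u <-> holds phi (fun j => u (r j)).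
Proof.
elim: phi r => {n} [n|n s t|n a IHa b IHb|n a IHa b IHb|n a IHa b IHb|//|//] r /=.
- by move=> _; exists FFalse.
- move=> _; exists (FEq (rename_term r s) (rename_term r t)) => // M u /=.
  by rewrite !eval_rename.
- move=> [/(IHa r) [a' qa ha] /(IHb r) [b' qb hb]]; exists (FImp a' b') => // M u /=.
  by rewrite ha hb.
- move=> [/(IHa r) [a' qa ha] /(IHb r) [b' qb hb]]; exists (FAnd a' b') => // M u /=.
  by rewrite ha hb.
- move=> [/(IHa r) [a' qa ha] /(IHb r) [b' qb hb]]; exists (FOr a' b') => // M u /=.
  by rewrite ha hb.
Qed.

(** The list may contain any formulas; those outside [P] are dropped by a classical case
    distinction. *)
Lemma conjunction n (P : formula L n -> Prop) (l : list (formula L n)) :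
  (forall phi, P phi -> quantifier_free phi) ->
  exists2 psi, quantifier_free psi & forall (M : structure L) (v : 'I_n -> M),
    holds psi v <-> forall phi, List.In phi l -> P phi -> holds phi v.
Proof.
move=> Pq; elim: l => [|phi l [psi qpsi hpsi]].
  by exists (FNot FFalse) => //= M v; split.
have [hP|hP] := pselect (P phi).
  exists (FAnd phi psi) => /= [|M v]; first by split => //; apply: Pq.
  rewrite hpsi; split=> [[h1 h2] chi [<- //|]|h]; first exact: h2.
  by split=> [|chi hc]; apply: h => //; [left|right].
exists psi => // M v; rewrite hpsi; split=> [h chi [<- //|]|h chi hc]; first exact: h.
by apply: h; right.
Qed.

Lemma In_nth (T : Type) (x0 x : T) (s : seq T) : List.In x s ->
  exists2 i, (i < size s)%N & nth x0 s i = x.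
Proof.
elim: s => //= y s IH [->|/IH [i hi <-]]; first by exists 0%N.
by exists i.+1.
Qed.

Lemma index_fun (T : Type) (x0 : T) (s : seq T) : exists idx : T -> 'I_(size s).+1,
  forall x, List.In x s -> nth x0 s (idx x) = x.
Proof.
suff /choice [f hf] : forall x, exists i : 'I_(size s).+1, List.In x s -> nth x0 s i = x.
  by exists f.
move=> x; have [/(In_nth x0) [i hi hx]|h] := pselect (List.In x s); last by exists ord0.
by exists (inord i) => _; rewrite inordK // ltnW // ltnS.
Qed.

End Logic.

(** * Replacing constant symbols by variables *)

Section Constants.
Variables (L : language) (C : Type) (c0 : C).
Let LC := with_constants L C.

Definition noarg (T : Type) (j : 'I_0) : T :=
  False_rect T (notF (ltn_ord j)).

Lemma noargE (T : Type) (f g : 'I_0 -> T) : f = g.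
Proof. by apply/funext => -[]. Qed.

Definition reduct (N : structure LC) : structure L :=
  @Structure L N (fun f x => @interp LC N (inl f) x).

Definition cval (N : structure LC) (c : C) : N := @interp LC N (inr c) (@noarg N).

Lemma eval_lift (N : structure LC) n (t : term L n) (v : 'I_n -> N) :
  eval (M := N) v (lift_term C t) = eval (M := reduct N) v t.
Proof.
elim: t => [//|f args IH] /=; congr (@interp LC N (inl f)).
by apply/funext.
Qed.

Lemma holds_lift (N : structure LC) n (phi : formula L n) (v : 'I_n -> N) :
  holds (M := N) (lift_formula C phi) v <-> holds (M := reduct N) phi v.
Proof.
elim: phi v => {n} [n|n s t|n a IHa b IHb|n a IHa b IHb|n a IHa b IHb|n a IH|n a IH] v //=.
- by rewrite !eval_lift.
- by rewrite IHa IHb.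
- by rewrite IHa IHb.
- by rewrite IHa IHb.
- by split=> h x; apply/IH; apply: h.
- by split=> -[x h]; exists x; apply/IH.
Qed.

(* Constant symbols become variables after the [n] free ones, out of the way of
   the binders, which act on variable 0. *)
Definition join (N : structure LC) (w : seq C) n (v : 'I_n -> N)
    (i : 'I_(n + (size w).+1)) : N :=
  match split i with inl j => v j | inr k => cval N (nth c0 w k) end.

Arguments join {N} w {n} v i.

Lemma join_scons (N : structure LC) (w : seq C) n (x : N) (v : 'I_n -> N) :
  scons x (join w v) = (join w (scons x v) : 'I_(n + (size w).+1).+1 -> N).
Proof.
apply/funext => i; case: (unliftP ord0 i) => [i' ->|->]; last first.
  rewrite /scons unlift_none /join.
  have -> : (ord0 : 'I_(n + (size w).+1).+1) = lshift (size w).+1 (ord0 : 'I_n.+1).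
    exact: val_inj.
  by rewrite (unsplitK (inl _)) unlift_none.
rewrite /scons liftK /join; case: (split_ordP i') => [j ->|k ->].
  have -> : (lift ord0 (lshift (size w).+1 j) : 'I_(n + (size w).+1).+1) =
      lshift (size w).+1 (lift ord0 j : 'I_n.+1) by exact: val_inj.
  by rewrite (unsplitK (inl _)) liftK.
have -> : (lift ord0 (rshift n k) : 'I_(n + (size w).+1).+1) = rshift n.+1 k.
  exact: val_inj.
by rewrite (unsplitK (inr _)).
Qed.

(** The translation works for every list containing [w], so that one common list serves all
    arguments of a symbol and both sides of a connective. *)
Lemma term_constants n (t : term LC n) : exists w : list C, forall w' : list C,
  (forall c, List.In c w -> List.In c w') -> exists t' : term L (n + (size w').+1),
  forall (N : structure LC) (v : 'I_n -> N),
    eval v t = eval (M := reduct N) (join w' v) t'.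
Proof.
elim: t => [i|[f|c] args IH].
- exists nil => w' _; exists (Var L (lshift _ i)) => N v /=.
  by rewrite /join (unsplitK (inl _)).
- have /choice [w hw] := IH; exists (flatten [seq w j | j <- enum 'I_(arity f)]) => w' hw'.
  have /choice [t' ht'] : forall j, exists t' : term L (n + (size w').+1),
      forall (N : structure LC) (v : 'I_n -> N),
      eval v (args j) = eval (M := reduct N) (join w' v) t'.
    move=> j; apply: hw => c hc; apply: hw'.
    have : j \in enum 'I_(arity f) by rewrite mem_enum.
    elim: (enum _) => //= j' s IHs; rewrite inE => /orP [/eqP <-|/IHs h].
      by apply/List.in_app_iff; left.
    by apply/List.in_app_iff; right.
  exists (@App L _ f t') => N v /=; congr (@interp LC N (inl f)).
  by apply/funext => j; rewrite ht'.
exists [:: c] => w' hw'; have [|i hi e] := @In_nth _ c0 c w'; first by apply: hw'; left.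
exists (Var L (rshift n (inord i))) => N v /=.
rewrite /join (unsplitK (inr _)) inordK 1?ltnW // e /cval.
by congr (@interp LC N (inr c)); apply: noargE.
Qed.

Lemma formula_constants n (phi : formula LC n) : exists w : list C, forall w' : list C,
  (forall c, List.In c w -> List.In c w') -> exists phi' : formula L (n + (size w').+1),
  forall (N : structure LC) (v : 'I_n -> N),
    holds phi v <-> holds (M := reduct N) phi' (join w' v).
Proof.
have two (P Q : list C -> Prop) : (exists w : list C, forall w' : list C,
    (forall c, List.In c w -> List.In c w') -> P w') ->
    (exists w : list C, forall w' : list C,
    (forall c, List.In c w -> List.In c w') -> Q w') ->
    exists w : list C, forall w' : list C,
    (forall c, List.In c w -> List.In c w') -> P w' /\ Q w'.
  move=> [w hw] [u hu]; exists (w ++ u) => w' hw'; split.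
    by apply: hw => c hc; apply: hw'; apply/List.in_app_iff; left.
  by apply: hu => c hc; apply: hw'; apply/List.in_app_iff; right.
elim: phi => {n} [n|n s t|n a IHa b IHb|n a IHa b IHb|n a IHa b IHb|n a [w hw]|n a [w hw]].
- by exists nil => w' _; exists FFalse.
- have [w hw] := two _ _ (term_constants s) (term_constants t).
  exists w => w' /hw [[s' hs] [t' ht]]; exists (FEq s' t') => N v /=.
  by rewrite hs ht.
- have [w hw] := two _ _ IHa IHb.
  exists w => w' /hw [[s' hs] [t' ht]]; exists (FImp s' t') => N v /=.
  by rewrite hs ht.
- have [w hw] := two _ _ IHa IHb.
  exists w => w' /hw [[s' hs] [t' ht]]; exists (FAnd s' t') => N v /=.
  by rewrite hs ht.
- have [w hw] := two _ _ IHa IHb.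
  exists w => w' /hw [[s' hs] [t' ht]]; exists (FOr s' t') => N v /=.
  by rewrite hs ht.
- exists w => w' /hw [a' ha]; exists (@FAll L (n + (size w').+1) a') => N v /=.
  split=> h x; have := h x; rewrite join_scons; first by move=> /ha.
  by move=> h'; apply/ha.
- exists w => w' /hw [a' ha]; exists (@FEx L (n + (size w').+1) a') => N v /=.
  by split=> -[x h]; exists x; move: h; rewrite join_scons => /ha.
Qed.

End Constants.
Arguments join {L C} c0 {N} w {n} v i.

(** * Models of the diagram as embeddings *)

Section Diagram.
Variables (L : language) (M : structure L).
Let LM := with_constants L M.

Definition cst (c : M) : term LM 0 := @App LM 0 (inr c) (@noarg _).

Lemma eval_cst (N : structure LM) (c : M) (v : 'I_0 -> N) : eval v (cst c) = cval N c.
Proof. by rewrite /= /cval; congr (@interp LM N (inr c)); apply: noargE. Qed.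

Lemma diagram_embedding (N : structure LM) : is_model (diagram M) N ->
  embedding (M := M) (N := reduct N) (cval N).
Proof.
move=> hN; split.
- move=> c d; apply: contraPP => cd.
  have /hN/(_ (@noarg _)) /= : diagram M (FNot (FEq (cst c) (cst d))).
    split; first by exists (cst c), (cst d); right.
    by move=> v /=.
  by rewrite !(noargE (fun j => eval _ _) (@noarg N)).
- move=> f x.
  have /hN/(_ (@noarg _)) : diagram M (FEq (@App LM 0 (inl f) (fun j => cst (x j))) (cst (interp x))).
    by split; [exists (@App LM 0 (inl f) (fun j => cst (x j))), (cst (interp x)); left|move=> v /=].
  move=> e; have {e} : eval (@noarg N) (@App LM 0 (inl f) (fun j => cst (x j))) = eval (@noarg N) (cst (interp x)) by [].
  rewrite eval_cst => <- /=; congr (@interp LM N (inl f)).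
  by apply/funext => j; rewrite -(eval_cst (x j) (@noarg N)).
Qed.

Definition expand (N : structure L) (h : M -> N) : structure LM :=
  @Structure LM N (fun s => match s with
    | inl f => fun x => @interp L N f x
    | inr c => fun _ => h c end).

Lemma expand_diagram (N : structure L) (h : M -> N) : embedding h ->
  is_model (diagram M) (expand h).
Proof.
move=> hh s [ls vs] v.
have he : embedding (M := name_elements M) (N := expand h) h.
  by split; [exact: hh.1|case=> [f|c] x //=; exact: hh.2].
have qs : quantifier_free s by case: ls => s1 [s2 [->|->]].
have := vs (@noarg _); rewrite (qf_embedding _ he qs).
by rewrite (noargE (fun j => h _) v).
Qed.

End Diagram.

Lemma expand_theory L (T : theory L) (M N : structure L) (h : M -> N) tau :
  is_model T N -> T tau -> valid_in (expand h) (lift_formula M tau).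
Proof.
(* Once [N] is destructed, the reduct of [expand h] is convertible to it. *)
case: N h => K i h hN ht v; apply/holds_lift.
exact: (hN tau ht v).
Qed.

(** * Quantifier elimination and the model completion *)

Section Main.
Variables (p : nat) (m : forall n : nat, 'I_(p ^ n) -> {ffun 'I_n -> 'I_p}).
Arguments m : clear implicits.
Hypothesis m_enum : forall n : nat, bijective (m n).

Local Notation dfield := (dfield m).
Local Notation Ldl := (L_dl p).

Lemma DF_entails n (phi : formula Ldl n) :
  (forall A : dfield, valid_in (dstr A) phi) -> entails (DF m) phi.
Proof.
move=> h; apply: class_entails => _ [K [d [ell [hd hell ->]]]].
exact: (h (DField hd hell)).
Qed.

Lemma SDCF_entails n (phi : formula Ldl n) :
  (forall A : dfield, sdc A -> valid_in (dstr A) phi) -> entails (SDCF m) phi.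
Proof.
move=> h; apply: class_entails => _ [K [d [ell [[hd hs] hell ->]]]].
exact: (h (DField hd hell) hs).
Qed.

Lemma SDCF_dstr (A : dfield) : sdc A -> is_model (SDCF m) (dstr A).
Proof.
move=> hA; apply: class_model; exists (A : fieldType), (@ddel p m A), (@dell p m A).
by split => //; [split => //; apply: ddf|move=> n x; apply: dell_spec].
Qed.

Lemma DF_SDCF M : is_model (SDCF m) M -> is_model (DF m) M.
Proof.
move=> hM s hs; apply: hM => _ [K [d [ell [[hd hsd] hell ->]]]].
by apply: hs; exists K, d, ell.
Qed.

Lemma compactness n (S : formula Ldl n -> Prop) :
  (forall l : list (formula Ldl n), exists (A : dfield) (v : 'I_n -> A), sdc A /\
     forall phi, List.In phi l -> S phi -> holds (M := dstr A) phi v) ->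
  exists (A : dfield) (v : 'I_n -> A), sdc A /\
     forall phi, S phi -> holds (M := dstr A) phi v.
Proof.
move=> /dchoice [A hA]; have [v hv] := dchoice hA.
have [U [hU UL]] := ultra_list (formula Ldl n); have [[UT US UI UN] UC] := hU.
have [B [cls [isu usdc _ _ _]]] := ultraproduct m_enum A hU.
exists B, (fun j => cls (fun l => v l j)); split.
  by apply: usdc; apply: US UT => l _; case: (hv l).
move=> phi hphi.
rewrite (los hU isu (fun l => ex_intro _ (0 : A l) Logic.I) phi (fun j l => v l j)).
by apply: US (UL phi) => l hl; have [_] := hv l; apply.
Qed.

(** Suppose no formula works. By compactness some [b] satisfies all quantifier-free consequences of
    [FEx theta] but not [FEx theta]. Then the quantifier-free type of [b] is consistent with
    [FEx theta], so some [a] has the same type and a witness. The embedding test carries the witness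
    into an elementary extension of [N], a contradiction. *)
Lemma eliminate_ex n (theta : formula Ldl n.+1) : quantifier_free theta ->
  exists2 psi : formula Ldl n, quantifier_free psi &
    forall (A : dfield) (v : 'I_n -> A), sdc A ->
      holds (M := dstr A) (FEx theta) v <-> holds (M := dstr A) psi v.
Proof.
move=> qth.
pose G (psi : formula Ldl n) := quantifier_free psi /\
  forall (A : dfield) (v : 'I_n -> A), sdc A ->
    holds (M := dstr A) (FEx theta) v -> holds (M := dstr A) psi v.
apply: contrapT => H.
have [|N [b [hN hb]]] := @compactness n (fun phi => G phi \/ phi = FNot (FEx theta)).
  move=> l; apply: contrapT => nl; apply: H.
  have [|psi qpsi hpsi] := @conjunction Ldl n G l; first by move=> phi [].
  exists psi => // A v hA; split=> [h|/hpsi h].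
    by apply/hpsi => phi _ [_]; apply.
  apply: contrapT => nh; apply: nl; exists A, v; split => // phi hl [hG|->].
    exact: h.
  exact: nh.
have nb : ~ holds (M := dstr N) (FEx theta) b by apply: (hb (FNot (FEx theta))); right.
pose D (psi : formula Ldl n) := quantifier_free psi /\ holds (M := dstr N) psi b.
have [|M [a [hM ha]]] := @compactness n (fun phi => D phi \/ phi = FEx theta).
  move=> l; apply: contrapT => nl.
  have [|psi qpsi hpsi] := @conjunction Ldl n D l; first by move=> phi [].
  have : holds (M := dstr N) (FNot psi) b.
    apply: hb; left; split=> // A v hA ex hv; apply: nl; have h := (hpsi (dstr A) v).1 hv; exists A, v; split => //.
    by move=> phi hl [hD|->]; [apply: h|].
  by move=> hn; exact: (hn ((hpsi (dstr N) b).2 (fun phi _ hD => hD.2))).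
have same phi : quantifier_free phi ->
    holds (M := dstr M) phi a <-> holds (M := dstr N) phi b.
  move=> qphi; split=> [h|h]; last by apply: ha; left.
  apply: contrapT => nh; have : holds (M := dstr M) (FNot phi) a; last by apply.
  by apply: ha; left; split.
have [N' [k [h [_ ek eh hk]]]] := embedding_test m_enum hN same.
have [x hx] : exists x, holds (M := dstr M) theta (scons x a).
  by apply: (ha (FEx theta)); right.
apply: nb; apply/ek; exists (h x).
have -> : (fun i => k (b i)) = (fun j => h (a j)) by apply/funext => j.
by rewrite -(scons_map h x a); apply/(qf_embedding _ eh qth).
Qed.

Theorem SDCF_qe n (phi : formula Ldl n) : exists2 psi : formula Ldl n,
  quantifier_free psi & forall (A : dfield) (v : 'I_n -> A), sdc A ->
    holds (M := dstr A) phi v <-> holds (M := dstr A) psi v.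
Proof.
elim: phi => {n} [n|n s t|n a [a' qa ha] b [b' qb hb]|n a [a' qa ha] b [b' qb hb]|
  n a [a' qa ha] b [b' qb hb]|n a [a' qa ha]|n a [a' qa ha]].
- by exists FFalse.
- by exists (FEq s t).
- by exists (FImp a' b') => //= A v hA; rewrite ha // hb.
- by exists (FAnd a' b') => //= A v hA; rewrite ha // hb.
- by exists (FOr a' b') => //= A v hA; rewrite ha // hb.
- have [|psi qpsi hpsi] := @eliminate_ex n (FNot a'); first by [].
  exists (FNot psi) => // A v hA /=; rewrite -hpsi //=; split=> [h [x nx]|h x].
    by apply: nx; apply/ha.
  by apply/ha => //; apply: contrapT => nx; apply: h; exists x.
have [psi qpsi hpsi] := eliminate_ex qa; exists psi => // A v hA; rewrite -hpsi //=.
by split=> -[x hx]; exists x; apply/ha.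
Qed.

Lemma SDCF_iff n (phi : formula Ldl n) : exists2 psi : formula Ldl n,
  quantifier_free psi & forall M : structure Ldl, is_model (SDCF m) M ->
    forall v : 'I_n -> M, holds phi v <-> holds psi v.
Proof.
have [psi qpsi hpsi] := SDCF_qe phi; exists psi => // M hM v.
have [|h1 h2] := @SDCF_entails n (FIff phi psi) _ M hM v; last by split.
by move=> A hA u; have [h1 h2] := hpsi A u hA; split.
Qed.

Lemma SDCF_model_complete : model_complete (SDCF m).
Proof.
move=> M N h hM hN eh n phi v; have [psi qpsi hpsi] := SDCF_iff phi.
by rewrite hpsi // (qf_embedding _ eh qpsi) -hpsi.
Qed.

(* Finitely many quantifier-free facts about elements of [M] hold for some
   elements of a differential field, as their negation is not in the theory;
   the ultraproduct over finite lists of facts realizes the diagram. *)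
Lemma DF_embeds M : is_model (DF m) M -> embeds_into_model M (SDCF m).
Proof.
move=> hM; pose x0 : M := @interp Ldl M (SZero p) (@noarg M).
pose fact := {n : nat & (formula Ldl n * ('I_n -> M))%type}.
pose good (f : fact) := quantifier_free (projT2 f).1 /\ holds (projT2 f).1 (projT2 f).2.
have step (l : list fact) : exists (D : dfield) (g : M -> D), sdc D /\
    forall f, List.In f l -> good f ->
      holds (M := dstr D) (projT2 f).1 (fun j => g ((projT2 f).2 j)).
  have [w hw0] : exists w : list M, forall f j, List.In f l -> List.In ((projT2 f).2 j) w.
    exists (flatten [seq codom (projT2 f).2 | f <- l]) => f j.
    elim: l => //= f' l IH [->|/IH h]; apply/List.in_app_iff; [left|by right].
    rewrite codomE; have : j \in enum 'I_(projT1 f) by rewrite mem_enum.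
    elim: (enum _) => //= j' s IHs; rewrite inE => /orP [/eqP ->|/IHs]; by [left|right].
  have [idx hidx] := index_fun x0 w; pose u0 (i : 'I_(size w).+1) := nth x0 w i.
  have hw f j : List.In f l -> u0 (idx ((projT2 f).2 j)) = (projT2 f).2 j.
    by move=> hf; apply: hidx; apply: hw0.
  have [Psi qPsi hPsi] : exists2 Psi : formula Ldl (size w).+1, quantifier_free Psi &
      forall (N : structure Ldl) (u : 'I_(size w).+1 -> N), holds Psi u <->
        forall f, List.In f l -> good f ->
          holds (projT2 f).1 (fun j => u (idx ((projT2 f).2 j))).
    move: (size w).+1 idx {hidx u0 hw hw0} => K idx; elim: l => [|f l IH].
      by exists (FNot FFalse) => //= N u; split.
    have [Psi qPsi hPsi] := IH; have [hf|hf] := pselect (good f); last first.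
      exists Psi => // N u; rewrite hPsi; split=> [h f' [<- //|]|h f' hf']; first exact: h.
      by apply: h; right.
    have [psi qpsi hpsi] := qf_rename (fun j => idx ((projT2 f).2 j)) hf.1.
    exists (FAnd psi Psi) => //= N u; rewrite hpsi hPsi.
    split=> [[h1 h2] f' [<- //|]|h]; first exact: h2.
    by split=> [|f' hf']; apply: h => //; [left|right].
  have : holds Psi u0.
    apply/hPsi => f hf [_ hv]; have -> // : (fun j => u0 (idx ((projT2 f).2 j))) = (projT2 f).2.
    by apply/funext => j; apply: hw.
  have [[A [u hu]] _|nA h0] := pselect (exists (A : dfield) (u : 'I_(size w).+1 -> A),
      holds (M := dstr A) Psi u); last first.
    have [] := @DF_entails _ (FNot Psi) _ M hM u0 h0.
    by move=> A v hv; apply: nA; exists A, v.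
  have [D [i [[di li] hD]]] := sdc_extension m_enum A.
  have ei : embedding (M := dstr A) (N := dstr D) i.
    by apply: (dstr_embedding m_enum di) => n v _; apply: li.
  exists D, (fun x => i (u (idx x))); split => // f hf gf.
  by apply/(qf_embedding _ ei gf.1); move/hPsi: hu; apply.
have [A hA] := dchoice step; have [g hg] := dchoice hA.
have [U [hU UL]] := ultra_list fact; have [[UT US UI UN] UC] := hU.
have [B [cls [isu usdc _ _ _]]] := ultraproduct m_enum A hU.
pose h x := cls (fun l => g l x).
have key n (phi : formula Ldl n) v : quantifier_free phi -> holds phi v ->
    holds (M := dstr B) phi (fun j => h (v j)).
  move=> qphi hv.
  rewrite (los hU isu (fun l => ex_intro _ (0 : A l) Logic.I) phi (fun j l => g l (v j))).
  by apply: US (UL (existT _ n (phi, v))) => l hl; have [_ hgl] := hg l; apply: (hgl _ hl).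
exists (dstr B), h; split.
  by apply: SDCF_dstr; apply: usdc; apply: US UT => l _; case: (hg l).
split=> [x y|f x].
  apply: contraPP => nxy e.
  pose phi : formula Ldl 2 := FNot (FEq (Var _ ord0) (Var _ ord_max)).
  have := @key 2 phi (fun j => if j == ord0 then x else y) (conj I I).
  by apply => //= exy; apply: nxy.
pose k := dl_arity f.
pose phi : formula Ldl k.+1 :=
  FEq (@App Ldl k.+1 f (fun j => Var _ (lift ord0 j))) (Var _ ord0).
have := @key k.+1 phi (scons (interp x) x) I; rewrite /= /scons unlift_none.
have lK (j : 'I_k) : unlift ord0 (lift ord0 j) = Some j by rewrite liftK.
under [X in interp X = _]funext => j do rewrite lK.
move=> /(_ erefl) <-; congr (@interp Ldl (dstr B) f); apply/funext => j.
by rewrite liftK.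
Qed.

(** A sentence with names for elements of [M] is a formula at a tuple of [M], hence equivalent to a
    quantifier-free one; its truth is decided in [M], which embeds over the names into every
    model. *)
Lemma SDCF_diagram_complete M : is_model (DF m) M -> complete (add_diagram (SDCF m) M).
Proof.
move=> hM; split.
  have [N [h [hN eh]]] := DF_embeds hM; exists (expand h) => s [[tau ht ->]|hs].
    exact: expand_theory ht.
  exact: (expand_diagram eh hs).
move=> s; pose x0 : M := @interp Ldl M (SZero p) (@noarg M).
have [w hw] := formula_constants x0 s; have [//|phi hphi] := hw w.
have [psi qpsi hpsi] := SDCF_iff phi.
pose a := join x0 (N := name_elements M) w (@noarg _).
have key (N : structure (with_constants Ldl M)) (v : 'I_0 -> N) :
    is_model (add_diagram (SDCF m) M) N -> holds s v <-> holds (M := M) psi a.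
  move=> hN; rewrite hphi hpsi; last first.
    move=> tau ht u; apply/holds_lift; apply: hN; left; by exists tau.
  have eN : embedding (M := M) (N := reduct N) (cval N).
    by apply: diagram_embedding => t ht; apply: hN; right.
  rewrite (qf_embedding _ eN qpsi).
  have -> // : join x0 w v = fun j => cval N (a j).
  by apply/funext => j; rewrite /join /a /join; case: split => [[]|].
have [h|h] := pselect (holds (M := M) psi a); [left|right] => N hN v.
  exact/key.
by move=> /(key N v hN).
Qed.

End Main.

Theorem theorem6p6 (p : nat) (p_prime : prime p)
    (m : forall n : nat, 'I_(p ^ n) -> {ffun 'I_n -> 'I_p})
    (m_enum : forall n : nat, bijective (m n)) :
  has_quantifier_elimination (SDCF m) /\ model_completion (SDCF m) (DF m).
Proof.
split.
  move=> n phi; have [psi qpsi hpsi] := SDCF_iff m_enum phi.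
  by exists psi; split => // M hM v; have [h1 h2] := hpsi M hM v; split.
split; last exact: SDCF_diagram_complete.
split; [exact: DF_embeds| |exact: SDCF_model_complete].
by move=> M hM; exists M, id; split; [apply: DF_SDCF|split].
Qed.
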